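(* Let $F$ be a continuous distribution function symmetric about zero, and $G$ a continuous distribution function with zero median; let $\varepsilon_n\in(0,1]$ with $\varepsilon_n\to0$ and $\mu_n>0$. Assume that $F$ and $G$ have densities $f$ and $g$ that are positive everywhere. The longest-run test, which rejects for large values of $L$, is asymptotically powerless if there is a sequence $(x_n)$ such that $$n\bar F(x_n)\to0,\quad n\varepsilon_nG(-x_n-\mu_n)\to0,\quad n\varepsilon_n\bar G(x_n-\mu_n)\to0,\qquad( * )$$ and $$\varepsilon_n(\log n)\sup_{0\le y\le x_n}\frac{[g(y-\mu_n)-g(-y-\mu_n)]_+}{f(y)+\varepsilon_ng(y-\mu_n)}\to0.$$ It is asymptotically powerful if either: (i) there is a sequence $(x_n)$ such that $$n\bar F(x_n)\to0,\quad n\varepsilon_nG(-x_n-\mu_n)\to0,\quad n\varepsilon_n\bar G(x_n-\mu_n)\gg\log n;$$ or (ii) there is a sequence $(x_n)$ satisfying $( * )$, another sequence $(x_n')$ with $0\le x_n'\le x_n$, as well as fixed constants $a\in(0,1)$, $b<1-\log(2-a)/\log 2$ and $c,d>0$, such that $$\varepsilon_n\inf_{x_n'\le x\le x_n'+c}\frac{g(x-\mu_n)-g(-x-\mu_n)}{f(x)+\varepsilon_ng(x-\mu_n)}\ge a$$ and $$\inf_{x_n'\le x\le x_n'+c}\big(f(x)+\varepsilon_ng(x-\mu_n)\big)\ge d\,n^{-b}.$$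
   Context: Testing problem: for each $n$ one observes $X_1,\dots,X_n\in\mathbb{R}$ and tests $H_0^n$: $X_1,\dots,X_n$ are i.i.d. with distribution function $F(x)$, versus $H_1^n$: $X_1,\dots,X_n$ are i.i.d. with distribution function $(1-\varepsilon_n)F(x)+\varepsilon_n G(x-\mu_n)$. Limits are as $n\to\infty$. Notation: $\bar F=1-F$, $\bar G=1-G$, $u_+=\max(u,0)$; $a_n\gg b_n$ means $b_n/a_n\to0$; $F$ symmetric about zero means $F(-x)=1-F(x)$ for all $x$. Longest-run statistic: order the observations so that $|X_{(1)}|>\cdots>|X_{(n)}|$ (almost surely there are no ties), put $\xi_{(i)}=\mathrm{sign}(X_{(i)})\in\{-1,1\}$; $L$ is the length of the longest run of pluses, i.e. the largest $\ell\ge0$ such that there is $j$ with $\xi_{(j+1)}=\cdots=\xi_{(j+\ell)}=1$. A test based on a statistic $S$ is asymptotically powerful (resp. powerless) if the total variation distance between the distribution of $S$ under $H_0^n$ and its distribution under $H_1^n$ tends to $2$ (resp. $0$) as $n\to\infty$; here total variation is normalized as $\|P-Q\|=2\sup_A|P(A)-Q(A)|$, so that $2$ is its maximal value. *)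

(* Defs.v *)
From mathcomp Require Export all_boot all_order all_algebra.
From mathcomp Require Export all_classical all_reals all_analysis.
Export Order.TTheory GRing.Theory Num.Theory numFieldNormedType.Exports.

Set Implicit Arguments.
Unset Strict Implicit.
Unset Printing Implicit Defensive.

Local Open Scope classical_set_scope.
Local Open Scope ring_scope.

(* The events range over full families; taking [A i = setT] for some of the
   indices gives the product rule for every subfamily. *)
Definition mutually_independent (d d' : measure_display)
    (T : measurableType d) (T' : measurableType d') (R : realType)
    (P : probability T R) (I : finType) (X : I -> {RV P >-> T'}) : Prop :=
  forall A : I -> set T', (forall i, measurable (A i)) ->
    P (\bigcap_(i in [set: I]) X i @^-1` A i)
      = (\prod_(i : I) P (X i @^-1` A i))%E.
Arguments mutually_independent {d d' T T' R} P {I} X.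

Definition iid_with_cdf (d : measure_display) (T : measurableType d)
    (R : realType) (P : probability T R) (I : finType)
    (X : I -> {RV P >-> R}) (H : R -> R) : Prop :=
  mutually_independent P X /\ forall i x, cdf (X i) x = (H x)%:E.
Arguments iid_with_cdf {d T R} P {I} X H.

Definition is_density (R : realType) (H h : R -> R) : Prop :=
  [/\ measurable_fun [set: R] h, forall x, 0 <= h x &
      forall x, (H x)%:E
        = (\int[lebesgue_measure]_(t in `]-oo, x]) (h t)%:E)%E].

Definition contaminated_cdf (R : realType) (F G : R -> R) (eps mu : R) : R -> R :=
  fun x => (1 - eps) * F x + eps * G (x - mu).

(* Signs of the observations, listed by decreasing absolute value.  In case of
   ties the order is whatever [sort] returns, and a null observation has sign 0;
   both have probability zero under continuous distribution functions. *)
Definition ordered_signs (R : realType) (s : seq R) : seq R :=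
  [seq Num.sg x | x <- sort (fun x y : R => `|y| <= `|x|) s].

(* Positions outside the list read as the default 0, hence are not pluses, so
   that no run can overshoot the sample. *)
Definition longest_run (R : realType) (s : seq R) : nat :=
  \max_(l < (size s).+1 | [exists j : 'I_(size s).+1,
      [forall i : 'I_l, (ordered_signs s)`_(j + i) == 1]]) l.

Definition longest_run_statistic (d : measure_display) (T : measurableType d)
    (R : realType) (n : nat) (X : 'I_n -> {mfun T >-> R}) (w : T) : nat :=
  longest_run [seq X i w | i <- enum 'I_n].

(* Normalized so that two mutually singular probabilities are at distance 2. *)
Definition total_variation (d : measure_display) (T : measurableType d)
    (R : realType) (P Q : set T -> \bar R) : \bar R :=
  (2%:E * ereal_sup [set `|P A - Q A| | A in [set A | measurable A]])%E.

Definition asymptotically_powerful (R : realType) (d : nat -> measure_display)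
    (T : forall n, measurableType (d n)) (P0 P1 : forall n, probability (T n) R)
    (dU : measure_display) (U : measurableType dU) (S : forall n, T n -> U) : Prop :=
  total_variation (pushforward (P0 n) (S n)) (pushforward (P1 n) (S n))
    @[n --> \oo] --> 2%:E.

Definition asymptotically_powerless (R : realType) (d : nat -> measure_display)
    (T : forall n, measurableType (d n)) (P0 P1 : forall n, probability (T n) R)
    (dU : measure_display) (U : measurableType dU) (S : forall n, T n -> U) : Prop :=
  total_variation (pushforward (P0 n) (S n)) (pushforward (P1 n) (S n))
    @[n --> \oo] --> 0%:E.

(* [a n >> b n].  The quotient is meaningful when [a n != 0] for large [n], as
   division by zero returns zero. *)
Definition dominates (R : realType) (a b : nat -> R) : Prop :=
  b n / a n @[n --> \oo] --> (0 : R).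

Definition tails_vanish (R : realType) (F G : R -> R) (eps mu x : nat -> R) : Prop :=
  [/\ n%:R * (1 - F (x n)) @[n --> \oo] --> (0 : R),
      n%:R * eps n * G (- x n - mu n) @[n --> \oo] --> (0 : R) &
      n%:R * eps n * (1 - G (x n - mu n)) @[n --> \oo] --> (0 : R)].

(* Main.v *)
(* List the signs by decreasing absolute value of the observations.  Given the
   absolute values they are independent, and under the null they are fair, so
   that the longest run is close to log2 n.  Cutting the half-line into so many
   small cells that ties are improbable turns this conditioning into finite sums.

   Powerless: couple the signs with fair ones.  The longest runs can differ only
   if both are shorter than l = log2 n - m, or if a disagreement falls in a
   window of l pluses of one of the two words.  The second event is rare because
   a disagreement has small probability: towards plus by the hypothesis on the
   supremum, and on average also towards minus, since the zero median of G makes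
   the contaminated distribution favour pluses.

   Powerful (i): the observations beyond x_n are listed first and are pluses, and
   there are more than 2 log2 n of them.

   Powerful (ii): about n^(1 - b) observations have an absolute value in the
   window, each is a plus with probability at least 1 / (2 - a), and this creates
   a run of length gam * log2 n for some gam > 1, too long for fair signs. *)

From HB Require Import structures.
Require Import Defs.
From mathcomp Require Import measurable_realfun ring lra zify.

Set Implicit Arguments.
Unset Strict Implicit.
Unset Printing Implicit Defensive.

Local Open Scope classical_set_scope.
Local Open Scope ring_scope.

(** * Runs and expectations over words of independent letters *)

(** In the powerless case the coupled sign sequences may disagree at many places: the hypothesis
    only makes [eps * s * ln n] small, not [n * eps * s]. What counts is a disagreement inside a
    window of [l] pluses. With [l] = log2 n - [m] there are about 2^m such windows on average, each
    with about log2 n positions, so the harmful disagreements number about 2^m log n [eps * s]; this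
    is the origin of the factor log n. The offset [m] is chosen from the target accuracy before n
    grows: large enough for a fair word to have a run of length [l], yet fixed, so that 2^m does not
    spoil the other terms. The probability of having no run must then be bounded without losing a
    factor log n.

    In the window case, a plus probability 1 / (2 - a) gives a run of length [gam] log2 n at a given
    place with probability about n^(- gam log2 (2 - a)), and there are n^(1 - b) places up to
    logarithms. Some [gam] > 1 succeeds exactly when log2 (2 - a) < 1 - b, which is the condition on
    b. Every bound is proved for cells of mass at most [eta], and [eta] then tends to 0 with n
    fixed. *)

Definition has_run (l : nat) (b : seq bool) : bool :=
  [exists j : 'I_(size b).+1, [forall i : 'I_l, nth false b (j + i)]].

Definition run_length (b : seq bool) : nat :=
  \max_(l < (size b).+1 | has_run l b) l.

Lemma has_runP l b :
  reflect (exists j, forall i, (i < l)%N -> nth false b (j + i)) (has_run l b).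
Proof.
apply: (iffP existsP) => [[j /forallP jl]|[j jl]].
  by exists j => i il; exact: (jl (Ordinal il)).
case: l jl => [|l] jl; first by exists ord0; apply/forallP => -[].
have jb : (j < (size b).+1)%N.
  by rewrite ltnS leqNgt; apply/negP => bj; have := jl 0%N isT; rewrite nth_default// addn0 ltnW.
by exists (Ordinal jb); apply/forallP => i; exact: jl.
Qed.

Lemma has_run_sub l l' b : (l <= l')%N -> has_run l' b -> has_run l b.
Proof.
by move=> ll' /has_runP[j jl]; apply/has_runP; exists j => i il; apply/jl/(leq_trans il).
Qed.

Lemma has_run_size l b : has_run l b -> (l <= size b)%N.
Proof.
case: l => // l /has_runP[j /(_ l (ltnSn l))]; case: (ltnP (j + l) (size b)) => [jb _|bj].
  by apply: leq_ltn_trans jb; rewrite leq_addl.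
by rewrite nth_default.
Qed.

(** Runs can be shortened, so the maximum dominates exactly the lengths that occur. Through this the
    longest run is handled by [has_run] alone. *)
Lemma leq_run_length l b : (l <= run_length b)%N = has_run l b.
Proof.
have h0 : has_run (ord0 : 'I_(size b).+1) b by apply/has_runP; exists 0%N.
apply/idP/idP => [lb|hb].
  have [i hi e] := @eq_bigmax_cond _ [pred i : 'I_(size b).+1 | has_run i b] (fun i => i : nat)
    (ltac:(by apply/card_gt0P; exists ord0)).
  by apply: has_run_sub lb _; rewrite /run_length e.
have lb := has_run_size hb.
exact: (@leq_bigmax_cond _ [pred i : 'I_(size b).+1 | has_run i b] (fun i => i : nat) (Ordinal (lb : l < (size b).+1)%N)).
Qed.

Lemma has_run_infix l s1 s2 s3 : has_run l s2 -> has_run l (s1 ++ s2 ++ s3).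
Proof.
move=> /has_runP[j jl]; apply/has_runP; exists (size s1 + j)%N => i il.
rewrite nth_cat -addnA ltnNge leq_addr /= addKn nth_cat; case: ltnP => [_|h]; first exact: jl.
by have := jl i il; rewrite nth_default.
Qed.

Lemma has_run_catr l s1 s2 : has_run l s2 -> has_run l (s1 ++ s2).
Proof. by move=> h; have := has_run_infix s1 [::] h; rewrite cats0. Qed.

Lemma has_run_cons l b : has_run l b -> forall c, has_run l (c :: b).
Proof. by move=> h c; have := has_run_catr [:: c] h. Qed.

Lemma has_run_nseq l b : has_run l (nseq l true ++ b).
Proof. by apply/has_runP; exists 0%N => i il; rewrite nth_cat size_nseq add0n il nth_nseq il. Qed.

(* A run not contained in [b] must use the leading pluses, but these are cut
   off by the minus that follows them. *)
Lemma has_run_blocked l k b :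
  (k < l)%N -> has_run l (nseq k true ++ false :: b) -> has_run l b.
Proof.
move=> kl /has_runP[j jl]; case: (leqP j k) => jk.
  have := jl (k - j)%N; rewrite subnKC// nth_cat size_nseq ltnn subnn /=.
  by rewrite (leq_ltn_trans (leq_subr _ _) kl) => /(_ isT).
apply/has_runP; exists (j - k.+1)%N => i il.
have := jl i il; rewrite nth_cat size_nseq.
have -> : (j + i < k)%N = false by lia.
by have -> : (j + i - k = (j - k.+1 + i).+1)%N by lia.
Qed.

Section expectation.
Variables (R : realFieldType) (C : finType) (I : Type).
Implicit Types (w : I -> C -> R) (r : seq I) (phi psi : seq C -> R).

(* Expectation of [phi] over words of independent letters, the letter at the
   position of [i] in [r] having law [w i]. *)
Fixpoint expct w r phi : R :=
  if r is i :: r' then \sum_c w i c * expct w r' (fun s => phi (c :: s))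
  else phi [::].

Lemma eq_expct w r phi psi :
  (forall s, size s = size r -> phi s = psi s) -> expct w r phi = expct w r psi.
Proof.
elim: r phi psi => [|i r ih] phi psi e /=; first exact: e.
by apply: eq_bigr => c _; congr (_ * _); apply: ih => s sr; apply: e; rewrite /= sr.
Qed.

Lemma le_expct w r phi psi : (forall i c, 0 <= w i c) ->
  (forall s, size s = size r -> phi s <= psi s) -> expct w r phi <= expct w r psi.
Proof.
move=> w0; elim: r phi psi => [|i r ih] phi psi e /=; first exact: e.
by apply: ler_sum => c _; apply: ler_wpM2l => //; apply: ih => s sr; apply: e; rewrite /= sr.
Qed.

Lemma expctD w r phi psi :
  expct w r (fun s => phi s + psi s) = expct w r phi + expct w r psi.
Proof.
elim: r phi psi => //= i r ih phi psi.
by rewrite -big_split; apply: eq_bigr => c _; rewrite ih mulrDr.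
Qed.

Lemma expctZ w r a phi : expct w r (fun s => a * phi s) = a * expct w r phi.
Proof.
elim: r phi => //= i r ih phi.
by rewrite big_distrr; apply: eq_bigr => c _; rewrite ih /= mulrCA.
Qed.

Lemma expctB w r phi psi :
  expct w r (fun s => phi s - psi s) = expct w r phi - expct w r psi.
Proof.
rewrite -[- expct w r psi]mulN1r -expctZ -expctD.
by apply: eq_expct => s _; rewrite mulN1r.
Qed.

Lemma expct_cst w r a : (forall i, \sum_c w i c = 1) -> expct w r (fun=> a) = a.
Proof. by move=> w1; elim: r => //= i r ->; rewrite -big_distrl /= w1 mul1r. Qed.

Lemma expct_sum w r (J : Type) (t : seq J) (P : pred J) (F : J -> seq C -> R) :
  (forall i, \sum_c w i c = 1) ->
  expct w r (fun s => \sum_(j <- t | P j) F j s) = \sum_(j <- t | P j) expct w r (F j).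
Proof.
move=> w1; elim: t => [|j t ih].
  by rewrite big_nil -[RHS](expct_cst r 0 w1); apply: eq_expct => s _; rewrite big_nil.
rewrite big_cons -ih -expctD; case: ifP => Pj; last first.
  by apply: eq_expct => s _; rewrite big_cons Pj.
by apply: eq_expct => s _; rewrite big_cons Pj.
Qed.

Lemma expct_cat w r1 r2 phi :
  expct w (r1 ++ r2) phi = expct w r1 (fun s1 => expct w r2 (fun s2 => phi (s1 ++ s2))).
Proof. by elim: r1 phi => //= i r1 ih phi; apply: eq_bigr => c _; rewrite ih. Qed.

(** Independence: letters before and after the window sum to 1, those inside factor. All run
    probabilities are reduced to this product. *)
Lemma expct_window w r (i0 : I) (c0 : C) (a : nat -> C -> R) (j l : nat) :
  (forall i, \sum_c w i c = 1) -> (j + l <= size r)%N ->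
  expct w r (fun s => \prod_(i < l) a i (nth c0 s (j + i)))
    = \prod_(i < l) \sum_c w (nth i0 r (j + i)) c * a i c.
Proof.
move=> w1; elim: j r => [|j ih] r; last first.
  case: r => // i r jl /=; under eq_bigr do rewrite ih//.
  by rewrite -big_distrl/= w1 mul1r.
elim: l a r => [|l ihl] a r lr.
  by rewrite big_ord0 -[RHS](expct_cst r 1 w1); apply: eq_expct => s _; rewrite big_ord0.
case: r lr => // i r lr /=; rewrite big_ord_recl /= big_distrl /=.
apply: eq_bigr => c _; rewrite -mulrA; congr (_ * _).
rewrite -(ihl (fun i => a i.+1))// -expctZ.
by apply: eq_expct => s _; rewrite big_ord_recl.
Qed.

Lemma norm_expct_le w r phi psi : (forall i c, 0 <= w i c) ->
  (forall s, size s = size r -> `|phi s| <= psi s) -> `|expct w r phi| <= expct w r psi.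
Proof.
move=> w0 h; rewrite ler_norml -mulN1r -expctZ; apply/andP; split; apply: le_expct => // s /h.
  by rewrite mulN1r ler_norml => /andP[].
by rewrite ler_norml => /andP[].
Qed.

End expectation.

Lemma expct_map (R : realFieldType) (C D : finType) (I : Type) (w : I -> C -> R)
    (v : I -> D -> R) (f : C -> D) (r : seq I) (phi : seq D -> R) :
  (forall i d, v i d = \sum_(c | f c == d) w i c) ->
  expct w r (fun s => phi (map f s)) = expct v r phi.
Proof.
move=> vE; elim: r phi => //= i r ih phi.
rewrite (partition_big f xpredT)//=; apply: eq_bigr => d _.
by rewrite vE big_distrl /=; apply: eq_bigr => c /eqP <-; rewrite -ih.
Qed.

Lemma expct_cst_law (R : realFieldType) (C : finType) (I J : Type) (w : C -> R)
    (r : seq I) (r' : seq J) (phi : seq C -> R) : size r = size r' ->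
  expct (fun=> w) r phi = expct (fun=> w) r' phi.
Proof. by elim: r r' phi => [[]|i r ih [|j r']] //= phi [e]; apply: eq_bigr => c _; rewrite (ih r'). Qed.

Lemma eq_in_expct (R : realFieldType) (C : finType) (I : eqType)
    (w v : I -> C -> R) (r : seq I) (phi : seq C -> R) :
  {in r, forall i c, w i c = v i c} -> expct w r phi = expct v r phi.
Proof.
elim: r phi => //= i r ih phi h; apply: eq_bigr => c _.
rewrite h ?mem_head// ih// => j jr; apply: h; exact: mem_behead.
Qed.

(** Passes from a product law on functions to the law of the word read along [r]; coordinates
    outside [r] are summed out. *)
Lemma sum_ffun_expct (R : realFieldType) (C I : finType) (w : I -> C -> R)
    (r : seq I) (phi : seq C -> R) : uniq r ->
  \sum_(s : {ffun I -> C}) (\prod_i w i (s i)) * phi (map s r)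
    = expct w r phi * \prod_(i | i \notin r) \sum_c w i c.
Proof.
elim: r w phi => [|i r ih] w phi.
  by move=> _; rewrite /= -big_distrl /= -bigA_distr_bigA mulrC.
move=> /= /andP[ir ur].
(* Weights that force the value [c] at [i]: one coordinate is split off while the functions keep
   their domain [I]. *)
pose w' c j d := if j == i then (d == c)%:R * w i c else w j d.
transitivity (\sum_c \sum_(s : {ffun I -> C}) (\prod_j w' c j (s j)) * phi (c :: map s r)).
  rewrite exchange_big /=; apply: eq_bigr => s _.
  rewrite (bigD1 (s i)) //= [X in _ + X]big1 ?addr0; last first.
    move=> c ci; rewrite (bigD1 i)//= {1}/w' eqxx eq_sym (negPf ci) !mul0r//.
  congr (_ * _); apply: eq_bigr => j _; rewrite /w'.
  by case: eqP => // ->; rewrite eqxx mul1r.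
rewrite big_distrl /=; apply: eq_bigr => c _.
rewrite (ih _ (fun s => phi (c :: s)))// (bigD1 i)//=.
rewrite (eq_in_expct (v := w)); last first.
  by move=> j jr d; rewrite /w'; case: eqP jr ir => // -> ->.
rewrite (mulrC (w i c)) -mulrA; congr (_ * (_ * _)).
  rewrite (bigD1 c)//= /w' !eqxx mul1r big1 ?addr0// => d /negPf ->.
  by rewrite mul0r.
apply: eq_big => [j|j /andP[_ /negPf ji]]; first by rewrite inE negb_or andbC.
by rewrite /w' ji.
Qed.

Lemma prod_cst_ord (R : realFieldType) (l : nat) (x : R) : \prod_(i < l) x = x ^+ l.
Proof. by rewrite prodr_const card_ord. Qed.

Definition bern (R : realFieldType) (p : R) (b : bool) : R := if b then p else 1 - p.

Arguments bern {R}.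

Lemma bern_ge0 (R : realFieldType) (p : R) b : 0 <= p <= 1 -> 0 <= bern p b.
Proof. by case: b => /= h; lra. Qed.

Lemma sum_bern (R : realFieldType) (p : R) : \sum_b bern p b = 1.
Proof. by rewrite big_bool /=; lra. Qed.

(** * Runs in sequences of independent signs *)

Section runs.
Variable R : realFieldType.

Definition fair (n : nat) (phi : seq bool -> R) : R :=
  expct (fun _ : unit => bern (1 / 2)) (nseq n tt) phi.

Lemma bern_half b : bern (1 / 2 : R) b = 1 / 2.
Proof. by case: b => /=; lra. Qed.

Let half_ge0 (i : unit) b : 0 <= bern (1 / 2 : R) b.
Proof. by rewrite bern_half; lra. Qed.

Let half_sum (i : unit) : \sum_b bern (1 / 2 : R) b = 1.
Proof. exact: sum_bern. Qed.

Lemma fair_expct (I : Type) (r : seq I) phi :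
  expct (fun=> bern (1 / 2 : R)) r phi = fair (size r) phi.
Proof. by apply: expct_cst_law; rewrite size_nseq. Qed.

(** Cut the word into [q] disjoint blocks of length [l]: without a run, each of these independent
    blocks contains a minus. *)
Lemma le_prob_no_run (I : eqType) (p : I -> R) (r : seq I) (p0 : R) (q l : nat) :
  0 <= p0 <= 1 -> (forall i, 0 <= p i <= 1) -> {in r, forall i, p0 <= p i} ->
  (q * l <= size r)%N ->
  expct (bern \o p) r (fun s => (~~ has_run l s)%:R) <= (1 - p0 ^+ l) ^+ q.
Proof.
move=> p01 p1; have w0 i b : 0 <= (bern \o p) i b by exact: bern_ge0.
have w1 i : \sum_b (bern \o p) i b = 1 by exact: sum_bern.
have pl : 0 <= 1 - p0 ^+ l by rewrite subr_ge0 exprn_ile1; lra.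
elim: q r => [|q ih] r rp sr.
  rewrite expr0 -[leRHS](expct_cst r 1 w1).
  by apply: le_expct => // s _; rewrite lern1 leq_b1.
have {1}-> : r = take l r ++ drop l r by rewrite cat_take_drop.
have slr : size (take l r) = l.
  by rewrite size_takel//; apply: leq_trans sr; rewrite mulSn leq_addr.
rewrite expct_cat exprS.
(* The product is the indicator of a first block made of pluses only. Then there is a run; otherwise
   the rest of the word must still avoid one, and the induction hypothesis applies. *)
apply: (@le_trans _ _ (expct (bern \o p) (take l r) (fun s1 =>
    (1 - \prod_(i < l) (nth false s1 (0 + i))%:R) * (1 - p0 ^+ l) ^+ q))).
  apply: le_expct => // s1; rewrite slr => s1l.
  have [h|h] := boolP [forall i : 'I_l, nth false s1 i].
    have -> : s1 = nseq l true.
      apply: (@eq_from_nth _ false); rewrite ?size_nseq// => i il; rewrite nth_nseq.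
      by rewrite s1l in il; rewrite il; move/forallP/(_ (Ordinal il)): h.
    rewrite big1; last by move=> i _; rewrite add0n nth_nseq ltn_ord.
    rewrite subrr mul0r -[leRHS](expct_cst (drop l r) 0 w1).
    by apply: le_expct => // s _; rewrite has_run_nseq.
  have [i hi] : exists i : 'I_l, ~~ nth false s1 i by apply/existsP; rewrite -negb_forall.
  rewrite (bigD1 i)//= add0n (negPf hi) mul0r subr0 mul1r.
  apply: (le_trans _ (ih (drop l r) _ _)).
  - apply: le_expct => // s _; rewrite ler_nat.
    case: (boolP (has_run l s)) => [hr|_]; last exact: leq_b1.
    by rewrite has_run_catr.
  - by move=> j /mem_drop; exact: rp.
  - by rewrite size_drop; move: sr; rewrite mulSn; lia.
under eq_expct do rewrite mulrC.
rewrite expctZ mulrC; apply: ler_wpM2r; first exact: exprn_ge0.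
rewrite expctB expct_cst//.
case: r rp sr slr => [|i0 r'] rp sr slr.
  have -> : l = 0%N by move: slr; case: (l).
  by rewrite /= big_ord0 expr0.
rewrite (expct_window i0 false (fun _ b => (b : bool)%:R) (j := 0%N))// ?slr ?add0n//.
rewrite lerB// -prod_cst_ord.
apply: ler_prod => i _; rewrite big_bool /= mulr1 mulr0 addr0.
case/andP: p01 => -> _ /=; apply: rp; apply: (mem_subseq (take_subseq _ l)).
by apply: mem_nth; rewrite slr add0n.
Qed.

(** Disjoint blocks would give an exponent near [n / l], and a factor log n would be lost. Instead,
    deleting the first letter gives a recursion on the length: the words that start with [l] pluses
    and a minus and have no run afterwards lose their only run by the deletion. Hence [a m.+1] is at
    most [a m] minus 2^-(l+1) times [a (m - l)], and [a] is nonincreasing. *)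
Lemma le_fair_no_run (n l : nat) : (l <= n)%N ->
  fair n (fun s => (~~ has_run l s)%:R) <= (1 - (1 / 2) ^+ l.+1) ^+ (n - l).
Proof.
set a := fun n => fair n (fun s => (~~ has_run l s)%:R).
have a0 m : 0 <= a m.
  rewrite -[leLHS](expct_cst (nseq m tt) 0 half_sum).
  by apply: le_expct => // s _.
have aS m : a m.+1 <= a m.
  rewrite -[leRHS]mul1r -(sum_bern (1 / 2 : R)) /a /fair /= big_distrl /=.
  apply: ler_sum => b _; apply: ler_wpM2l; first exact: half_ge0 tt b.
  apply: le_expct => // s _.
  by rewrite ler_nat; case: (boolP (has_run l s)) => [/has_run_cons ->|]//; rewrite leq_b1.
have a_mono m k : a (m + k)%N <= a m.
  by elim: k => [|k ih]; rewrite ?addn0// addnS; apply: le_trans ih.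
have rec m : (l <= m)%N -> a m.+1 <= a m - (1 / 2) ^+ l.+1 * a (m - l)%N.
  move=> lm.
  (* The words with a run of length [l] that disappears when the first letter is removed because it
     is cut off by the minus. *)
  pose blk s := (take l.+1 s == rcons (nseq l true) false) && ~~ has_run l (drop l.+1 s).
  have blkE : fair m.+1 (fun s => (blk s)%:R) = (1 / 2) ^+ l.+1 * a (m - l)%N.
    rewrite /fair; have -> : nseq m.+1 tt = nseq l.+1 tt ++ nseq (m - l) tt.
      by rewrite -nseqD addSn subnKC.
    rewrite expct_cat.
    transitivity (expct (fun _ : unit => bern (1 / 2 : R)) (nseq l.+1 tt)
       (* The product is the indicator of the prefix of [l] pluses and one minus, written for
          [expct_window]. *)
       (fun s1 => a (m - l)%N * \prod_(i < l.+1) (nth false s1 (0 + i) == (i < l)%N)%:R)).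
      apply: eq_expct => s1; rewrite size_nseq => s1l.
      have [e|ne] := eqVneq s1 (rcons (nseq l true) false).
        rewrite big1 ?mulr1; last first.
          move=> i _; rewrite add0n e nth_rcons size_nseq nth_nseq.
          by case: (ltnP i l) => il; rewrite ?eqxx//; case: ifP; rewrite eqxx.
        apply: eq_expct => s2 _; rewrite /blk take_cat s1l ltnn subnn take0 cats0 e eqxx.
        by rewrite drop_cat -e s1l ltnn subnn drop0.
      have [i hi] : exists i : 'I_l.+1, nth false s1 i != (i < l)%N.
        apply/existsP; rewrite -negb_forall; apply: contra ne => /forallP h.
        apply/eqP/(@eq_from_nth _ false); rewrite ?size_rcons ?size_nseq// => i.
        rewrite s1l => il; rewrite (eqP (h (Ordinal il))) nth_rcons size_nseq nth_nseq /=.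
        by case: ifP => //; case: ifP.
      rewrite (bigD1 i)//= add0n (negPf hi) mul0r mulr0.
      rewrite -[RHS](expct_cst (nseq (m - l) tt) 0 half_sum).
      apply: eq_expct => s2 _; rewrite /blk take_cat s1l ltnn subnn take0 cats0.
      by rewrite (negPf ne).
    rewrite expctZ mulrC (expct_window tt false (fun i b => (b == (i < l)%N)%:R) (j := 0%N))//;
      last by rewrite size_nseq.
    congr (_ * _); rewrite -prod_cst_ord; apply: eq_bigr => i _.
    by rewrite big_bool !bern_half; case: (i < l)%N => /=; rewrite ?mulr1 ?mulr0 ?addr0 ?add0r.
  rewrite -blkE lerBrDr.
  have -> : a m = fair m.+1 (fun s => (~~ has_run l (behead s))%:R).
    by rewrite /fair /= -big_distrl /= sum_bern mul1r.
  rewrite -expctD; apply: le_expct => // s; rewrite size_nseq => sm.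
  rewrite -natrD ler_nat.
  have [bs|_] := boolP (blk s); last first.
    rewrite addn0; have [|nr] := boolP (has_run l (behead s)); last by rewrite leq_b1.
    by case: s sm => // c s sm /has_run_cons -> .
  move/andP: bs => [/eqP st nr]; rewrite -(cat_take_drop l.+1 s) st -cats1 -catA /=.
  rewrite has_run_nseq add0n.
  case: (posnP l) => [l0|lp].
    by move: nr; rewrite l0; case/has_runP; exists 0%N.
  have -> : behead (nseq l true ++ false :: drop l.+1 s) = nseq l.-1 true ++ false :: drop l.+1 s.
    by case: (l) lp.
  case: (boolP (has_run l _)) => // /has_run_blocked; rewrite prednK// => /(_ (leqnn _)) h.
  by rewrite h in nr.
move=> /subnK <-; elim: (n - l)%N => [|k ih].
  rewrite add0n subnn expr0 -[leRHS](expct_cst (nseq l tt) 1 half_sum).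
  by apply: le_expct => // s _; rewrite lern1 leq_b1.
rewrite addnK; rewrite addnK in ih.
have c0 : 0 <= 1 - (1 / 2 : R) ^+ l.+1 by rewrite subr_ge0 exprn_ile1; lra.
apply: le_trans (rec (k + l)%N (leq_addl _ _)) _.
rewrite [leRHS]exprS; apply: le_trans (ler_wpM2l c0 ih); rewrite mulrBl; apply: lerB; first by rewrite [leRHS]mul1r.
by apply: ler_wpM2l; [apply: exprn_ge0; lra|rewrite addnK a_mono].
Qed.

(** Union bound over the starting position; there are [n - l + 1] of them, at most [n] because [l]
    is positive. *)
Lemma fair_run_le (n l : nat) : (0 < l)%N ->
  fair n (fun s => (has_run l s)%:R) <= n%:R * (1 / 2) ^+ l.
Proof.
move=> l0.
have [ln|nl] := leqP l n; last first.
  apply: (@le_trans _ _ 0); last by apply: mulr_ge0 => //; apply: exprn_ge0; lra.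
  rewrite -[leRHS](expct_cst (nseq n tt) 0 half_sum); apply: le_expct => // s.
  rewrite size_nseq => sn; case: (boolP (has_run l s)) => // /has_run_size.
  by rewrite sn leqNgt nl.
apply: (@le_trans _ _ (fair n (fun s =>
    \sum_(j < (n - l).+1) \prod_(i < l) (nth false s (j + i))%:R))).
  apply: le_expct => // s; rewrite size_nseq => sn.
  have [/has_runP[j jl]|_] := boolP (has_run l s); last first.
    by apply: sumr_ge0 => j _; apply: prodr_ge0.
  have jn : (j < (n - l).+1)%N.
    have := jl l.-1; rewrite prednK// => /(_ (leqnn _)).
    by case: (ltnP (j + l.-1) n) => [|h]; [lia|rewrite nth_default// sn].
  rewrite (bigD1 (Ordinal jn))//= big1 => [|i _]; last by rewrite jl.
  by rewrite lerDl; apply: sumr_ge0 => k _; apply: prodr_ge0.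
rewrite /fair expct_sum//.
apply: (@le_trans _ _ (\sum_(j < (n - l).+1) (1 / 2) ^+ l)); last first.
  by rewrite sumr_const card_ord -[leLHS]mulr_natl; apply: ler_wpM2r; [apply: exprn_ge0; lra|rewrite ler_nat; lia].
apply: ler_sum => j _; rewrite (expct_window tt false (fun _ b => (b : bool)%:R))//; last first.
  by rewrite size_nseq; have := ltn_ord j; lia.
rewrite -prod_cst_ord; apply: ler_prod => i _.
by rewrite big_bool !bern_half /= mulr0n mulr1n; lra.
Qed.

End runs.

(** * Coupling with fair signs *)

(* Monotone coupling of a fair bit (first component) and a bit of parameter [p]. *)
Definition coupling (R : realFieldType) (p : R) (c : bool * bool) : R :=
  match c with
  | (true, true) => Num.min p (1 / 2)
  | (true, false) => 1 / 2 - Num.min p (1 / 2)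
  | (false, true) => p - Num.min p (1 / 2)
  | (false, false) => 1 / 2 - p + Num.min p (1 / 2)
  end.

Section coupling.
Variable R : realFieldType.
Implicit Types p : R.

Lemma coupling_ge0 p c : 0 <= p <= 1 -> 0 <= coupling p c.
Proof. by case: c => [[] []] /=; case: (lerP p (1 / 2)) => h1 h2; lra. Qed.

Lemma big_bool2 (F : bool * bool -> R) (P : pred (bool * bool)) : \sum_(c | P c) F c =
  (if P (true, true) then F (true, true) else 0) + (if P (true, false) then F (true, false) else 0) +
  (if P (false, true) then F (false, true) else 0) + (if P (false, false) then F (false, false) else 0).
Proof.
rewrite big_mkcond; transitivity (\sum_a \sum_b (if P (a, b) then F (a, b) else 0)).
  by rewrite pair_bigA; apply: eq_bigr => -[].
by rewrite !big_bool /= !addrA.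
Qed.

Lemma sum_coupling p : \sum_c coupling p c = 1.
Proof. by rewrite big_bool2 /=; lra. Qed.

Lemma coupling_fst p b : bern (1 / 2) b = \sum_(c | c.1 == b) coupling p c.
Proof. by rewrite big_bool2 /=; case: b => /=; lra. Qed.

Lemma coupling_snd p b : bern p b = \sum_(c | c.2 == b) coupling p c.
Proof. by rewrite big_bool2 /=; case: b => /=; lra. Qed.

Lemma has_run_window l (b : seq bool) j :
  (forall i, (i < l)%N -> nth false b (j + i)) -> (0 < l)%N -> (j < (size b - l).+1)%N.
Proof.
move=> jl l0; have := jl l.-1; rewrite prednK// => /(_ (leqnn _)).
by case: (ltnP (j + l.-1) (size b)) => [|h]; [lia|rewrite nth_default].
Qed.

(* If the longest run of [b] is longer than that of [b'], one of its positions
   is a minus of [b']; such a position lies in a window of [l] pluses of [b]. *)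
Lemma shorter_run_disagrees (b b' : seq bool) (l : nat) :
  (0 < l)%N -> has_run l b -> (run_length b' < run_length b)%N ->
  exists j q, [/\ (j < (size b - l).+1)%N, (q < l)%N, ~~ nth false b' (j + q)
    & forall i, (i < l)%N -> nth false b (j + i)].
Proof.
move=> l0 hl lt; have := leqnn (run_length b); rewrite {1}leq_run_length => /has_runP[j jr].
have lr : (l <= run_length b)%N by rewrite leq_run_length.
have : ~~ has_run (run_length b) b' by rewrite -leq_run_length -ltnNge.
have [/forallP h|] := boolP [forall q : 'I_(run_length b), nth false b' (j + q)].
  by case/has_runP; exists j => i il; exact: (h (Ordinal il)).
rewrite negb_forall => /existsP[q hq] _.
(* Start of a window of length [l] inside the long run that covers offset [q]: start at [q] itself,
   unless this overshoots the run, and then take the last window. *)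
pose j' := (j + minn q (run_length b - l))%N.
have jl i : (i < l)%N -> nth false b (j' + i).
  by move=> il; rewrite /j' -addnA; apply: jr; have := ltn_ord q; lia.
exists j', (q - minn q (run_length b - l))%N; split => //.
- exact: has_run_window.
- by have := ltn_ord q; lia.
- by have -> : (j' + (q - minn q (run_length b - l)) = j + q)%N by rewrite /j'; lia.
Qed.

(** The three terms are: no run of length [l] in the fair word; a window of [l] fair pluses with a
    minus of the other word; the same with the words exchanged. Excess over 1/2 is bounded uniformly
    by [dlt], since it also raises the probability of a window of pluses; a deficit may be large at
    some letters and enters only through its sum. The test function [chi] is arbitrary so as to
    reach total variation. *)
Lemma run_length_law_gap (I : eqType) (p : I -> R) (r : seq I) (l : nat) (dlt : R)
    (chi : nat -> R) :
  (forall i, 0 <= p i <= 1) -> (forall i, p i <= 1 / 2 + dlt) -> 0 <= dlt ->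
  (forall k, 0 <= chi k <= 1) -> (0 < l <= size r)%N ->
  `|expct (fun i => bern (p i)) r (chi \o run_length) - fair (size r) (chi \o run_length)|
    <= (1 - (1 / 2) ^+ l.+1) ^+ (size r - l)
     + l%:R * (1 / 2) ^+ l.-1 * (\sum_(i <- r) Num.max (1 / 2 - p i) 0)
     + (size r)%:R * l%:R * (dlt * (1 / 2 + dlt) ^+ l.-1).
Proof.
move=> p01 pd d0 chi01 /andP[l0 lr].
pose w i := coupling (p i).
have w0 i c : 0 <= w i c by exact: coupling_ge0.
have w1 i : \sum_c w i c = 1 by exact: sum_coupling.
set n := size r.
rewrite -(@expct_map _ _ _ _ w _ snd); last by move=> i b; exact: coupling_snd.
rewrite -(@fair_expct _ _ r) -(@expct_map _ _ _ _ w _ fst); last by move=> i b; exact: coupling_fst.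
rewrite -expctB.
(* Condition on the letter at offset [i] of a window where the fair word has only pluses and the
   other word a minus at offset [q]; [B] exchanges the two words. *)
pose A (q i : nat) (c : bool * bool) : R := (c.1 && ((i == q) ==> ~~ c.2))%:R.
pose B (q i : nat) (c : bool * bool) : R := (c.2 && ((i == q) ==> ~~ c.1))%:R.
pose V (E : nat -> nat -> bool * bool -> R) s := \sum_(j < (n - l).+1) \sum_(q < l)
  \prod_(i < l) E q i (nth (false, false) s (j + i)).
have E0 q i c : 0 <= A q i c /\ 0 <= B q i c by split; rewrite ler0n.
have V0 s : 0 <= V A s /\ 0 <= V B s.
  by split; apply: sumr_ge0 => j _; apply: sumr_ge0 => q _; apply: prodr_ge0 => i _; case: (E0 q i (nth (false,false) s (j + i))).
apply: (@le_trans _ _ (expct w r (fun s =>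
   ((~~ has_run l (map fst s))%:R + V A s) + V B s))).
  apply: norm_expct_le => // s sr /=.
  have [VA0 VB0] := V0 s.
  case: (eqVneq (run_length (map snd s)) (run_length (map fst s))) => [->|ne].
    by rewrite subrr normr0 !addr_ge0// ler0n.
  have chi_le1 : `|chi (run_length (map snd s)) - chi (run_length (map fst s))| <= 1.
    by have := chi01 (run_length (map snd s)); have := chi01 (run_length (map fst s));
       rewrite ler_norml; lra.
  apply: le_trans chi_le1 _.
  have [hl|nh] := boolP (has_run l (map fst s)); last by rewrite -addrA lerDl addr_ge0.
  rewrite add0r.
  have nthE f j : nth false (map f s) j = if (j < size s)%N then f (nth (false, false) s j) else false.
    by case: ltnP => h; [rewrite (nth_map (false, false))|rewrite nth_default ?size_map].
  have big1V (E : nat -> nat -> bool * bool -> R) (E0' : forall q i c, 0 <= E q i c) j q : (j < (n - l).+1)%N -> (q < l)%N ->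
      (forall i, (i < l)%N -> E q i (nth (false, false) s (j + i)) = 1) -> 1 <= V E s.
    move=> jn ql h; rewrite /V (bigD1 (Ordinal jn))//= (bigD1 (Ordinal ql))//=.
    rewrite big1 => [|i _]; last exact: h.
    rewrite -addrA lerDl addr_ge0//; apply: sumr_ge0 => k _; first by apply: prodr_ge0.
    by apply: sumr_ge0 => ? _; apply: prodr_ge0.
  move: ne; rewrite neq_ltn => /orP[lt|gt].
    have [j [q [jn ql qn jl]]] := shorter_run_disagrees l0 hl lt.
    apply: le_trans (_ : V A s <= _); last by rewrite lerDl.
    apply: (big1V A _ j q) => [q' i c| | |i il]; [by case: (E0 q' i c)| | |].
    - by rewrite size_map sr in jn.
    - by [].
    have := jl _ il; rewrite nthE /A; case: ifP => // ji -> /=.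
    by case: eqP => // iq; move: qn; rewrite -iq nthE ji => ->.
  have hl' : has_run l (map snd s).
    by rewrite -leq_run_length; apply: leq_trans (ltnW gt); rewrite leq_run_length.
  have [j [q [jn ql qn jl]]] := shorter_run_disagrees l0 hl' gt.
  apply: le_trans (_ : V B s <= _); last by rewrite lerDr.
  apply: (big1V B _ j q) => [q' i c| | |i il]; [by case: (E0 q' i c)| | |].
  - by rewrite size_map sr in jn.
  - by [].
  have := jl _ il; rewrite nthE /B; case: ifP => // ji -> /=.
  by case: eqP => // iq; move: qn; rewrite -iq nthE ji => ->.
rewrite !expctD; apply: lerD; first apply: lerD.
- rewrite (@expct_map _ _ _ _ w (fun _ => bern (1 / 2)) fst r (fun b => (~~ has_run l b)%:R));
    last by move=> i b; exact: coupling_fst.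
  by rewrite fair_expct; exact: le_fair_no_run.
- have [i0 _] : exists i0 : I, True.
    by case: (r) lr => [|i r'] lr; [move: l0 lr; case: (l)|exists i].
  rewrite /V expct_sum// (eq_bigr (fun j : 'I__ => \sum_(q < l) expct w r (fun s =>
    \prod_(i < l) A q i (nth (false, false) s (j + i))))); last by move=> j _; rewrite expct_sum.
  rewrite exchange_big /= -mulrA mulr_natl -[leRHS]mulr_natl -[X in _ <= X%:R * _]card_ord.
  rewrite mulr_natl -sumr_const; apply: ler_sum => q _.
  apply: (@le_trans _ _ (\sum_(j < (n - l).+1) (1 / 2) ^+ l.-1 * Num.max (1 / 2 - p (nth i0 r (j + q))) 0)).
    apply: ler_sum => j _; rewrite (expct_window i0 (false, false) (A q))//; last first.
      by have := ltn_ord j; lia.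
    rewrite (bigD1 q)//= mulrC; apply: ler_pM.
    + by apply: prodr_ge0 => i _; apply: sumr_ge0 => c _; apply: mulr_ge0 => //; case: (E0 q i c).
    + by apply: sumr_ge0 => c _; apply: mulr_ge0 => //; case: (E0 q q c).
    + have -> : l.-1 = #|[pred i : 'I_l | i != q]| by rewrite cardC1 card_ord.
      rewrite -prodr_const; apply: ler_prod => i iq.
      rewrite big_bool2 /A /= (negPf (iq : nat_of_ord i != q)) /= !mulr1 !mulr0.
      have := p01 (nth i0 r (j + i)); case: (lerP (p (nth i0 r (j + i))) (1 / 2)); lra.
    + rewrite big_bool2 /A /= eqxx /= !mulr1 !mulr0.
      case: (lerP (p (nth i0 r (j + q))) (1 / 2)) => h; rewrite ?maxEle; case: ifP; lra.
  rewrite -big_distrr /=; apply: ler_wpM2l; first by apply: exprn_ge0; lra.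
  rewrite (big_nth i0) big_mkord -/n.
  (* For fixed [q], distinct windows put distinct positions of [r] at offset [q]. The sum over
     windows is thus a shifted part of the sum over [r]. *)
  pose h k := if (k < n)%N then Num.max (1 / 2 - p (nth i0 r k)) 0 else 0.
  rewrite (eq_bigr (fun j : 'I__ => h (j + q)%N)); last first.
    by move=> j _; rewrite /h; case: ifP => //; have := ltn_ord j; have := ltn_ord q; lia.
  rewrite [leRHS](eq_bigr (fun j : 'I__ => h j)); last by move=> j _; rewrite /h ltn_ord.
  have h0 k : 0 <= h k by rewrite /h; case: ifP => // _; rewrite le_max lexx orbT.
  rewrite -(big_mkord xpredT (fun j => h (j + q)%N)) -(big_mkord xpredT h).
  have -> : \sum_(0 <= j < (n - l).+1) h (j + q)%N = \sum_(q <= j < (n - l).+1 + q) h j.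
    by rewrite -{2}[nat_of_ord q]add0n big_addn addnK.
  have qn : ((n - l).+1 + q <= n)%N by have := ltn_ord q; lia.
  rewrite [leRHS](@big_cat_nat _ _ _ q)//=; last by have := ltn_ord q; lia.
  rewrite [X in _ <= _ + X](@big_cat_nat _ _ _ ((n - l).+1 + q))//=; last by lia.
  by rewrite addrCA lerDl addr_ge0//; apply: sumr_ge0.
- have [i0 _] : exists i0 : I, True.
    by case: (r) lr => [|i r'] lr; [move: l0 lr; case: (l)|exists i].
  rewrite /V expct_sum// (eq_bigr (fun j : 'I__ => \sum_(q < l) expct w r (fun s =>
    \prod_(i < l) B q i (nth (false, false) s (j + i))))); last by move=> j _; rewrite expct_sum.
  apply: (@le_trans _ _ (\sum_(j < (n - l).+1) \sum_(q < l) dlt * (1 / 2 + dlt) ^+ l.-1)).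
    apply: ler_sum => j _; apply: ler_sum => q _.
    rewrite (expct_window i0 (false, false) (B q))//; last first.
      by have := ltn_ord j; lia.
    rewrite (bigD1 q)//=; apply: ler_pM.
    + by apply: sumr_ge0 => c _; apply: mulr_ge0 => //; case: (E0 q q c).
    + by apply: prodr_ge0 => i _; apply: sumr_ge0 => c _; apply: mulr_ge0 => //; case: (E0 q i c).
    + rewrite big_bool2 /B /= eqxx /= !mulr1 !mulr0.
      have := pd (nth i0 r (j + q)).
      case: (lerP (p (nth i0 r (j + q))) (1 / 2)) => h; lra.
    + have -> : l.-1 = #|[pred i : 'I_l | i != q]| by rewrite cardC1 card_ord.
      rewrite -prodr_const; apply: ler_prod => i iq.
      rewrite big_bool2 /B /= (negPf (iq : nat_of_ord i != q)) /= !mulr1 !mulr0.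
      have := p01 (nth i0 r (j + i)); have := pd (nth i0 r (j + i)); lra.
  have dd : 0 <= dlt * (1 / 2 + dlt) ^+ l.-1 by apply: mulr_ge0 => //; apply: exprn_ge0; lra.
  rewrite !sumr_const !card_ord -mulrnA -[leLHS]mulr_natl mulnC natrM.
  by apply: ler_wpM2r => //; apply: ler_wpM2r; rewrite ?ler_nat//; lia.
Qed.

End coupling.

(** * Ranked samples with values in finitely many cells *)

Lemma sorted_filter_upset (T : Type) (leT : rel T) (U : pred T) (s : seq T) :
  transitive leT -> (forall x y, leT x y -> U y -> U x) -> sorted leT s ->
  s = [seq x <- s | U x] ++ [seq x <- s | predC U x].
Proof.
move=> tr up; elim: s => //= x s ih xs; case: (boolP (U x)) => Ux /=.
  by rewrite -ih//; exact: path_sorted xs.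
have /(order_path_min tr) : path leT x s by [].
move=> h; have nU : all (predC U) s.
  apply: sub_all h => y /= xy; apply: contra Ux; exact: up xy.
have -> : [seq y <- s | U y] = [::].
  by apply: size0nil; rewrite size_filter; apply/eqP; rewrite eqn0Ngt -has_count -all_predC.
by have := all_filterP nU => /= ->.
Qed.

Section ranking.
Variables (n : nat) (key : 'I_n -> nat).

Definition ranked : seq 'I_n := sort (fun i j => (key j <= key i)%N) (enum 'I_n).

Lemma perm_ranked : perm_eq ranked (enum 'I_n).
Proof. by rewrite perm_sort. Qed.

Lemma size_ranked : size ranked = n.
Proof. by rewrite size_sort size_enum_ord. Qed.

Lemma ranked_uniq : uniq ranked.
Proof. by rewrite sort_uniq enum_uniq. Qed.

Lemma big_ranked (R : realFieldType) (F : 'I_n -> R) : \sum_(i <- ranked) F i = \sum_i F i.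
Proof. by rewrite (perm_big _ perm_ranked) big_enum. Qed.

(** In a decreasing list, an up-closed predicate holds on a prefix. Two of them cut the ranking in
    three, so the observations of a window are consecutive and their signs form one factor of the
    word. *)
Lemma ranked_split (U1 U2 : pred nat) :
  (forall x y, (y <= x)%N -> U1 y -> U1 x) -> (forall x y, (y <= x)%N -> U2 y -> U2 x) ->
  exists a b c, [/\ ranked = a ++ b ++ c,
    {in b, forall i, U2 (key i) && ~~ U1 (key i)} &
    size b = #|[pred i | U2 (key i) && ~~ U1 (key i)]|].
Proof.
move=> up1 up2.
have tr : transitive (fun i j : 'I_n => (key j <= key i)%N).
  by move=> y x z xy yz; exact: leq_trans yz xy.
have srt : sorted (fun i j => (key j <= key i)%N) ranked.
  by apply: sort_sorted => i j; exact: leq_total.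
have e1 := sorted_filter_upset tr (fun x y => @up1 (key x) (key y)) srt.
have e2 := sorted_filter_upset tr (fun x y => @up2 (key x) (key y))
  (sorted_filter tr (predC (fun i => U1 (key i))) srt).
exists [seq i <- ranked | U1 (key i)],
  [seq i <- [seq i <- ranked | predC (fun i => U1 (key i)) i] | U2 (key i)],
  [seq i <- [seq i <- ranked | predC (fun i => U1 (key i)) i] | predC (fun i => U2 (key i)) i].
split; first by rewrite -e2 -e1.
  by move=> i; rewrite !mem_filter /= => /and3P[-> ->].
rewrite -filter_predI size_filter cardE /enum_mem size_filter.
rewrite (permP perm_ranked) enumT; exact: eq_count.
Qed.

End ranking.

(** From here on signs are booleans; a null observation counts as a non-plus on both sides. *)
Lemma longest_runE (R : realType) (s : seq R) :
  longest_run s = run_length [seq 0 < x | x <- sort (fun x y : R => `|y| <= `|x|) s].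
Proof.
rewrite /longest_run /run_length.
set t := sort _ s.
have st : size [seq 0 < x | x <- t] = size s by rewrite size_map size_sort.
have tE i : nth false [seq 0 < x | x <- t] i = ((ordered_signs s)`_i == 1).
  rewrite /ordered_signs -/t; case: (ltnP i (size t)) => it.
    rewrite (nth_map 0)// (nth_map 0)//.
    by case: (ltrgt0P t`_i) => [/gtr0_sg ->|/ltr0_sg ->|->];
      rewrite ?eqxx// ?sgr0 eq_sym ?oner_eq0// -subr_eq0 opprK -[1 + 1]/(2%:R) pnatr_eq0.
  by rewrite !nth_default ?size_map// eq_sym oner_eq0.
rewrite /has_run st; apply: eq_bigl => l.
by apply: eq_existsb => j; apply: eq_forallb => i; rewrite tE.
Qed.

Lemma longest_run_ranked (R : realType) (n : nat) (x : 'I_n -> R) (key : 'I_n -> nat) :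
  (forall i j, (`|x j| <= `|x i|) = (key j <= key i)%N) ->
  longest_run [seq x i | i <- enum 'I_n] = run_length [seq 0 < x i | i <- ranked key].
Proof.
move=> xk; rewrite longest_runE sort_map -map_comp; congr (run_length (map _ _)).
by rewrite /ranked; congr (sort _ _); apply/funext => i; apply/funext => j; rewrite /= xk.
Qed.

Section samples.
Variables (R : realFieldType) (C : finType) (n : nat) (w : C -> R).
Hypothesis w_ge0 : forall c, 0 <= w c.
Hypothesis w_sum : \sum_c w c = 1.

Definition sample_wt (c : {ffun 'I_n -> C}) : R := \prod_i w (c i).

Lemma sample_wt_ge0 c : 0 <= sample_wt c.
Proof. exact: prodr_ge0. Qed.

Lemma sum_sample_wt_prod (h : 'I_n -> C -> R) :
  \sum_c sample_wt c * \prod_i h i (c i) = \prod_i \sum_a w a * h i a.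
Proof. by rewrite bigA_distr_bigA; apply: eq_bigr => c _; rewrite -big_split. Qed.

Lemma sum_sample_wt : \sum_c sample_wt c = 1.
Proof.
have := sum_sample_wt_prod (fun _ _ => 1).
move=> /=; under eq_bigr do rewrite big1_eq mulr1; move=> ->.
by rewrite big1// => i _; under eq_bigr do rewrite mulr1.
Qed.

Lemma sum_sample_wt_coord (i : 'I_n) (h : C -> R) :
  \sum_c sample_wt c * h (c i) = \sum_a w a * h a.
Proof.
have := sum_sample_wt_prod (fun j a => if j == i then h a else 1).
rewrite (eq_bigr (fun c => sample_wt c * h (c i))) => [->|c _]; last first.
  by rewrite (bigD1 i)//= eqxx big1 ?mulr1// => j /negPf ->.
rewrite (bigD1 i)//= eqxx [X in _ * X]big1 ?mulr1// => j /negPf ->.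
by under eq_bigr do rewrite mulr1.
Qed.

Lemma union_bound (a : pred C) :
  \sum_c sample_wt c * [exists i, a (c i)]%:R <= n%:R * \sum_(x | a x) w x.
Proof.
apply: (@le_trans _ _ (\sum_c \sum_(i < n) sample_wt c * (a (c i))%:R)).
  apply: ler_sum => c _; rewrite -mulr_sumr; apply: ler_wpM2l; first exact: sample_wt_ge0.
  case: existsP => [[i ai]|_]; last exact: sumr_ge0.
  by rewrite (bigD1 i)//= ai lerDl sumr_ge0.
rewrite exchange_big /=; under eq_bigr do rewrite (sum_sample_wt_coord _ (fun x => (a x)%:R)).
rewrite sumr_const card_ord -[leLHS]mulr_natl; apply: ler_wpM2l => //.
rewrite [leRHS]big_mkcond; apply: ler_sum => x _.
by case: (a x); rewrite ?mulr1 ?mulr0.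
Qed.

(** Union bound over ordered pairs; two coordinates agree with probability equal to the sum of the
    squares of [w], which is at most [eta]. *)
Lemma collision_bound (eta : R) : (forall c, w c <= eta) ->
  \sum_(c : {ffun 'I_n -> C} | ~~ injectiveb c) sample_wt c <= n%:R ^+ 2 * eta.
Proof.
move=> weta.
apply: (@le_trans _ _ (\sum_c \sum_(i < n) \sum_(j < n | j != i) sample_wt c * (c i == c j)%:R)).
  rewrite big_mkcond; apply: ler_sum => c _; case: ifPn => [|_]; last first.
    by do 2 (apply: sumr_ge0 => ? _); rewrite mulr_ge0// sample_wt_ge0.
  move=> /injectivePn[i [j ij cij]].
  rewrite (bigD1 i)//= (bigD1 j)/=; last by rewrite eq_sym.
  rewrite cij eqxx mulr1 -addrA lerDl addr_ge0//.
    by apply: sumr_ge0 => ? _; rewrite mulr_ge0// sample_wt_ge0.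
  by do 2 (apply: sumr_ge0 => ? _); rewrite mulr_ge0// sample_wt_ge0.
rewrite exchange_big /=.
apply: (@le_trans _ _ (\sum_(i < n) \sum_(j < n) eta)); last first.
  by rewrite !sumr_const !card_ord -mulrnA -[leLHS]mulr_natl natrM expr2.
apply: ler_sum => i _; rewrite exchange_big /=.
have eta0 : 0 <= eta.
  have [c _|c0] := pickP (@predT C); first exact: le_trans (weta c).
  by have := w_sum; rewrite big_pred0// => /esym/eqP; rewrite oner_eq0.
rewrite big_mkcond; apply: ler_sum => j _; case: ifP => // ji.
(* Split by the common value [a]: each term becomes a product over coordinates, to which
   independence applies. *)
have -> : \sum_c sample_wt c * (c i == c j)%:R
    = \sum_a \sum_c sample_wt c * \prod_l (if (l == i) || (l == j) then (c l == a)%:R else 1).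
  rewrite exchange_big; apply: eq_bigr => c _ /=; rewrite -mulr_sumr; congr (_ * _).
  rewrite (bigD1 (c i))//= [X in _ + X]big1 ?addr0; last first.
    by move=> a aci; rewrite (bigD1 i)//= eqxx [c i == a]eq_sym (negPf aci) mul0r.
  rewrite (bigD1 i)//= !eqxx mul1r (bigD1 j)//= eqxx orbT big1 ?mulr1 1?eq_sym//.
  by move=> l /andP[/negPf -> /negPf ->].
apply: (@le_trans _ _ (\sum_a w a * eta)); last by rewrite -mulr_suml w_sum mul1r.
apply: ler_sum => a _.
rewrite (sum_sample_wt_prod (fun l x => if (l == i) || (l == j) then (x == a)%:R else 1)).
have one : \sum_x w x * (x == a)%:R = w a.
  rewrite (bigD1 a)//= eqxx mulr1 big1 ?addr0// => x /negPf ->.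
  by rewrite mulr0.
rewrite (bigD1 i)//= eqxx /= one (bigD1 j)//= eqxx orbT one big1 ?mulr1.
  by apply: ler_wpM2l.
by move=> l /andP[/negPf -> /negPf ->] /=; under eq_bigr do rewrite mulr1.
Qed.

(* Markov's inequality applied to [2 ^- N]. *)
Lemma count_lower_tail (a : pred C) (N0 : nat) :
  \sum_c sample_wt c * (#|[pred i | a (c i)]| < N0)%:R
    <= 2 ^+ N0 * (1 - (\sum_(x | a x) w x) / 2) ^+ n.
Proof.
have -> : (1 - (\sum_(x | a x) w x) / 2) ^+ n
   = \sum_c sample_wt c * \prod_i (if a (c i) then 1 / 2 else 1).
  rewrite (sum_sample_wt_prod (fun _ x => if a x then 1 / 2 else 1)) prod_cst_ord; congr (_ ^+ _).
  rewrite -{1}w_sum mulr_suml [X in _ - X]big_mkcond -sumrB; apply: eq_bigr => x _.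
  by case: (a x); lra.
rewrite mulr_sumr; apply: ler_sum => c _; rewrite mulrCA; apply: ler_wpM2l.
  exact: sample_wt_ge0.
have -> : \prod_i (if a (c i) then 1 / 2 else 1) = (1 / 2 : R) ^+ #|[pred i | a (c i)]|.
  by rewrite -big_mkcond -prodr_const; apply: eq_bigl.
set N := #|_|.
case: ltnP => h; last by apply: mulr_ge0; apply: exprn_ge0; lra.
rewrite -(subnK (ltnW h)) exprD -mulrA -exprMn.
have -> : 2 * (1 / 2) = 1 :> R by lra.
by rewrite expr1n mulr1 exprn_ege1//; lra.
Qed.

End samples.

Section ranked_samples.
Variables (R : realFieldType) (n K : nat) (m p : 'I_K -> R).
Hypothesis m_ge0 : forall k, 0 <= m k.
Hypothesis m_sum : \sum_k m k = 1.
Hypothesis p01 : forall k, 0 <= p k <= 1.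
Implicit Types (k : {ffun 'I_n -> 'I_K}) (phi : seq bool -> R).

Definition rank_expct (k : {ffun 'I_n -> 'I_K}) phi : R :=
  expct (fun i => bern (p (k i))) (ranked (fun i => k i : nat)) phi.

(* Mean of [phi] over the signs of a sample with cells of mass [m], the signs
   being listed by decreasing cell; samples with ties are discarded. *)
Definition untied_expct phi : R :=
  \sum_(k : {ffun 'I_n -> 'I_K} | injectiveb k) sample_wt m k * rank_expct k phi.

(** The conditioning on absolute values: fixing the cells fixes the ranking, and the signs remain
    independent with parameters [p (k i)]. *)
Lemma untied_expctE (w : 'I_K * bool -> R) phi :
  (forall a b, w (a, b) = m a * bern (p a) b) ->
  \sum_(c : {ffun 'I_n -> 'I_K * bool} | injectiveb [ffun i => (c i).1])
     sample_wt w c * phi [seq (c i).2 | i <- ranked (fun i => (c i).1 : nat)]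
  = untied_expct phi.
Proof.
move=> wE; rewrite (partition_big (fun c : {ffun 'I_n -> 'I_K * bool} => [ffun i => (c i).1])
   (fun k => injectiveb k))//=.
apply: eq_bigr => k kinj.
rewrite (reindex_onto (fun s : {ffun 'I_n -> bool} => [ffun i => (k i, s i)])
   (fun c => [ffun i => (c i).2])) /=; last first.
  by move=> c /andP[_ /eqP ck]; apply/ffunP => i; rewrite !ffunE -ck ffunE; case: (c i).
transitivity (\sum_(s : {ffun 'I_n -> bool}) (\prod_i (m (k i) * bern (p (k i)) (s i)))
    * phi [seq s i | i <- ranked (fun i => k i : nat)]).
  apply: eq_big => [s|s _]; last first.
    congr (_ * phi _); first by apply: eq_bigr => i _; rewrite ffunE wE.
    have -> : ranked (fun i => ([ffun i0 => (k i0, s i0)] i).1 : nat) = ranked (fun i => k i : nat).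
      by rewrite /ranked; congr (sort _ _); apply/funext => i; apply/funext => j; rewrite !ffunE.
    by apply: eq_map => i; rewrite ffunE.
  have -> : [ffun i => ([ffun i0 => (k i0, s i0)] i).1] = k by apply/ffunP => i; rewrite !ffunE.
  have -> : [ffun i => ([ffun i0 => (k i0, s i0)] i).2] = s by apply/ffunP => i; rewrite !ffunE.
  by rewrite kinj !eqxx.
under eq_bigr do rewrite big_split -mulrA.
rewrite -mulr_sumr; congr (_ * _).
rewrite (sum_ffun_expct (fun i => bern (p (k i))) phi (ranked_uniq _)).
by rewrite [X in _ * X]big1 ?mulr1// => i _; exact: sum_bern.
Qed.

Let b0 k i b : 0 <= bern (p (k i)) b. Proof. exact: bern_ge0. Qed.
Let b1 k i : \sum_b bern (p (k i)) b = 1. Proof. exact: sum_bern. Qed.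

Lemma rank_expct_01 k phi : (forall s, 0 <= phi s <= 1) -> 0 <= rank_expct k phi <= 1.
Proof.
move=> h; rewrite -{1}(expct_cst (ranked (fun i => k i : nat)) 0 (b1 k)).
rewrite -[X in _ && (_ <= X)](expct_cst (ranked (fun i => k i : nat)) 1 (b1 k)).
by apply/andP; split; apply: le_expct => [//|s _]; case/andP: (h s).
Qed.

Lemma fair_01 phi : (forall s, 0 <= phi s <= 1) -> 0 <= fair n phi <= (1 : R).
Proof.
have h0 (i : unit) b : 0 <= bern (1 / 2 : R) b by rewrite bern_half; lra.
have h1 (i : unit) : \sum_b bern (1 / 2 : R) b = 1 by exact: sum_bern.
move=> h; rewrite -{1}(expct_cst (nseq n tt) 0 h1).
rewrite -[X in _ && (_ <= X)](expct_cst (nseq n tt) 1 h1).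
by apply/andP; split; apply: le_expct => [//|s _]; case/andP: (h s).
Qed.

Lemma untied_expct_fair_gap phi (eta : R) (G : {ffun 'I_n -> 'I_K} -> R) :
  (forall s, 0 <= phi s <= 1) -> (forall a, m a <= eta) -> (forall k, 0 <= G k) ->
  (forall k, injectiveb k -> `|rank_expct k phi - fair n phi| <= G k) ->
  `|untied_expct phi - fair n phi| <= n%:R ^+ 2 * eta + \sum_k sample_wt m k * G k.
Proof.
move=> h meta G0 gap.
have := collision_bound n m_ge0 m_sum meta.
have sw0 k : 0 <= sample_wt m k by exact: sample_wt_ge0.
set T := \sum_(k | ~~ _) _ => Tle.
have /andP[f0 f1] := fair_01 h.
have fE : fair n phi = \sum_(k : {ffun 'I_n -> 'I_K}) sample_wt m k * fair n phi.
  by rewrite -mulr_suml sum_sample_wt// mul1r.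
rewrite {1}fE.
rewrite (bigID (fun k : {ffun 'I_n -> 'I_K} => injectiveb k)) /= opprD addrA -sumrB.
apply: le_trans (ler_normB _ _) _; rewrite addrC; apply: lerD.
  apply: le_trans Tle; rewrite -mulr_suml -/T normrM ger0_norm; last exact: sumr_ge0.
  by rewrite ger0_norm// ler_piMr//; exact: sumr_ge0.
apply: le_trans (ler_norm_sum _ _ _) _; rewrite big_mkcond; apply: ler_sum => k _.
case: ifP => [kinj|_]; last by rewrite mulr_ge0.
rewrite -mulrBr normrM ger0_norm//; apply: ler_wpM2l => //; exact: gap.
Qed.

(** Averages [run_length_law_gap] over the cells. Nothing is known of [p] on bad cells, so samples
    that meet one are given up, at the price of a union bound. The summed deficit becomes [n] times
    its mean over one observation. *)
Lemma untied_expct_run_gap (chi : nat -> R) (eta dlt : R) (bad : pred 'I_K) (l : nat) :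
  (forall j, 0 <= chi j <= 1) -> (forall a, m a <= eta) -> 0 <= dlt ->
  (forall a, ~~ bad a -> p a <= 1 / 2 + dlt) -> (0 < l <= n)%N ->
  `|untied_expct (chi \o run_length) - fair n (chi \o run_length)|
    <= n%:R ^+ 2 * eta + n%:R * (\sum_(a | bad a) m a)
     + (1 - (1 / 2) ^+ l.+1) ^+ (n - l)
     + l%:R * (1 / 2) ^+ l.-1 * (n%:R * \sum_a m a * Num.max (1 / 2 - p a) 0)
     + n%:R * l%:R * (dlt * (1 / 2 + dlt) ^+ l.-1).
Proof.
move=> chi01 meta d0 pd ln.
have phi01 s : 0 <= (chi \o run_length) s <= 1 by exact: chi01.
have mx0 x : 0 <= Num.max x (0 : R) by rewrite le_max lexx orbT.
have h20 j : 0 <= (1 / 2 : R) ^+ j by apply: exprn_ge0; lra.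
set c1 := (1 - _) ^+ _; set c2 := l%:R * _; set c3 := n%:R * l%:R * _.
have c10 : 0 <= c1 by apply: exprn_ge0; rewrite subr_ge0 exprn_ile1; lra.
have c20 : 0 <= c2 by rewrite mulr_ge0.
have c30 : 0 <= c3 by rewrite /c3 !mulr_ge0//; apply: exprn_ge0; lra.
pose G k := [exists i, bad (k i)]%:R + (c1 + c2 * (\sum_i Num.max (1 / 2 - p (k i)) 0) + c3).
apply: (le_trans (untied_expct_fair_gap (G := G) phi01 meta _ _)) => [k|k _|].
- by rewrite /G !addr_ge0// mulr_ge0// sumr_ge0.
- rewrite /G; case: (boolP [exists i, bad (k i)]) => [_|].
    have := rank_expct_01 k phi01; have := fair_01 phi01.
    rewrite ler_norml => /andP[? ?] /andP[? ?].
    have : 0 <= c2 * \sum_i Num.max (1 / 2 - p (k i)) 0 by rewrite mulr_ge0// sumr_ge0.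
    by rewrite mulr1n; lra.
  rewrite negb_exists => /forallP kb; rewrite add0r.
  have := @run_length_law_gap R 'I_n (fun i => p (k i)) (ranked (fun i => k i : nat)) l dlt chi.
  rewrite size_ranked big_ranked; apply => // i; exact: pd.
- rewrite -!addrA lerD2l; under eq_bigr do rewrite mulrDr.
  rewrite big_split; apply: lerD; first exact: union_bound.
  under eq_bigr do rewrite !mulrDr.
  rewrite !big_split /= -!mulr_suml sum_sample_wt// [1 * c1]mul1r [1 * c3]mul1r -!addrA lerD2l lerD2r.
  under eq_bigr do rewrite mulrCA.
  rewrite -mulr_sumr; apply: ler_wpM2l => //.
  rewrite [leLHS](eq_bigr (fun k : {ffun 'I_n -> 'I_K} => \sum_(i < n)
    sample_wt m k * Num.max (1 / 2 - p (k i)) 0)); last by move=> k _; rewrite mulr_sumr.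
  rewrite exchange_big /=.
  under eq_bigr do rewrite (sum_sample_wt_coord m_sum _ (fun x => Num.max (1 / 2 - p x) 0)).
  by rewrite sumr_const card_ord -[leLHS]mulr_natl.
Qed.

(** Either fewer than [N0] observations fall in the window, or the window contributes a consecutive
    stretch of at least [q] blocks of length [l]. *)
Lemma untied_expct_no_run (U1 U2 : pred nat) (p0 : R) (N0 q l : nat) :
  (forall x y, (y <= x)%N -> U1 y -> U1 x) -> (forall x y, (y <= x)%N -> U2 y -> U2 x) ->
  0 <= p0 <= 1 ->
  (forall k : 'I_K, U2 k && ~~ U1 k -> p0 <= p k) -> (q * l <= N0)%N ->
  untied_expct (fun s => (~~ has_run l s)%:R)
    <= 2 ^+ N0 * (1 - (\sum_(k : 'I_K | U2 k && ~~ U1 k) m k) / 2) ^+ n + (1 - p0 ^+ l) ^+ q.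
Proof.
move=> up1 up2 p001 pp ql.
have phi01 s : 0 <= ((~~ has_run l s)%:R : R) <= 1 by rewrite ler0n lern1 leq_b1.
have h0 : 0 <= (1 - p0 ^+ l) ^+ q by apply: exprn_ge0; rewrite subr_ge0 exprn_ile1; lra.
have sw0 k : 0 <= sample_wt m k by exact: sample_wt_ge0.
pose few k := (#|[pred i | (fun x : 'I_K => U2 x && ~~ U1 x) (k i)]| < N0)%N.
apply: (@le_trans _ _ (\sum_k sample_wt m k * ((few k)%:R + (1 - p0 ^+ l) ^+ q))); last first.
  under eq_bigr do rewrite mulrDr.
  rewrite big_split /= -mulr_suml sum_sample_wt// mul1r lerD2r.
  exact: count_lower_tail.
rewrite /untied_expct big_mkcond; apply: ler_sum => k _.
case: ifP => _; last by rewrite mulr_ge0// addr_ge0.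
apply: ler_wpM2l => //; have /andP[_ E1] := rank_expct_01 k phi01.
rewrite /few; case: ltnP => [_|many]; first by rewrite (le_trans E1)// lerDl.
rewrite add0r /rank_expct.
have [a [b [c [e bP sb]]]] := ranked_split (fun i => k i : nat) up1 up2.
rewrite e !expct_cat.
have lem : expct (fun i => bern (p (k i))) b (fun s => (~~ has_run l s)%:R) <= (1 - p0 ^+ l) ^+ q.
  have h := @le_prob_no_run R 'I_n (fun i => p (k i)) b p0 q l p001 (fun i => p01 (k i)).
  by apply: h => [i /bP /pp //|]; rewrite sb; exact: leq_trans ql many.
apply: le_trans lem.
rewrite -[leRHS](expct_cst a _ (b1 k)); apply: le_expct => // s1 _.
rewrite expct_cat; apply: le_expct => // s2 _.
rewrite -[leRHS](expct_cst c _ (b1 k)); apply: le_expct => // s3 _.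
rewrite ler_nat; case: (boolP (has_run l s2)) => [h|_]; last exact: leq_b1.
by rewrite has_run_infix.
Qed.

End ranked_samples.

(** Both measures agree on half-open intervals, which are stable under intersection and generate the
    Borel sets; the intervals from -n to n exhaust the line. *)
Lemma eq_measure_cdf (R : realType) (m1 m2 : {measure set (measurableTypeR R) -> \bar R})
    (H : R -> R) :
  (forall x, m1 `]-oo, x]%classic = (H x)%:E) -> (forall x, m2 `]-oo, x]%classic = (H x)%:E) ->
  forall A, measurable A -> m1 A = m2 A.
Proof.
move=> m1H m2H.
have moc (m : {measure set (measurableTypeR R) -> \bar R}) a b : a <= b ->
    (forall x, m `]-oo, x]%classic = (H x)%:E) -> m `]a, b]%classic = (H b - H a)%:E.
  move=> ab mH.
  have -> : `]a, b]%classic = `]-oo, b] `\` `]-oo, a].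
    by rewrite -[RHS]setCK setCD setCitvl setUC -[LHS]setCK setCitv.
  rewrite measureD ?setIidr//=; last 2 first.
  - exact: subset_itvl.
  - by rewrite mH ltry.
  by rewrite !mH.
move=> A mA.
apply: (@measure_unique _ R (measurableTypeR R) (@ocitv R)
  (fun n => `](- n%:R), n%:R]%classic) erefl) => //.
- exact: ocitvI.
- by move=> n; exact: is_ocitv.
- rewrite -subTset => x _ /=; exists (Num.bound x).+1 => //=; rewrite in_itv/=.
  have := archi_boundP (normr_ge0 x); have := ler_norm x; have := ler_norm (- x).
  rewrite normrN => h1 h2; have -> : Num.bound `|x| = Num.bound x by rewrite /Num.bound normr_id.
  by rewrite -natr1; move: (Num.bound x)%:R => B; lra.
- move=> _ [[a b] _ <-] /=; have [ab|ba] := leP a b; first by rewrite !(moc _ a b).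
  by rewrite set_itv_ge ?measure0// bnd_simp -leNgt ltW.
- by move=> n; rewrite (moc _ (- n%:R) n%:R)// ?ltry// lerNl (le_trans _ (ler0n _ n))// lerNl oppr0.
Qed.

(** * Densities *)

Section density_measure.
Variables (R : realType) (h : R -> R).
Hypothesis mh : measurable_fun [set: R] h.
Hypothesis h0 : forall x, 0 <= h x.

(** Packaged as a measure so that [eq_measure_cdf] can identify a law, known only by its
    distribution function, with the integral of its density. *)
Definition density_measure (A : set (measurableTypeR R)) : \bar R :=
  (\int[lebesgue_measure]_(x in A) (h x)%:E)%E.

Let mE : measurable_fun [set: R] (EFin \o h).
Proof. exact/measurable_EFinP. Qed.

Let dm0 : density_measure set0 = 0%E.
Proof. exact: integral_set0. Qed.

Let dm_ge0 A : (0 <= density_measure A)%E.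
Proof. by apply: integral_ge0 => x _; rewrite lee_fin. Qed.

Let dm_sigma_additive : semi_sigma_additive density_measure.
Proof.
apply: (@semi_sigma_additive_nng_induced _ _ _ lebesgue_measure (EFin \o h)); first exact: mE.
by move=> x; rewrite lee_fin.
Qed.

HB.instance Definition _ := isMeasure.Build _ _ _
  density_measure dm0 dm_ge0 dm_sigma_additive.

Lemma measure_density (m : {measure set (measurableTypeR R) -> \bar R}) (H : R -> R) :
  (forall x, m `]-oo, x]%classic = (H x)%:E) ->
  (forall x, (H x)%:E = (\int[lebesgue_measure]_(t in `]-oo, x]) (h t)%:E)%E) ->
  forall A, measurable A -> m A = (\int[lebesgue_measure]_(x in A) (h x)%:E)%E.
Proof.
move=> mH hH A mA; rewrite -/(density_measure A).
by apply: (eq_measure_cdf mH) => // x; rewrite -hH.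
Qed.

End density_measure.

Section affine_change.
Variable R : realType.
Implicit Types (g : R -> R) (A : set R).

(** Uniqueness of Lebesgue measure on half-open intervals shows that its image by a translation is
    itself; the reflection below follows the same pattern. *)
Lemma integral_shift g (c : R) A : measurable_fun [set: R] g -> (forall x, 0 <= g x) ->
  measurable A ->
  (\int[lebesgue_measure]_(x in A) (g (x - c))%:E
    = \int[lebesgue_measure]_(x in (fun y => (y + c)%R) @^-1` A) (g x)%:E)%E.
Proof.
move=> mg g0 mA'.
pose phi (x : measurableTypeR R) : measurableTypeR R := x - c.
have mphi : measurable_fun setT phi by apply: measurable_funB.
have mB : measurable ((fun y => (y + c)%R) @^-1` A).
  rewrite -[X in measurable X]setTI; apply: measurable_funD => //.
rewrite [RHS](@eq_measure_integral _ _ _ _ (pushforward lebesgue_measure phi)); last first.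
  move=> B mB' _; apply: (@lebesgue_measure_unique R (pushforward lebesgue_measure phi)) => //.
  move=> _ [[a b] _ <-] /=.
  have e : phi @^-1` `]a, b] = `](a + c), (b + c)]%classic.
    by apply/seteqP; split => x /=; rewrite !in_itv/= /phi; lra.
  rewrite /pushforward e !lebesgue_measure_itv /= !lte_fin ltrD2r; case: ifP => // _.
  by rewrite -!EFinB; congr (_%:E); ring.
rewrite ge0_integral_pushforward//=; last 2 first.
- by apply: measurable_funTS; exact/measurable_EFinP.
- by move=> y _; rewrite lee_fin.
congr integral; apply/seteqP; split => x /=; rewrite /phi subrK//.
Qed.

Lemma integral_reflect g A : measurable_fun [set: R] g -> (forall x, 0 <= g x) ->
  measurable A ->
  (\int[lebesgue_measure]_(x in A) (g (- x))%:E
    = \int[lebesgue_measure]_(x in -%R @^-1` A) (g x)%:E)%E.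
Proof.
move=> mg g0 mA'.
pose phi (x : measurableTypeR R) : measurableTypeR R := - x.
have mphi : measurable_fun setT phi by exact: oppr_measurable.
have mB : measurable (-%R @^-1` A).
  by rewrite -[X in measurable X]setTI; apply: oppr_measurable.
rewrite [RHS](@eq_measure_integral _ _ _ _ (pushforward lebesgue_measure phi)); last first.
  move=> B mB' _; apply: (@lebesgue_measure_unique R (pushforward lebesgue_measure phi)) => //.
  move=> _ [[a b] _ <-] /=.
  have e : phi @^-1` `]a, b] = `[(- b), (- a)[%classic.
    by apply/seteqP; split => x /=; rewrite !in_itv/= /phi; lra.
  rewrite /pushforward e !lebesgue_measure_itv /= !lte_fin ltrN2; case: ifP => // _.
  by rewrite -!EFinB; congr (_%:E); ring.
rewrite ge0_integral_pushforward//=; last 2 first.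
- by apply: measurable_funTS; exact/measurable_EFinP.
- by move=> y _; rewrite lee_fin.
by congr integral; apply/seteqP; split => x /=; rewrite /phi opprK.
Qed.

Lemma is_density_shift (G g : R -> R) (c : R) :
  is_density G g -> is_density (fun x => G (x - c)) (fun x => g (x - c)).
Proof.
move=> [mg g0 gG]; split => [||x] //.
  by apply: measurableT_comp => //; apply: measurable_funB.
rewrite integral_shift// gG; congr integral.
by apply/seteqP; split => y /=; rewrite !in_itv/= lerBrDr.
Qed.

Lemma is_density_mix (F G f g : R -> R) (a b : R) : 0 <= a -> 0 <= b ->
  is_density F f -> is_density G g ->
  is_density (fun x => a * F x + b * G x) (fun x => a * f x + b * g x).
Proof.
move=> a0 b0 [mf f0 fF] [mg g0 gG]; split => [|x|x].
- by apply: measurable_funD; apply: measurable_funM.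
- by rewrite addr_ge0// mulr_ge0.
under eq_integral do rewrite EFinD !EFinM.
have mf' (D : set R) : measurable_fun D (fun x => (f x)%:E).
  by apply: measurable_funTS; exact/measurable_EFinP.
have mg' (D : set R) : measurable_fun D (fun x => (g x)%:E).
  by apply: measurable_funTS; exact/measurable_EFinP.
rewrite ge0_integralD//.
- rewrite !ge0_integralZl//; first by rewrite -fF -gG EFinD !EFinM.
  + exact: mg'.
  + by move=> *; rewrite lee_fin.
  + exact: mf'.
  + by move=> *; rewrite lee_fin.
- by move=> y _; rewrite -EFinM lee_fin mulr_ge0.
- by apply: measurable_funeM; exact: mf'.
- by move=> y _; rewrite -EFinM lee_fin mulr_ge0.
- by apply: measurable_funeM; exact: mg'.
Qed.

Lemma integrable_density (F : cumulativeBounded (0 : R) (1 : R)) (f : R -> R) :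
  is_density F f -> lebesgue_measure.-integrable [set: R] (EFin \o f)
    /\ (\int[lebesgue_measure]_x (f x)%:E = 1)%E.
Proof.
move=> [mf f0 fF].
have int1 : (\int[lebesgue_measure]_x (f x)%:E = 1)%E.
  rewrite -(measure_density mf f0 (m := lebesgue_stieltjes_measure F) (H := F))//.
  - exact: (@probability_setT _ _ _ (lebesgue_stieltjes_measure F : probability _ _)).
  - move=> x; rewrite -cdf_lebesgue_stieltjes_id /cdf /distribution /pushforward.
    by rewrite preimage_id.
split => //; apply/integrableP; split; first exact/measurable_EFinP.
under eq_integral do rewrite /= ger0_norm//.
by rewrite int1 ltry.
Qed.

(** The density [f] need not be even pointwise: symmetry of [F] makes only its integrals even. This
    is enough because signs are compared through masses of sets. *)
Lemma is_density_reflect (F : cumulativeBounded (0 : R) (1 : R)) (f : R -> R) :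
  (forall x, F (- x) = 1 - F x) -> is_density F f -> is_density F (fun x => f (- x)).
Proof.
move=> symF dF; have [_ int1] := integrable_density dF.
have [mf f0 fF] := dF.
have mfN : measurable_fun [set: R] (fun x => f (- x)).
  by apply: (measurableT_comp mf); exact: oppr_measurable.
split => [//|x|x]; first exact: f0.
rewrite integral_reflect//.
have -> : -%R @^-1` `]-oo, x] = `[(- x), +oo[%classic.
  by apply/seteqP; split => y /=; rewrite !in_itv/= ?andbT lerNl.
have mE (D : set R) : measurable_fun D (fun x => (f x)%:E).
  by apply: measurable_funTS; exact/measurable_EFinP.
have split1 : (\int[lebesgue_measure]_x (f x)%:E =
    (F (- x)%R)%:E + \int[lebesgue_measure]_(t in `[(- x)%R, +oo[) (f t)%:E)%E.
  rewrite fF -(integral_itv_bndo_bndc (mE _)) -ge0_integral_setU//.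
  - congr integral; apply/seteqP; split => y //= _; rewrite /setU /= !in_itv /= andbT.
    by case: (ltP y (- x)) => h; [left|right].
  - exact: mE.
  - by move=> y _; rewrite lee_fin.
  - apply/disj_setPS => y /= []; rewrite !in_itv/= andbT => h1 h2.
    by move: h1; rewrite ltNge h2.
move: split1; rewrite int1 symF.
case: (integral _ _ _) => [r| |] // [] e; congr (_%:E); lra.
Qed.

End affine_change.

(** * From the law of the sample to finite sums over cells *)

Section finite_valued.
Context (d : measure_display) (T : measurableType d) (D : finType) (b : T -> D).
Hypothesis mb : forall x, measurable (b @^-1` [set x]).

Lemma finite_valued_preimage (B : pred D) :
  [set w | B (b w)] = \bigcup_(x in [set x | B x]) b @^-1` [set x].
Proof.
apply/seteqP; split => w /=; first by move=> h; exists (b w).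
by move=> [x /= Bx ->].
Qed.

Lemma measurable_finite_valued (B : pred D) : measurable [set w | B (b w)].
Proof. by rewrite finite_valued_preimage; apply: fin_bigcup_measurable. Qed.

Lemma prob_finite_valued (R : realType) (P : probability T R) (B : pred D) :
  fine (P [set w | B (b w)]) = \sum_(x | B x) fine (P (b @^-1` [set x])).
Proof.
rewrite finite_valued_preimage measure_fin_bigcup//; last 2 first.
- exact: finite_finset.
- by apply/trivIsetP => x y _ _ xy; apply/seteqP; split => w //= [-> e]; move: xy; rewrite e eqxx.
rewrite (_ : \sum_(i \in _) _ = \sum_(x | B x) P (b @^-1` [set x]))%E; last first.
  rewrite [RHS](@bigfs _ _ _ _ (index_enum D) B) ?index_enum_uniq// => x _.
  by rewrite mem_index_enum.
by rewrite -sum_fine// => x _; exact: fin_num_measure.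
Qed.

End finite_valued.

(** The statistic is a function of finitely many booleans: the comparisons between absolute values,
    which determine the output of [sort] even with ties, and the signs. *)
Lemma measurable_longest_run (d : measure_display) (T : measurableType d) (R : realType)
    (n : nat) (X : 'I_n -> {mfun T >-> R}) (A : set nat) :
  measurable (longest_run_statistic X @^-1` A).
Proof.
pose b w := ([ffun ij : 'I_n * 'I_n => `|X ij.2 w| <= `|X ij.1 w|], [ffun i => 0 < X i w]).
pose Psi (x : {ffun 'I_n * 'I_n -> bool} * {ffun 'I_n -> bool}) :=
  run_length [seq x.2 i | i <- sort (fun i j => x.1 (i, j)) (enum 'I_n)].
have e w : longest_run_statistic X w = Psi (b w).
  rewrite /longest_run_statistic longest_runE sort_map -map_comp /Psi /b /=.
  congr run_length; have -> : (fun i j => [ffun ij : 'I_n * 'I_n => `|X ij.2 w| <= `|X ij.1 w|] (i, j))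
     = relpre (fun i => X i w) (fun x y : R => `|y| <= `|x|).
    by apply/funext => i; apply/funext => j; rewrite ffunE.
  by apply: eq_map => i; rewrite ffunE.
have -> : longest_run_statistic X @^-1` A = [set w | (fun x => `[< A (Psi x) >]) (b w)].
  by apply/seteqP; split => w /=; rewrite e => /asboolP.
apply: (@measurable_finite_valued _ _ _ b _ (fun x => `[< A (Psi x) >])) => -[x1 x2].
have -> : b @^-1` [set (x1, x2)] =
  \bigcap_(ij in [set: 'I_n * 'I_n]) [set w | (`|X ij.2 w| <= `|X ij.1 w|) = x1 ij] `&`
  \bigcap_(i in [set: 'I_n]) [set w | (0 < X i w) = x2 i].
  apply/seteqP; split => w /=.
    by case=> <- <-; split => i _ /=; rewrite ffunE.
  move=> [h1 h2]; congr (_, _); apply/ffunP => i; rewrite ffunE.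
    exact: h1.
  exact: h2.
have mX i : measurable_fun setT (X i) by exact: measurable_funP.
apply: measurableI; apply: fin_bigcap_measurable => [|i _]; try exact: finite_finset.
  have mf : measurable_fun setT (fun w => `|X i.2 w| <= `|X i.1 w|).
    by apply: measurable_fun_ler; apply: measurableT_comp.
  by rewrite -[X in measurable X]setTI; apply: (mf measurableT [set x1 i]).
have mf : measurable_fun setT (fun w => 0 < X i w) by exact: measurable_fun_ltr.
by rewrite -[X in measurable X]setTI; apply: (mf measurableT [set x2 i]).
Qed.

Definition density_mass (R : realType) (h : R -> R) (A : set R) : R :=
  \int[lebesgue_measure]_(x in A) h x.

Section iid_law.
Context (d : measure_display) (T : measurableType d) (R : realType) (P : probability T R).
Variables (n : nat) (X : 'I_n -> {RV P >-> R}) (H h : R -> R).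
Hypothesis X_iid : iid_with_cdf P X H.
Hypothesis H_density : is_density H h.

Lemma iid_mass i A : measurable A -> P (X i @^-1` A) = (density_mass h A)%:E.
Proof.
move=> mA; have [mh h0 hH] := H_density; have [_ XH] := X_iid.
have mX : measurable_fun setT (X i : T -> measurableTypeR R).
  move=> _ Y mY; have mY' : measurable (Y : set R) by exact: mY.
  have hX : measurable_fun setT (X i) by exact: measurable_funP.
  exact: (hX measurableT Y mY').
have E : P (X i @^-1` A) = (\int[lebesgue_measure]_(x in A) (h x)%:E)%E.
  by rewrite -(@measure_density R h mh h0 (pushforward P (X i : T -> measurableTypeR R)) H) => // x; exact: XH.
rewrite /density_mass /Rintegral -E fineK//; apply: fin_num_measure.
by rewrite -[X in measurable X]setTI; exact: (measurable_funP (X i)).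
Qed.

Lemma iid_law (C : finType) (c : R -> C) (B : pred {ffun 'I_n -> C}) :
  (forall a, measurable (c @^-1` [set a])) ->
  fine (P [set w | B [ffun i => c (X i w)]])
    = \sum_(b | B b) sample_wt (fun a => density_mass h (c @^-1` [set a])) b.
Proof.
move=> mc; have [ind _] := X_iid.
have mX i A : measurable A -> measurable (X i @^-1` A).
  by move=> mA; rewrite -[X in measurable X]setTI; apply: (measurable_funP (X i)).
have E (b : {ffun 'I_n -> C}) : (fun w => [ffun i => c (X i w)]) @^-1` [set b]
    = \bigcap_(i in [set: 'I_n]) X i @^-1` (c @^-1` [set b i]).
  apply/seteqP; split => w /=; first by move=> <- i _ /=; rewrite ffunE.
  by move=> hw; apply/ffunP => i; rewrite ffunE; exact: hw.
rewrite (prob_finite_valued (b := fun w => [ffun i => c (X i w)])) => [|b].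
  apply: eq_bigr => b _; rewrite E ind// /sample_wt.
  rewrite (eq_bigr (fun i => (density_mass h (c @^-1` [set b i]))%:E)); last first.
    by move=> i _; exact: iid_mass.
  by rewrite prodEFin.
by rewrite E; apply: fin_bigcap_measurable => // i _; apply: mX.
Qed.

(** Masses inherit the rules of a probability from the law of one observation, hence the condition
    [0 < n] here and below. *)
Lemma density_mass_setT : (0 < n)%N -> density_mass h setT = 1.
Proof.
move=> n0; apply: EFin_inj; rewrite -(iid_mass (Ordinal n0))// preimage_setT.
exact: probability_setT.
Qed.

Lemma density_mass_ge0 A : 0 <= density_mass h A.
Proof. by have [_ h0 _] := H_density; apply: Rintegral_ge0. Qed.

Lemma density_mass_setU A B : (0 < n)%N -> measurable A -> measurable B ->
  A `&` B = set0 -> density_mass h (A `|` B) = density_mass h A + density_mass h B.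
Proof.
move=> n0 mA mB AB.
have mX i D : measurable D -> measurable (X i @^-1` D).
  by move=> mD; rewrite -[X in measurable X]setTI; apply: (measurable_funP (X i)).
pose i := Ordinal n0; apply: EFin_inj; rewrite EFinD -!(iid_mass i)//; last exact: measurableU.
rewrite preimage_setU measureU//; try exact: mX.
by rewrite -preimage_setI AB preimage_set0.
Qed.

Lemma le_density_mass A B : (0 < n)%N -> measurable A -> measurable B -> A `<=` B ->
  density_mass h A <= density_mass h B.
Proof.
move=> n0 mA mB AB; pose i := Ordinal n0; rewrite -lee_fin -!(iid_mass i)//.
have mX D : measurable D -> measurable (X i @^-1` D).
  by move=> mD; rewrite -[X in measurable X]setTI; apply: (measurable_funP (X i)).
by apply: le_measure; rewrite ?inE; [exact: mX|exact: mX|exact: preimage_subset].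
Qed.

Lemma density_mass_fibres (C : finType) (c : R -> C) (B : pred C) : (0 < n)%N ->
  (forall a, measurable (c @^-1` [set a])) ->
  density_mass h [set x | B (c x)] = \sum_(a | B a) density_mass h (c @^-1` [set a]).
Proof.
move=> n0 mc; pose i := Ordinal n0.
have mX D : measurable D -> measurable (X i @^-1` D).
  by move=> mD; rewrite -[X in measurable X]setTI; apply: (measurable_funP (X i)).
apply: EFin_inj; rewrite -(iid_mass i)//; last exact: measurable_finite_valued.
rewrite -[LHS]fineK; last by apply: fin_num_measure; apply: mX; exact: measurable_finite_valued.
congr (_%:E); have := @prob_finite_valued _ T C (c \o X i) (fun x => mX _ (mc x)) R P B.
move=> /= e; rewrite [LHS]e; apply: eq_bigr => a _.
by have -> := iid_mass i (mc a).
Qed.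

(* [kappa] cuts the half-line into [K.+1] consecutive cells; two observations in
   distinct cells are ordered like their cells. *)
Lemma longest_run_cells (K : nat) (kappa : R -> nat) (m p : 'I_K.+1 -> R) (eta : R)
    (A : set nat) : (0 < n)%N ->
  (forall y, (kappa y < K.+1)%N) ->
  (forall y y', 0 <= y -> y <= y' -> (kappa y <= kappa y')%N) ->
  (forall k, measurable [set x : R | kappa `|x| = k]) ->
  (forall k, m k = density_mass h [set x : R | kappa `|x| = k]) ->
  (forall k, m k * p k = density_mass h [set x : R | kappa `|x| = k /\ 0 < x]) ->
  (forall k, m k <= eta) -> (forall k, 0 <= p k <= 1) ->
  `|fine (P (longest_run_statistic X @^-1` A)) - untied_expct n m p (\1_A \o run_length)|
    <= n%:R ^+ 2 * eta.
Proof.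
move=> n0 kK kmono mk mE pE meta p01.
pose c (x : R) : 'I_K.+1 * bool := (inord (kappa `|x|), 0 < x).
pose c1 (x : R) : 'I_K.+1 := inord (kappa `|x|).
have c1E x k : (c1 x = k) <-> (kappa `|x| = k).
  split => [<-|e]; first by rewrite inordK.
  by apply/val_inj; rewrite /= inordK.
have fib1 k : c1 @^-1` [set k] = [set x : R | kappa `|x| = k].
  by apply/seteqP; split => x /= /c1E.
have mc1 k : measurable (c1 @^-1` [set k]) by rewrite fib1.
have mpos : measurable [set x : R | 0 < x].
  rewrite (_ : [set _ | _] = `]0, +oo[%classic)//.
  by apply/seteqP; split => x /=; rewrite in_itv/= andbT.
have fibt k : c @^-1` [set (k, true)] = [set x : R | kappa `|x| = k /\ 0 < x].
  apply/seteqP; split => x /=; first by case=> /c1E e1 e2; split.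
  by case=> /c1E e1 e2; congr (_, _).
have fibtI k : c @^-1` [set (k, true)] = [set x : R | kappa `|x| = k] `&` [set x | 0 < x] by [].
have fibf k : c @^-1` [set (k, false)] = [set x : R | kappa `|x| = k] `&` ~` [set x | 0 < x].
  apply/seteqP; split => x /=; first by case=> /c1E e1 e2; split => //; apply/negP; rewrite e2.
  by case=> /c1E e /negP/negbTE ne; congr (_, _).
have mc a : measurable (c @^-1` [set a]).
  case: a => k [].
    by rewrite fibt -[X in measurable X]/([set x : R | kappa `|x| = k] `&` [set x | 0 < x]); apply: measurableI.
  by rewrite fibf; apply: measurableI => //; exact: measurableC.
pose w a := density_mass h (c @^-1` [set a]).
have wE k s : w (k, s) = m k * bern (p k) s.
  case: s; rewrite /w; first by rewrite fibt -pE.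
  apply: (@addrI _ (m k * p k)); rewrite {1}pE -fibt -density_mass_setU//.
    rewrite /= mulrBr mulr1 subrKC mE; congr density_mass.
    by rewrite fibf fibt; apply/seteqP; split => x /= => [[[]|[]]|e] //;
      case: (boolP (0 < x)) => hx; [left|right; split => //; apply/negP].
  rewrite fibt fibf; apply/seteqP; split => x //= -[[_ a] [_ b]]; exact: b a.
have mX i D : measurable D -> measurable (X i @^-1` D).
  by move=> mD; rewrite -[X in measurable X]setTI; apply: (measurable_funP (X i)).
have mcX (C : finType) (cc : R -> C) (B : pred {ffun 'I_n -> C}) :
    (forall a, measurable (cc @^-1` [set a])) -> measurable [set w | B [ffun i => cc (X i w)]].
  move=> mcc; apply: (measurable_finite_valued (b := fun w => [ffun i => cc (X i w)])) => b.
  have -> : (fun w => [ffun i => cc (X i w)]) @^-1` [set b]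
      = \bigcap_(i in [set: 'I_n]) X i @^-1` (cc @^-1` [set b i]).
    apply/seteqP; split => w' /=; first by move=> <- i _ /=; rewrite ffunE.
    by move=> hw; apply/ffunP => i; rewrite ffunE; exact: hw.
  by apply: fin_bigcap_measurable => // i _; apply: mX.
set E := longest_run_statistic X @^-1` A.
pose ssigns (b : {ffun 'I_n -> 'I_K.+1 * bool}) :=
  [seq (b i).2 | i <- ranked (fun i => (b i).1 : nat)].
(* No tie between cells, and a longest run in [A] once the signs are listed by decreasing cell. *)
pose B (b : {ffun 'I_n -> 'I_K.+1 * bool}) :=
  injectiveb [ffun i => (b i).1] && (run_length (ssigns b) \in A).
pose EB := [set w | B [ffun i => c (X i w)]].
pose tie := [set w | (fun k : {ffun 'I_n -> 'I_K.+1} => ~~ injectiveb k) [ffun i => c1 (X i w)]].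
have keysE t : [ffun i => ([ffun i0 => c (X i0 t)] i).1] = [ffun i => c1 (X i t)].
  by apply/ffunP => i; rewrite !ffunE.
have LE t : injectiveb [ffun i => c1 (X i t)] ->
    run_length (ssigns [ffun i => c (X i t)]) = longest_run_statistic X t.
  move=> /injectiveP inj; rewrite /longest_run_statistic.
  rewrite (longest_run_ranked (key := fun i => kappa `|X i t|)).
    rewrite /ssigns; congr run_length.
    have -> : ranked (fun i => ([ffun i0 => c (X i0 t)] i).1 : nat) = ranked (fun i => kappa `|X i t|).
      by rewrite /ranked; congr (sort _ _); apply/funext => i; apply/funext => j; rewrite !ffunE /= !inordK.
    by apply: eq_map => i; rewrite ffunE.
  move=> i j; case: (leP `|X j t| `|X i t|) => [le|lt]; first by rewrite kmono.
  have kle : (kappa `|X i t|%R <= kappa `|X j t|%R)%N by apply: kmono => //; exact: ltW.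
  apply/esym/negbTE; rewrite -ltnNge ltn_neqAle kle andbT.
  apply/negP => /eqP e; have /inj ij : [ffun i => c1 (X i t)] i = [ffun i => c1 (X i t)] j.
    by rewrite !ffunE /c1 e.
  by move: lt; rewrite ij ltxx.
have mEB : measurable EB by exact: mcX.
have mtie : measurable tie by exact: mcX.
have mEE : measurable E by exact: measurable_longest_run.
have PB : fine (P EB) = untied_expct n m p (\1_A \o run_length).
  rewrite /EB iid_law// -(untied_expctE n _ wE).
  rewrite big_mkcond [RHS]big_mkcond; apply: eq_bigr => b _; rewrite /B /= indicE.
  by case: ifP => [/andP[-> ->]|]; [rewrite mulr1|case: ifP => //= _ ->; rewrite mulr0].
have Ptie : fine (P tie) <= n%:R ^+ 2 * eta.
  have -> : fine (P tie) = _ := iid_law (fun k : {ffun 'I_n -> 'I_K.+1} => ~~ injectiveb k) mc1.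
  apply: collision_bound.
  - by move=> k; exact: density_mass_ge0.
  - rewrite -(density_mass_fibres xpredT n0 mc1) -(density_mass_setT n0); congr density_mass.
    by apply/seteqP; split.
  - by move=> k; rewrite fib1 -mE.
(* Without ties the cells determine the ranking, so [EB] is contained in [E], and [E] in the union
   of [EB] and [tie]. *)
have le1 : fine (P EB) <= fine (P E).
  apply: fine_le; rewrite ?fin_num_measure//; apply: le_measure; rewrite ?inE//.
  by move=> t /= /andP[]; rewrite keysE => inj /set_mem; rewrite LE.
have le2 : fine (P E) <= fine (P EB) + fine (P tie).
  rewrite -fineD ?fin_num_measure//; apply: fine_le; rewrite ?fin_numD ?fin_num_measure//.
  apply: (le_trans _ (measureU2 P mEB mtie)).
  apply: le_measure; rewrite ?inE//; first exact: measurableU.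
  move=> w0 Ew; case: (boolP (injectiveb [ffun i => c1 (X i w0)])) => inj; [left|by right].
  by rewrite /EB /= /B keysE inj /= LE//; apply/mem_set.
by rewrite -PB ger0_norm ?subr_ge0//; lra.
Qed.

End iid_law.

Lemma measurable_monotone_nat (R : realType) (u : R -> nat) (k : nat) :
  {homo u : x y / x <= y >-> (x <= y)%N} -> measurable [set x : R | u x = k].
Proof.
move=> um; apply: is_interval_measurable => x y /= ux uy z /andP[xz zy].
by apply/eqP; rewrite eqn_leq; apply/andP; split; [rewrite -uy|rewrite -ux]; exact: um.
Qed.

Lemma measurable_norm_preimage (R : realType) (A : set R) :
  measurable A -> measurable [set x : R | A `|x|].
Proof.
move=> mA; rewrite (_ : [set _ | _] = [set: R] `&` (fun x : R => `|x|) @^-1` A); last by rewrite setTI.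
by have := @normr_measurable R setT; move=> /(_ measurableT A mA).
Qed.

(** * Cells of small mass *)

Section cells.
Context (d : measure_display) (T : measurableType d) (R : realType) (P : probability T R).
Variables (n : nat) (X : 'I_n -> {RV P >-> R}) (H h : R -> R).
Hypothesis X_iid : iid_with_cdf P X H.
Hypothesis H_density : is_density H h.
Hypothesis n_gt0 : (0 < n)%N.

Let mass := density_mass h.
Let abs_cdf (y : R) := mass [set x | `|x| <= y].

Lemma density_mass_itvNy x : density_mass h `]-oo, x] = H x.
Proof. by have [_ _ hH] := H_density; rewrite /density_mass /Rintegral -hH. Qed.

Lemma integrable_iid_density (A : set R) : measurable A ->
  lebesgue_measure.-integrable A (EFin \o h).
Proof.
move=> mA; have [mh h0 _] := H_density; apply: (@integrableS _ _ _ _ setT) => //.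
apply/integrableP; split; first exact/measurable_EFinP.
under eq_integral do rewrite /= ger0_norm//.
have := density_mass_setT X_iid H_density n_gt0; rewrite /density_mass /Rintegral.
have : (0 <= \int[lebesgue_measure]_x (h x)%:E)%E by apply: integral_ge0 => x _; rewrite lee_fin.
case: (integral _ _ _) => [r| |] //= _; first by rewrite ltry.
by move=> e; have := oner_neq0 R; rewrite -e eqxx.
Qed.

Let mle y : measurable [set x : R | `|x| <= y].
Proof.
apply: (@measurable_norm_preimage R [set x | x <= y]).
by rewrite (_ : [set _ | _] = `]-oo, y]%classic)//; apply/seteqP; split => z /=; rewrite in_itv.
Qed.

Lemma density_mass_itv (a b : R) : a <= b -> density_mass h `]a, b] = H b - H a.
Proof.
move=> ab; rewrite -!density_mass_itvNy; apply: (@addrI _ (density_mass h `]-oo, a])).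
rewrite subrKC -(density_mass_setU X_iid H_density n_gt0)//.
- congr density_mass; apply/seteqP; split => x /=; rewrite !in_itv /=.
    by case=> [h1|/andP[_ //]]; exact: le_trans ab.
  by move=> ->; case: (leP x a) => h1; [left|right].
- by apply/seteqP; split => x //=; rewrite !in_itv/= => -[h1 /andP[h2 _]]; move: h2; rewrite ltNge h1.
Qed.

Lemma density_mass_abs_le y : 0 <= y -> density_mass h [set x | `|x| <= y] = H y - H (- y).
Proof.
move=> y0; rewrite -density_mass_itv; last lra.
rewrite (_ : [set _ | _] = `[- y, y]%classic); last first.
  by apply/seteqP; split => x /=; rewrite in_itv/= ler_norml.
by rewrite /density_mass -Rintegral_itv_obnd_cbnd//; exact: integrable_iid_density.
Qed.

Lemma density_mass_tails x : 0 <= x ->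
  density_mass h [set y | x < `|y|] = 1 - H x + H (- x).
Proof.
move=> x0; have := density_mass_abs_le x0 => e.
have : density_mass h setT = density_mass h ([set y | `|y| <= x] `|` [set y | x < `|y|]).
  by congr density_mass; apply/seteqP; split => y //= _; case: (leP `|y| x); [left|right].
rewrite (density_mass_setT X_iid)// (density_mass_setU X_iid H_density n_gt0)//.
- by rewrite e; lra.
- rewrite (_ : [set y | x < `|y|] = ~` [set y | `|y| <= x]); first exact: measurableC.
  by apply/seteqP; split => y /=; rewrite ltNge => /negP.
- by apply/seteqP; split => y //= -[]; rewrite leNgt => /negP.
Qed.

Let abs_cdf_homo : {homo abs_cdf : x y / x <= y}.
Proof.
move=> x y xy; apply: (le_density_mass X_iid H_density n_gt0) => // z /= zx.
exact: le_trans xy.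
Qed.

Let abs_cdf_ge0 y : 0 <= abs_cdf y.
Proof. exact: (density_mass_ge0 H_density). Qed.

Let abs_cdf_le1 y : abs_cdf y <= 1.
Proof.
rewrite -(density_mass_setT X_iid H_density n_gt0).
exact: (le_density_mass X_iid H_density n_gt0).
Qed.

Hypothesis H_continuous : continuous H.

Lemma cdf_cvgy : H x @[x --> +oo] --> (1 : R).
Proof.
have [_ XH] := X_iid; have := cvg_cdfy1 (X (Ordinal n_gt0)).
rewrite (_ : cdf _ = EFin \o H); last by apply/funext => x; rewrite XH.
by move/fine_cvg.
Qed.

Lemma cdf_cvgNy : H x @[x --> -oo] --> (0 : R).
Proof.
have [_ XH] := X_iid; have := cvg_cdfNy0 (X (Ordinal n_gt0)).
rewrite (_ : cdf _ = EFin \o H); last by apply/funext => x; rewrite XH.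
by move/fine_cvg.
Qed.

(** The continuous function H x - H (- x) goes from 0 at the origin to values near 1; the
    intermediate value theorem applies. *)
Let abs_cdf_onto (q : R) : 0 < q < 1 -> exists t, abs_cdf t = q.
Proof.
move=> /andP[q0 q1].
have [B [B0 HB]] : exists B : R, 0 <= B /\ q <= H B - H (- B).
  have c1 : H x @[x --> +oo] --> (1 : R) := cdf_cvgy.
  have c0 : H (- x) @[x --> +oo] --> (0 : R).
    exact: (proj1 (cvgNy_compNP H (nbhs (0 : R))) cdf_cvgNy).
  have c : (fun x => H x - H (- x)) x @[x --> +oo] --> (1 : R).
    by rewrite -[X in _ --> X]subr0; exact: cvgB.
  have : \forall x \near +oo, 0 <= x /\ q <= H x - H (- x).
    near=> x; split; first by near: x; exact: nbhs_pinfty_ge.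
    by apply: ltW; near: x; exact: (cvgr_gt _ c).
  by move=> /pinfty_ex_gt0[B _ [B0 hB]]; exists B.
have cont : {within `[0, B], continuous (fun x => H x - H (- x))}.
  apply: continuous_subspaceT => x; apply: cvgB; first exact: H_continuous.
  by apply: (@continuous_comp _ _ _ -%R H); [exact: opp_continuous|exact: H_continuous].
have [|c + hc] := IVT B0 cont (v := q).
  by rewrite oppr0 subrr minEle maxEle; case: ifP; lra.
by rewrite in_itv/= => /andP[c0 _]; exists c; rewrite /abs_cdf /mass density_mass_abs_le.
Unshelve. all: by end_near.
Qed.

Let mlt q : measurable [set x : R | abs_cdf `|x| < q].
Proof.
apply: (@measurable_norm_preimage R [set x | abs_cdf x < q]).
apply: is_interval_measurable => x y /= ux uy z /andP[xz zy].
exact: le_lt_trans (abs_cdf_homo zy) uy.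
Qed.

(* Probability integral transform for [|X|]. *)
Let abs_cdf_uniform (q : R) : 0 <= q <= 1 -> mass [set x | abs_cdf `|x| < q] = q.
Proof.
move=> /andP[q0 q1]; apply/eqP; rewrite eq_le; apply/andP; split.
  case: (eqVneq q 0) => [->|qn0].
    rewrite (_ : [set _ | _] = set0); first by rewrite /mass /density_mass Rintegral_set0.
    by apply/seteqP; split => x //=; rewrite ltNge abs_cdf_ge0.
  case: (eqVneq q 1) => [->|qn1].
    rewrite -[leRHS](density_mass_setT X_iid H_density n_gt0).
    exact: (le_density_mass X_iid H_density n_gt0).
  have [t <-] : exists t, abs_cdf t = q by apply: abs_cdf_onto; rewrite !lt_neqAle eq_sym qn0 q0 qn1.
  apply: (le_density_mass X_iid H_density n_gt0) => // x /= lt.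
  by rewrite leNgt; apply/negP => tx; move: lt; rewrite ltNge abs_cdf_homo// ltW.
rewrite leNgt; apply/negP => lt.
have m0 := density_mass_ge0 H_density [set x | abs_cdf `|x| < q].
(* If [W] were below [q], a point [t] with [abs_cdf t] equal to the midpoint of [W] and [q] would
   put the set of mass [q'] where |x| is at most [t] inside the set of mass [W]. *)
set W := mass _ in lt m0 *; pose q' := (W + q) / 2.
have m0' : 0 <= W by exact: m0.
have [t tq] : exists t, abs_cdf t = q' by apply: abs_cdf_onto; rewrite /q'; lra.
have : q' <= W.
  rewrite -tq; apply: (le_density_mass X_iid H_density n_gt0) => // x /= xt.
  by apply: le_lt_trans (abs_cdf_homo xt) _; rewrite tq /q'; lra.
by rewrite /q'; lra.
Qed.

(** [abs_cdf] at |X| is uniform, so truncating [M%:R * abs_cdf] gives cells of mass at most 1 / [M].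
    Adding the number of cuts below [y] makes every cut a boundary: both summands are monotone, so
    equal sums force equal summands. *)
Lemma cells_exist (eta : R) (cuts : seq R) : 0 < eta ->
  exists K (kappa : R -> nat), [/\ forall y, (kappa y < K.+1)%N,
    {homo kappa : x y / x <= y >-> (x <= y)%N},
    forall k, measurable [set x : R | kappa `|x| = k],
    forall k, density_mass h [set x | kappa `|x| = k] <= eta &
    forall y y' t, kappa y = kappa y' -> t \in cuts -> (t < y) = (t < y')].
Proof.
move=> eta0; pose M := (Num.truncn eta^-1).+1.
have M0 : 0 < M%:R :> R by rewrite ltr0n.
have Meta : M%:R^-1 <= eta.
  by rewrite -[leRHS]invrK lef_pV2 ?posrE ?invr_gt0// ltW// truncnS_gt.
pose k1 (y : R) := Num.truncn (M%:R * abs_cdf y).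
pose k2 (y : R) := count (fun t => t < y) cuts.
pose kappa (y : R) := (k1 y + k2 y)%N.
have k1m : {homo k1 : x y / x <= y >-> (x <= y)%N}.
  move=> x y xy; apply: le_truncn; apply: ler_wpM2l; [exact: ltW|exact: abs_cdf_homo].
have k2m : {homo k2 : x y / x <= y >-> (x <= y)%N}.
  by move=> x y xy; apply: sub_count => t /= tx; exact: lt_le_trans xy.
have km : {homo kappa : x y / x <= y >-> (x <= y)%N}.
  by move=> x y xy; apply: leq_add; [exact: k1m|exact: k2m].
have keq (x y : R) : kappa x = kappa y -> k1 x = k1 y /\ k2 x = k2 y.
  wlog xy : x y / x <= y => [hw|].
    case: (leP x y) => [|/ltW] xy; first exact: hw.
    by move=> /esym /(hw _ _ xy)[-> ->].
  by have := k1m _ _ xy; have := k2m _ _ xy; rewrite /kappa; lia.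
have mcell k : measurable [set x : R | kappa `|x| = k].
  by apply: (@measurable_norm_preimage R [set x | kappa x = k]); exact: measurable_monotone_nat.
exists (M + size cuts)%N, kappa; split => // [y|k|].
- rewrite ltnS leq_add ?count_size// -(@ler_nat R).
  apply: (@le_trans _ _ (M%:R * abs_cdf y)); first by rewrite truncn_le mulr_ge0// ltW.
  by rewrite ler_piMr.
- have [[x0 x0k]|none] := pselect (exists x : R, kappa `|x| = k); last first.
    rewrite (_ : [set _ | _] = set0); first by rewrite /density_mass Rintegral_set0 ltW.
    by apply/seteqP; split => x //= xk; apply: none; exists x.
  pose j := k1 `|x0|.
  (* The index [j] reaches [M] where [abs_cdf] equals 1; the minimum keeps the level within the
     range of [abs_cdf_uniform]. *)
  pose Wj i := [set x : R | abs_cdf `|x| < Num.min 1 (i%:R / M%:R)].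
  have cell_sub : [set x | kappa `|x| = k] `<=` [set x : R | k1 `|x| = j].
    by move=> x /= xk; apply: (proj1 (keq _ _ _)); rewrite xk.
  have bounds (x : R) : k1 `|x| = j -> j%:R / M%:R <= abs_cdf `|x| /\ abs_cdf `|x| < j.+1%:R / M%:R.
    move=> <-; have Mc : 0 <= M%:R * abs_cdf `|x| by apply: mulr_ge0 => //; exact: ltW.
    have /andP[h1 h2] := truncn_itv Mc.
    by split; [rewrite ler_pdivrMr//|rewrite ltr_pdivlMr//]; rewrite mulrC.
  have min01 i : 0 <= Num.min (1 : R) (i%:R / M%:R) <= 1.
    by rewrite ge_min lexx le_min ler01 divr_ge0.
  have mWj i : measurable (Wj i) by exact: mlt.
  have mdiff : density_mass h [set x | kappa `|x| = k] + mass (Wj j) <= mass (Wj j.+1 `|` [set x | 1 <= abs_cdf `|x|]).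
    rewrite /mass -(density_mass_setU X_iid H_density n_gt0)//; last first.
    - apply/seteqP; split => x //= -[/cell_sub/bounds[h1 _]]; rewrite /Wj /= ltNge.
      by rewrite ge_min h1 orbT.
    - apply: (le_density_mass X_iid H_density n_gt0) => //.
      + by apply: measurableU.
      + apply: measurableU => //.
        rewrite (_ : [set _ | _] = ~` [set x : R | abs_cdf `|x| < 1]); first exact: measurableC.
        by apply/seteqP; split => x /=; rewrite leNgt => /negP.
      move=> x [/cell_sub/bounds[_ h2]|].
        by case: (ltP (abs_cdf `|x|) 1) => h3; [left; rewrite /Wj /= lt_min h3 h2|right].
      rewrite /Wj /= lt_min => /andP[a b]; left; rewrite lt_min a (lt_le_trans b)//.
      by rewrite ler_pM2r ?invr_gt0// ler_nat.
  have tail0 : mass [set x | 1 <= abs_cdf `|x|] = 0.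
    apply: (@addIr _ (mass [set x | abs_cdf `|x| < 1])); rewrite add0r.
    rewrite /mass -(density_mass_setU X_iid H_density n_gt0)//.
    + rewrite -/mass (abs_cdf_uniform (q := 1)) ?ler01 ?lexx//.
      rewrite -[RHS](density_mass_setT X_iid H_density n_gt0); congr density_mass.
      by apply/seteqP; split => x //= _; case: (leP 1 (abs_cdf `|x|)); [left|right].
    + rewrite (_ : [set _ | _] = ~` [set x : R | abs_cdf `|x| < 1]); first exact: measurableC.
      by apply/seteqP; split => x /=; rewrite leNgt => /negP.
    + by apply/seteqP; split => x //= -[]; rewrite leNgt => /negP.
  have mU : mass (Wj j.+1 `|` [set x | 1 <= abs_cdf `|x|]) = mass (Wj j.+1).
    rewrite /mass (density_mass_setU X_iid H_density n_gt0)// ?tail0.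
    + by rewrite -/mass tail0 addr0.
    + rewrite (_ : [set _ | _] = ~` [set x : R | abs_cdf `|x| < 1]); first exact: measurableC.
      by apply/seteqP; split => x /=; rewrite leNgt => /negP.
    + by apply/seteqP; split => x //= -[]; rewrite /Wj/= lt_min leNgt => /andP[-> _].
  move: mdiff; rewrite mU /Wj !abs_cdf_uniform// -addn1 natrD mulrDl mul1r => mdiff.
  have : Num.min (1 : R) (j%:R / M%:R + M%:R^-1) <= Num.min (1 : R) (j%:R / M%:R) + M%:R^-1.
    have : 0 <= M%:R^-1 :> R by rewrite invr_ge0 ltW.
    by move: (j%:R / M%:R : R) (M%:R^-1 : R) => u v v0; rewrite !minEle; do 2 case: ifP; lra.
  by move: mdiff; lra.
- move=> y y' t /keq[_ e] tc.
  wlog yy : y y' e / y <= y' => [hw|].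
    by case: (leP y y') => [|/ltW] yy; [exact: hw|rewrite (hw y' y)].
  apply/idP/idP => [ty|ty']; first exact: lt_le_trans yy.
  rewrite ltNge; apply/negP => yt.
  have : (k2 y < k2 y')%N.
    rewrite /k2 -(cat_take_drop (index t cuts) cuts) !count_cat -addnS.
    apply: leq_add; first by apply: sub_count => z /= zy; exact: lt_le_trans yy.
    rewrite (drop_nth t) ?index_mem// nth_index//= ty' [(t < y)]ltNge yt /= add0n ltnS.
    by apply: sub_count => z /= zy; exact: lt_le_trans yy.
  by rewrite e ltnn.
Qed.

End cells.

Lemma integrable_of_mass (R : realType) (h : R -> R) (A : set R) :
  measurable_fun [set: R] h -> (forall x, 0 <= h x) ->
  (\int[lebesgue_measure]_x (h x)%:E = 1)%E -> measurable A ->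
  lebesgue_measure.-integrable A (EFin \o h).
Proof.
move=> mh h0 int1 mA; apply: (@integrableS _ _ _ _ setT) => //.
apply/integrableP; split; first exact/measurable_EFinP.
by under eq_integral do rewrite /= ger0_norm//; rewrite int1 ltry.
Qed.

Lemma measurable_opp_preimage (R : realType) (A : set R) :
  measurable A -> measurable (-%R @^-1` A).
Proof. by move=> mA; rewrite -[X in measurable X]setTI; apply: oppr_measurable. Qed.

(** * Bounds on the law of the longest run *)

Section contaminated.
Context (R : realType) (F G : cumulativeBounded (0 : R) (1 : R)) (f g : R -> R) (eps mu : R).
Hypothesis F_continuous : continuous F.
Hypothesis G_continuous : continuous G.
Hypothesis F_symmetric : forall x, F (- x) = 1 - F x.
Hypothesis F_density : is_density F f.
Hypothesis G_density : is_density G g.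
Hypothesis eps01 : 0 <= eps <= 1.

Definition mixture_density (y : R) : R := (1 - eps) * f y + eps * g (y - mu).
Local Notation h := mixture_density.
Local Notation H := (contaminated_cdf F G eps mu).

Definition base_mass (C : set R) : R := density_mass f C.
Definition right_mass (C : set R) : R := density_mass (fun y => g (y - mu)) C.
(** Contamination carried by the reflection of [C], written as an integral over [C] itself. The
    hypotheses compare g at y - mu and at - y - mu, and can thus be integrated over a positive
    cell. *)
Definition left_mass (C : set R) : R := density_mass (fun y => g (- y - mu)) C.

Lemma mixture_is_density : is_density H h.
Proof.
apply: (@is_density_mix R F (fun x => G (x - mu)) f (fun x => g (x - mu)) (1 - eps) eps) => //.
- by have e01 := eps01; lra.
- by case/andP: eps01.
- exact: is_density_shift.
Qed.

Lemma contaminated_continuous : continuous H.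
Proof.
move=> x; apply: cvgD; apply: cvgM; try exact: cvg_cst; first exact: F_continuous.
apply: (@continuous_comp _ _ _ (fun y => y - mu) G); last exact: G_continuous.
by apply: cvgB; [exact: cvg_id|exact: cvg_cst].
Qed.

Let mg : measurable_fun [set: R] (fun y => g (y - mu)).
Proof. by have [] := is_density_shift mu G_density. Qed.

Let mg' : measurable_fun [set: R] (fun y => g (- y - mu)).
Proof. by apply: (measurableT_comp mg); exact: oppr_measurable. Qed.

Let g0 y : 0 <= g y. Proof. by case: G_density. Qed.
Let f0 y : 0 <= f y. Proof. by case: F_density. Qed.
Let mf : measurable_fun [set: R] f. Proof. by case: F_density. Qed.

Let int_g : (\int[lebesgue_measure]_x (g (x - mu)%R)%:E = 1)%E.
Proof.
have [mg0 _ _] := G_density.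
by rewrite (@integral_shift _ g)// preimage_setT; have [] := integrable_density G_density.
Qed.

Let int_g' : (\int[lebesgue_measure]_x (g (- x - mu)%R)%:E = 1)%E.
Proof. by rewrite (@integral_reflect _ (fun y => g (y - mu)))// preimage_setT. Qed.

Let intf C : measurable C -> lebesgue_measure.-integrable C (EFin \o f).
Proof. by apply: integrable_of_mass => //; have [] := integrable_density F_density. Qed.
Let intg C : measurable C -> lebesgue_measure.-integrable C (EFin \o (fun y => g (y - mu))).
Proof. exact: integrable_of_mass. Qed.
Let intg' C : measurable C -> lebesgue_measure.-integrable C (EFin \o (fun y => g (- y - mu))).
Proof. exact: integrable_of_mass. Qed.

Let intZ C (k : R -> R) (c : R) : measurable C -> lebesgue_measure.-integrable C (EFin \o k) ->
  lebesgue_measure.-integrable C (EFin \o (fun y => c * k y)).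
Proof.
move=> mC ik; rewrite (_ : EFin \o _ = (fun y => c%:E * (EFin \o k) y)%E)//.
exact: integrableZl.
Qed.

Let intD C (k l : R -> R) : measurable C -> lebesgue_measure.-integrable C (EFin \o k) ->
  lebesgue_measure.-integrable C (EFin \o l) ->
  lebesgue_measure.-integrable C (EFin \o (fun y => k y + l y)).
Proof.
move=> mC ik il; rewrite (_ : EFin \o _ = ((EFin \o k) \+ (EFin \o l))%E)//.
exact: integrableD.
Qed.

Lemma mixture_mass (C : set R) : measurable C ->
  density_mass h C = (1 - eps) * base_mass C + eps * right_mass C.
Proof.
move=> mC; rewrite /density_mass /mixture_density RintegralD//; try by apply: intZ => //; auto.
by rewrite !RintegralZl//; auto.
Qed.

Lemma base_mass_reflect (C : set R) : measurable C -> density_mass (fun y => f (- y)) C = base_mass C.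
Proof.
move=> mC; have [mfN fN0 eN] := is_density_reflect F_symmetric F_density.
have [_ _ e] := F_density.
rewrite /base_mass /density_mass /Rintegral.
by rewrite -(@measure_density R _ mfN fN0 (density_measure f) F).
Qed.

Lemma mixture_mass_reflect (C : set R) : measurable C ->
  density_mass h (-%R @^-1` C) = (1 - eps) * base_mass C + eps * left_mass C.
Proof.
move=> mC; have [mh h0 _] := mixture_is_density.
have -> : density_mass h (-%R @^-1` C) = density_mass (fun y => h (- y)) C.
  by rewrite /density_mass /Rintegral integral_reflect.
have intfN : lebesgue_measure.-integrable C (EFin \o (fun y => f (- y))).
  apply: integrable_of_mass => //.
  - by apply: (measurableT_comp mf); exact: oppr_measurable.
  - by rewrite integral_reflect// preimage_setT; have [] := integrable_density F_density.
rewrite {1}/density_mass /mixture_density RintegralD//; try by apply: intZ => //; auto.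
by rewrite !RintegralZl//; [rewrite -base_mass_reflect|auto].
Qed.

(** Turns a pointwise inequality between [f] and the two branches of [g] into one between masses.
    The bounds on the supremum and on the infimum are both used through it. *)
Lemma mass_combination_ge0 (C : set R) (a b c : R) : measurable C ->
  (forall y, C y -> 0 <= a * f y + (b * g (y - mu) + c * g (- y - mu))) ->
  0 <= a * base_mass C + (b * right_mass C + c * left_mass C).
Proof.
move=> mC h0; rewrite /base_mass /right_mass /left_mass /density_mass.
rewrite -!RintegralZl//; auto.
rewrite -RintegralD//; try by apply: intZ => //; auto.
rewrite -RintegralD//; first exact: Rintegral_ge0.
- by apply: intZ => //; auto.
- by apply: intD => //; apply: intZ => //; auto.
Qed.

Lemma window_mass_ge (a b D : R) : a <= b ->
  (forall y, a < y <= b -> D <= f y + eps * g (y - mu)) ->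
  D * (b - a) <= base_mass `]a, b] + eps * right_mass `]a, b].
Proof.
move=> ab hD; have mC : measurable (`]a, b]%classic : set R) by exact: measurable_itv.
have leb : lebesgue_measure (`]a, b]%classic : set R) = (b - a)%:E.
  rewrite lebesgue_measure_itv/= lte_fin EFinB; case: ltP => // ba.
  by rewrite -EFinB (_ : b - a = 0)//; apply/eqP; rewrite subr_eq0 eq_le ba ab.
have -> : D * (b - a) = \int[lebesgue_measure]_(x in `]a, b]) D.
  by rewrite Rintegral_cst//; congr (_ * _); rewrite -[LHS]/(fine (b - a)%:E) -leb.
rewrite /right_mass /base_mass /density_mass -RintegralZl//; last exact: intg.
rewrite -RintegralD//; [|exact: intf|by apply: intZ => //; exact: intg].
apply: le_Rintegral => //.
- apply/integrableP; split; first exact: measurable_cst.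
  by under eq_integral do rewrite /=; rewrite integral_cst//= leb -EFinM ltry.
- by apply: intD => //; [exact: intf|apply: intZ => //; exact: intg].
Qed.

Context (d : measure_display) (T : measurableType d) (P : probability T R).
Variables (n : nat) (X : 'I_n -> {RV P >-> R}).
Hypothesis n_gt0 : (0 < n)%N.
Hypothesis X_iid : iid_with_cdf P X H.

Let dH := mixture_is_density.
Local Notation prob_L A := (fine (P (longest_run_statistic X @^-1` A))).

Section with_cells.
Variables (K : nat) (kappa : R -> nat).
Hypothesis kappa_lt : forall y, (kappa y < K.+1)%N.
Hypothesis kappa_homo : {homo kappa : x y / x <= y >-> (x <= y)%N}.
Hypothesis kappa_meas : forall k, measurable [set x : R | kappa `|x| = k].

Definition poscell (k : 'I_K.+1) : set R := [set x | kappa `|x| = k /\ 0 < x].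
Definition cell_mass (k : 'I_K.+1) : R := density_mass h [set x | kappa `|x| = k].
Definition pos_mass (k : 'I_K.+1) : R := density_mass h (poscell k).
Definition neg_mass (k : 'I_K.+1) : R := density_mass h (-%R @^-1` poscell k).

(* Probability of a plus in cell [k], with the junk value [r] on null cells. *)
Definition plus_prob (r : R) (k : 'I_K.+1) : R :=
  if cell_mass k == 0 then r else pos_mass k / cell_mass k.

Lemma measurable_poscell k : measurable (poscell k).
Proof.
rewrite (_ : poscell k = [set x : R | kappa `|x| = k] `&` `]0, +oo[%classic).
  exact: measurableI.
by apply/seteqP; split => x /=; rewrite in_itv/= andbT.
Qed.

Let mass_ge0 (A : set R) : 0 <= density_mass h A. Proof. exact: (density_mass_ge0 dH). Qed.

(** The only point without a sign is 0, which has mass zero. *)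
Lemma cell_massE k : cell_mass k = pos_mass k + neg_mass k.
Proof.
have mp := measurable_poscell k; have mn := measurable_opp_preimage mp.
rewrite /cell_mass /pos_mass /neg_mass -(density_mass_setU X_iid dH n_gt0)//; last first.
  by apply/seteqP; split => x //= -[[_ x0] [_ nx0]]; lra.
have [k0|k0] := eqVneq (kappa 0) k; last first.
  congr density_mass; apply/seteqP; split => x /=; last first.
    by rewrite /poscell /= normrN; case=> -[].
  rewrite /poscell /= normrN; case: (ltrgt0P x) => x0 xk; first by left.
    by right; rewrite oppr_gt0.
  by move: k0; rewrite -xk eqxx.
transitivity (density_mass h ((poscell k `|` -%R @^-1` poscell k) `|` [set 0])).
  congr density_mass; apply/seteqP; split => x /=; last first.
    by rewrite /poscell /= normrN; case=> [[[]|[]]|->] //; rewrite normr0.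
  rewrite /poscell /= normrN; case: (ltrgt0P x) => x0 xk.
  - by left; left.
  - by left; right; rewrite oppr_gt0.
  - by right.
have mpn := measurableU _ _ mp mn.
rewrite [LHS](density_mass_setU X_iid dH n_gt0)//; last first.
  by apply/seteqP; split => x //= -[[[_ a]|[_ a]] x0]; move: a; rewrite x0 ?oppr0 ltxx.
by rewrite [X in _ + X]/density_mass Rintegral_set1 addr0.
Qed.

Lemma cell_mass_ge0 k : 0 <= cell_mass k. Proof. exact: mass_ge0. Qed.

Lemma plus_probM r k : cell_mass k * plus_prob r k = pos_mass k.
Proof.
rewrite /plus_prob; case: eqP => [e|/eqP ne]; last by rewrite mulrC divfK.
have := cell_massE k; have : 0 <= pos_mass k by exact: mass_ge0.
by have : 0 <= neg_mass k by [exact: mass_ge0]; rewrite e mul0r; lra.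
Qed.

Lemma plus_prob01 r k : 0 <= r <= 1 -> 0 <= plus_prob r k <= 1.
Proof.
move=> r01; rewrite /plus_prob; case: eqP => // /eqP ne.
have c0 : 0 < cell_mass k by rewrite lt_def ne cell_mass_ge0.
have := cell_massE k; have : 0 <= neg_mass k by exact: mass_ge0.
have : 0 <= pos_mass k by exact: mass_ge0.
by move=> ? ? ?; rewrite divr_ge0//= ?ler_pdivrMr ?mul1r; lra.
Qed.

Let cell_fibre k : (fun x : R => inord (kappa `|x|) : 'I_K.+1) @^-1` [set k]
  = [set x | kappa `|x| = k].
Proof.
apply/seteqP; split => x /= => [<-|e]; first by rewrite inordK.
by apply/val_inj; rewrite /= inordK.
Qed.

Lemma sum_cell_mass_cond (B : pred 'I_K.+1) :
  \sum_(k | B k) cell_mass k = density_mass h [set x | B (inord (kappa `|x|))].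
Proof.
rewrite (density_mass_fibres X_iid dH (c := fun x => inord (kappa `|x|)) B n_gt0).
  by apply: eq_bigr => k _; rewrite cell_fibre.
by move=> k; rewrite cell_fibre.
Qed.

Lemma sum_cell_mass : \sum_k cell_mass k = 1.
Proof.
by rewrite (sum_cell_mass_cond xpredT) -(density_mass_setT X_iid dH n_gt0); congr density_mass; apply/seteqP.
Qed.

Lemma longest_run_plus_prob (r eta : R) (A : set nat) : 0 <= r <= 1 ->
  (forall k, cell_mass k <= eta) ->
  `|prob_L A - untied_expct n cell_mass (plus_prob r) (\1_A \o run_length)|
    <= n%:R ^+ 2 * eta.
Proof.
move=> r01 heta; apply: (longest_run_cells X_iid dH (kappa := kappa)) => //.
- by move=> y y' _ yy; exact: kappa_homo.
- by move=> k; rewrite plus_probM.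
- by move=> k; exact: plus_prob01.
Qed.

End with_cells.

Let indic01 (A : set nat) (s : seq bool) : 0 <= ((\1_A \o run_length) s : R) <= 1.
Proof. by rewrite /= indicE; case: (_ \in _); rewrite ?lexx ?ler01. Qed.

(** Lets the mesh of the cells tend to 0, which removes the cost of ties. *)
Lemma le_of_le_add_eps (a b c : R) : (forall eta, 0 < eta -> a <= b + c * eta) -> a <= b.
Proof.
move=> hab; rewrite leNgt; apply/negP => ba.
have c1 : 0 < `|c| + 1 by have := normr_ge0 c; lra.
have e0 : 0 < (a - b) / (2 * (`|c| + 1)) by rewrite divr_gt0//; lra.
have := hab _ e0; have : c * ((a - b) / (2 * (`|c| + 1))) <= (`|c| + 1) * ((a - b) / (2 * (`|c| + 1))).
  by apply: ler_wpM2r; [exact: ltW|have := ler_norm c; lra].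
have -> : (`|c| + 1) * ((a - b) / (2 * (`|c| + 1))) = (a - b) / 2 by field; lra.
lra.
Qed.

(** The null hypothesis is the case [eps = 0]: symmetry gives each positive cell the mass of its
    reflection, so the parameter 1/2 is exact, null cells included. *)
Lemma longest_run_fair (A : set nat) : eps = 0 ->
  prob_L A = fair n (\1_A \o run_length).
Proof.
move=> eps0; apply/eqP; rewrite -subr_eq0 -normr_eq0 eq_le normr_ge0 andbT.
apply: (@le_of_le_add_eps _ _ (2 * n%:R ^+ 2)) => eta eta0; rewrite add0r.
have [K [kappa [kK kh km ke _]]] := cells_exist X_iid dH n_gt0 contaminated_continuous [::] eta0.
have p12 (k : 'I_K.+1) : cell_mass kappa k * (1 / 2) = pos_mass kappa k :> R.
  rewrite (@cell_massE K kappa km k) /neg_mass mixture_mass_reflect; last exact: measurable_poscell.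
  by rewrite /pos_mass mixture_mass; [rewrite eps0; lra|exact: measurable_poscell].
have h1 : `|prob_L A - untied_expct n (cell_mass kappa) (fun _ : 'I_K.+1 => 1 / 2) (\1_A \o run_length)| <= n%:R ^+ 2 * eta.
  apply: (longest_run_cells X_iid dH (kappa := kappa)) => //.
  - by move=> y y' _ yy; exact: kh.
  - by move=> k; exact: ke.
  - by move=> k; lra.
have h2 := @untied_expct_fair_gap R n K.+1 (cell_mass kappa) (fun=> 1 / 2)
  (fun k => @cell_mass_ge0 K kappa k) (sum_cell_mass kK km) (\1_A \o run_length) eta (fun=> 0) (indic01 A)
  (fun k => ke k) (fun=> lexx 0).
have h2' : `|untied_expct n (cell_mass kappa) (fun _ : 'I_K.+1 => 1 / 2) (\1_A \o run_length) - fair n (\1_A \o run_length)| <= n%:R ^+ 2 * eta.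
  apply: le_trans (h2 _) _ => [k _|].
    by rewrite /rank_expct fair_expct size_ranked subrr normr0.
  by rewrite big1 ?addr0// => k _; rewrite mulr0.
by apply: le_trans (ler_distD (untied_expct n (cell_mass kappa) (fun _ : 'I_K.+1 => 1 / 2) (\1_A \o run_length)) _ _) _; lra.
Qed.

(** On cells below [x] the bound on [g] limits the excess of pluses to [eps * s]. Cells beyond [x]
    are the bad ones, of total mass 1 - H x + H (- x). *)
Lemma longest_run_gap (A : set nat) (s x : R) (l : nat) :
  eps <= 1 / 2 -> 0 <= s -> 0 <= x -> H 0 <= 1 / 2 -> (0 < l <= n)%N ->
  (forall y, 0 <= y <= x -> g (y - mu) - g (- y - mu) <= s * (f y + eps * g (y - mu))) ->
  `|prob_L A - fair n (\1_A \o run_length)|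
    <= n%:R * (1 - H x + H (- x))
     + (1 - (1 / 2) ^+ l.+1) ^+ (n - l)
     + l%:R * (1 / 2) ^+ l.-1 * (n%:R * (eps * s + (1 - H x + H (- x))))
     + n%:R * l%:R * (eps * s * (1 / 2 + eps * s) ^+ l.-1).
Proof.
move=> eps2 s0 x0 H0 ln hs; have e01 := eps01; set tl := 1 - H x + H (- x).
apply: (@le_of_le_add_eps _ _ (2 * n%:R ^+ 2)) => eta eta0.
have [K [kappa [kK kh km ke kc]]] := cells_exist X_iid dH n_gt0 contaminated_continuous [:: x] eta0.
have es0 : 0 <= eps * s by rewrite mulr_ge0//; lra.
(* Since [x] is a cut, a cell with one point beyond [x] lies entirely beyond it. *)
pose bad (k : 'I_K.+1) := `[< exists2 y, x < y & kappa y = k >].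
have badE (y : R) (k : 'I_K.+1) : kappa y = k -> bad k = (x < y).
  move=> yk; apply/asboolP/idP => [[y' xy' yk']|xy]; last by exists y.
  by rewrite (kc y y' x)// ?yk ?yk'// mem_head.
have bad_mass : \sum_(k | bad k) cell_mass kappa k = tl.
  rewrite /tl (sum_cell_mass_cond kK km) -(density_mass_tails X_iid dH n_gt0 x0).
  congr density_mass; apply/seteqP; split => y /=.
    by rewrite (badE `|y|)// inordK.
  by move=> xy; rewrite (badE `|y|)// inordK.
have good (k : 'I_K.+1) : ~~ bad k -> pos_mass kappa k - neg_mass kappa k <= 2 * (eps * s) * pos_mass kappa k.
  move=> gk; have mp := measurable_poscell km k.
  have := @mass_combination_ge0 (poscell kappa k) s (s * eps - 1) 1 mp.
  have hy y : poscell kappa k y -> 0 <= s * f y + ((s * eps - 1) * g (y - mu) + 1 * g (- y - mu)).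
    move=> [yk y0]; have xy : ~~ (x < y) by rewrite -(badE y k)// -yk gtr0_norm.
    have := hs y; rewrite ltW// leNgt xy => /(_ isT).
    by move: (f y) (g (y - mu)) (g (- y - mu)) => F' G1 G2 hh; nra.
  move=> /(_ hy); rewrite /pos_mass /neg_mass mixture_mass_reflect// mixture_mass//.
  have b0 : 0 <= base_mass (poscell kappa k) by apply: Rintegral_ge0.
  have r0 : 0 <= right_mass (poscell kappa k) by apply: Rintegral_ge0.
  move: (base_mass _) (right_mass _) (left_mass _) b0 r0 => bF bG bG' b0 r0 hh.
  have e1 : eps * (bG - bG') <= eps * s * (bF + eps * bG).
    by have /andP[e0 _] := eps01; have := mulr_ge0 e0 hh; lra.
  (* [eps <= 1 / 2] gives 1 <= 2 (1 - eps). The hypothesis has f + eps g in the denominator, while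
     the actual density has the weight 1 - eps on f; this costs the factor 2. *)
  have : eps * s * (bF + eps * bG) <= eps * s * (2 * ((1 - eps) * bF + eps * bG)).
    apply: ler_wpM2l => //; have /andP[e0 _] := eps01; have := mulr_ge0 e0 r0.
    have : 0 <= (1 - 2 * eps) * bF by apply: mulr_ge0 => //; lra.
    lra.
  lra.
have pos0 (k : 'I_K.+1) : 0 <= pos_mass kappa k by exact: (density_mass_ge0 dH).
have neg0 (k : 'I_K.+1) : 0 <= neg_mass kappa k by exact: (density_mass_ge0 dH).
have cm0 := @cell_mass_ge0 K kappa.
have tl0 : 0 <= tl by rewrite -bad_mass; apply: sumr_ge0.
have cE := @cell_massE K kappa km.
have p_le (k : 'I_K.+1) : ~~ bad k -> plus_prob kappa 0 k <= 1 / 2 + eps * s.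
  move=> gk; rewrite /plus_prob; case: eqP => [_|/eqP ne]; first lra.
  have c0 : 0 < cell_mass kappa k by rewrite lt_def ne cm0.
  rewrite ler_pdivrMr//; have := good k gk; have := cE k; have := neg0 k; have := pos0 k.
  have : 0 <= eps * s * neg_mass kappa k by rewrite mulr_ge0.
  by move=> ? ? ? e ?; rewrite e; lra.
have meanE : \sum_(k < K.+1) (pos_mass kappa k - neg_mass kappa k) = 1 - 2 * H 0 :> R.
  transitivity (\sum_(k < K.+1) (2 * pos_mass kappa k - cell_mass kappa k)).
    by apply: eq_bigr => k _; rewrite cE; ring.
  rewrite sumrB (sum_cell_mass kK km) -mulr_sumr.
  have -> : \sum_(k < K.+1) pos_mass kappa k = 1 - H 0.
    have mpos : measurable [set x : R | 0 < x].
      rewrite (_ : [set _ | _] = `]0, +oo[%classic)//.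
      by apply/seteqP; split => z /=; rewrite in_itv/= andbT.
    have := density_mass_fibres X_iid dH (c := fun z => (inord (kappa `|z|) : 'I_K.+1, 0 < z)) (fun a => a.2) n_gt0.
    have fibE a : (fun z => (inord (kappa `|z|) : 'I_K.+1, 0 < z)) @^-1` [set a] =
        [set z : R | kappa `|z| = a.1] `&` (if a.2 then [set z | 0 < z] else ~` [set z | 0 < z]).
      case: a => k b; apply/seteqP; split => z /=.
        by case=> <- <-; rewrite inordK//; split => //; case: ifP => // /negbT/negP.
      move=> [zk hb]; congr (_, _); first by apply/val_inj; rewrite /= inordK.
      by case: b hb => //= /negP/negbTE.
    have mfib a : measurable ((fun z => (inord (kappa `|z|) : 'I_K.+1, 0 < z)) @^-1` [set a]).
      by rewrite fibE; apply: measurableI => //; case: ifP => // _; exact: measurableC.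
    move=> /(_ mfib).
    have -> : [set z : R | ((inord (kappa `|z|) : 'I_K.+1, 0 < z)).2] = [set z | 0 < z] by [].
    have -> : density_mass h [set z | 0 < z] = 1 - H 0.
      rewrite -(density_mass_itvNy dH) -(density_mass_setT X_iid dH n_gt0).
      rewrite (_ : [set: R] = `]-oo, 0] `|` [set z | 0 < z]); last first.
        by apply/seteqP; split => z //= _; rewrite in_itv/=; case: (leP z 0); [left|right].
      rewrite (density_mass_setU X_iid dH n_gt0)//; first by rewrite addrC addKr.
      by apply/seteqP; split => z //= -[]; rewrite in_itv/= leNgt => /negP.
    move=> ->; rewrite (reindex_onto (fun k : 'I_K.+1 => (k, true)) (fun a => a.1)) /=; last first.
      by case=> a b /= ->.
    by apply: eq_big => [k|k _]; [rewrite eqxx|rewrite fibE].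
  ring.
(* The signed excesses [pos_mass - neg_mass] have the nonnegative sum 1 - 2 H 0, so the deficits are
   at most the excesses, and these are bounded by [good] or by the mass of the bad cells. *)
have avg : \sum_(k < K.+1) cell_mass kappa k * Num.max (1 / 2 - plus_prob kappa 0 k) 0 <= eps * s + tl.
  have step (k : 'I_K.+1) : cell_mass kappa k * Num.max (1 / 2 - plus_prob kappa 0 k) 0
      <= (neg_mass kappa k - pos_mass kappa k) / 2 + (eps * s * pos_mass kappa k + (if bad k then cell_mass kappa k else 0)).
    rewrite maxr_pMr ?cm0// mulr0 mulrBr plus_probM// cE.
    have := neg0 k; have := pos0 k; have e := mulr_ge0 es0 (pos0 k).
    rewrite ge_max; case: ifPn => [_|gk] ? ?; first by apply/andP; split; lra.
    by have := good k gk => ?; apply/andP; split; lra.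
  apply: le_trans (ler_sum _ (fun k _ => step k)) _.
  rewrite !big_split /= -mulr_suml -mulr_sumr -big_mkcond /= bad_mass.
  have -> : \sum_(k < K.+1) (neg_mass kappa k - pos_mass kappa k) = 2 * H 0 - 1.
    rewrite -[RHS]opprB -meanE -sumrN; apply: eq_bigr => k _; ring.
  have : \sum_(k < K.+1) pos_mass kappa k <= 1.
    by rewrite -(sum_cell_mass kK km); apply: ler_sum => k _; rewrite cE lerDl.
  have sp0 : 0 <= \sum_(k < K.+1) pos_mass kappa k by exact: sumr_ge0.
  by move=> sp1; have := ler_wpM2l es0 sp1; rewrite mulr1; lra.
(* An upper bound on [plus_prob] is wanted, so null cells receive the value 0; the window bound
   below uses 1 for the opposite reason. *)
have r01 : 0 <= (0 : R) <= 1 by rewrite lexx ler01.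
have h1 := longest_run_plus_prob kK kh km A r01 (fun k => ke k).
have h2 := @untied_expct_run_gap R n K.+1 (cell_mass kappa) (plus_prob kappa 0) cm0 (sum_cell_mass kK km)
   (fun k => plus_prob01 km k r01) (\1_A) eta (eps * s) bad l.
have {}h2 := h2 (fun j => ltac:(by rewrite indicE; case: (_ \in _); rewrite ?lexx ?ler01)) (fun k => ke k) es0 p_le ln.
apply: le_trans (ler_distD (untied_expct n (cell_mass kappa) (plus_prob kappa 0) (\1_A \o run_length)) _ _) _.
rewrite bad_mass in h2.
have c20 : 0 <= l%:R * (1 / 2 : R) ^+ l.-1 * n%:R.
  by rewrite !mulr_ge0//; apply: exprn_ge0; lra.
have := ler_wpM2l c20 avg; rewrite -!mulrA in h2 *; move: h1 h2.
set c1 := (1 - _) ^+ _; set c3 := n%:R * (l%:R * _); set u := untied_expct _ _ _ _.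
move=> h1 h2 h3; move: h1 h2; move: (_ * (_ * (_ * \sum_k _))) h3 => t2 h3.
by move: (l%:R * _) h3 => t3 h3; lra.
Qed.

(** Integrating the first inequality over a cell gives neg <= (1 - a) pos, that is, a plus
    probability of at least 1 / (2 - a). The second bounds the mass of the window from below. *)
Lemma longest_run_window (x1 x2 a D : R) (N0 q l : nat) :
  0 <= x1 -> x1 <= x2 -> 0 < a < 1 -> 0 <= D ->
  (forall y, x1 < y <= x2 -> a * (f y + eps * g (y - mu)) <= eps * (g (y - mu) - g (- y - mu))) ->
  (forall y, x1 < y <= x2 -> D <= f y + eps * g (y - mu)) ->
  (q * l <= N0)%N ->
  prob_L [set k | (k < l)%N]
    <= 2 ^+ N0 * (1 - (1 - eps) * (D * (x2 - x1)) / 2) ^+ n + (1 - (2 - a)^-1 ^+ l) ^+ q.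
Proof.
move=> x10 x12 a01 D0 hg hD ql.
apply: (@le_of_le_add_eps _ _ (n%:R ^+ 2)) => eta eta0.
have [K [kappa [kK kh km ke kc]]] := cells_exist X_iid dH n_gt0 contaminated_continuous [:: x1; x2] eta0.
(* The condition of lying beyond [x], read on cell indices: up-closed by construction, and exact
   when [x] is a cut. *)
pose U (x : R) (k : nat) := `[< exists2 y, x < y & (kappa y <= k)%N >].
have up x : forall j k, (k <= j)%N -> U x k -> U x j.
  by move=> j k kj /asboolP[y xy yk]; apply/asboolP; exists y => //; exact: leq_trans kj.
have UE (x y : R) : x \in [:: x1; x2] -> U x (kappa y) = (x < y).
  move=> xc; apply/asboolP/idP => [[y' xy' yy']|xy]; last by exists y.
  rewrite ltNge; apply/negP => yx.
  have /eqP e : kappa y' == kappa y by rewrite eqn_leq yy' kh// ltW// (le_lt_trans yx).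
  by move: xy'; rewrite (kc y' y x)// ltNge yx.
pose mid (k : nat) := U x1 k && ~~ U x2 k.
have midE y : mid (kappa y) = (x1 < y <= x2).
  by rewrite /mid !UE ?inE ?eqxx ?orbT// -leNgt.
have mitv : measurable (`]x1, x2]%classic : set R) by exact: measurable_itv.
have mid_mass : (1 - eps) * (D * (x2 - x1)) <= \sum_(k < K.+1 | mid k) cell_mass kappa k.
  rewrite (sum_cell_mass_cond kK km (fun k => mid k)).
  apply: (@le_trans _ _ (density_mass h `]x1, x2])).
    rewrite mixture_mass//; have := window_mass_ge x12 hD.
    have /andP[e0 e1] := eps01.
    have b0 : 0 <= base_mass `]x1, x2] by apply: Rintegral_ge0.
    have r0 : 0 <= right_mass `]x1, x2] by apply: Rintegral_ge0.
    move: (base_mass _) (right_mass _) (D * _) b0 r0 => bF bG w b0 r0 hw.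
    have e1' : 0 <= 1 - eps by lra.
    have := ler_wpM2l e1' hw; have : 0 <= eps * (eps * bG) by rewrite !mulr_ge0.
    by lra.
  apply: (le_density_mass X_iid dH n_gt0) => //.
    apply: (@measurable_finite_valued _ _ _ (fun z : R => inord (kappa `|z|) : 'I_K.+1) _ (fun k => mid k)) => k.
    rewrite (_ : _ @^-1` _ = [set x : R | kappa `|x| = k])//.
    apply/seteqP; split => x /= => [<-|e]; first by rewrite inordK.
    by apply/val_inj; rewrite /= inordK.
  move=> y /=; rewrite in_itv/= inordK// midE => /andP[y1 y2].
  by rewrite gtr0_norm ?y1//; lra.
have pos0 (k : 'I_K.+1) : 0 <= pos_mass kappa k by exact: (density_mass_ge0 dH).
have neg0 (k : 'I_K.+1) : 0 <= neg_mass kappa k by exact: (density_mass_ge0 dH).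
have cE := @cell_massE K kappa km.
have p0 : 0 <= (2 - a)^-1 <= 1.
  by rewrite invr_ge0 invf_le1; lra.
have r01 : 0 <= (1 : R) <= 1 by rewrite lexx ler01.
have pp (k : 'I_K.+1) : mid k -> (2 - a)^-1 <= plus_prob kappa 1 k.
  move=> mk; rewrite /plus_prob; case: eqP => [_|/eqP ne]; first by case/andP: p0.
  have c0 : 0 < cell_mass kappa k by rewrite lt_def ne cell_mass_ge0.
  rewrite ler_pdivlMr// mulrC ler_pdivrMr; last lra.
  rewrite cE; suff : neg_mass kappa k <= (1 - a) * pos_mass kappa k by lra.
  have mp := measurable_poscell km k.
  have := @mass_combination_ge0 (poscell kappa k) (- a) (eps - a * eps) (- eps) mp.
  have hy y : poscell kappa k y -> 0 <= (- a) * f y + ((eps - a * eps) * g (y - mu) + (- eps) * g (- y - mu)).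
    move=> [yk y0]; have := hg y; rewrite -midE -{1}(gtr0_norm y0) yk mk => /(_ isT); lra.
  move=> /(_ hy); rewrite /pos_mass /neg_mass mixture_mass_reflect// mixture_mass//.
  have b0 : 0 <= base_mass (poscell kappa k) by apply: Rintegral_ge0.
  move: (base_mass _) (right_mass _) (left_mass _) b0 => bF bG bG' b0 hh.
  have /andP[e0 e1] := eps01; have ae : 0 <= a * (eps * bF) by rewrite !mulr_ge0//; lra.
  lra.
have h1 := longest_run_plus_prob kK kh km [set k | (k < l)%N] r01 (fun k => ke k).
have h2 := @untied_expct_no_run R n K.+1 (cell_mass kappa) (plus_prob kappa 1)
  (@cell_mass_ge0 K kappa) (sum_cell_mass kK km) (fun k => plus_prob01 km k r01)
  (U x2) (U x1) _ N0 q l (up x2) (up x1) p0 pp ql.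
have e : (\1_[set k | (k < l)%N] \o run_length) = (fun s => (~~ has_run l s)%:R) :> (seq bool -> R).
  by apply/funext => s /=; rewrite indicE -leq_run_length -ltnNge; congr (_%:R); congr nat_of_bool;
    apply/idP/idP => [/set_mem //|h3]; exact/mem_set.
rewrite e in h1.
have m1 : \sum_(k < K.+1 | mid k) cell_mass kappa k <= 1.
  rewrite -(sum_cell_mass kK km) [leLHS]big_mkcond; apply: ler_sum => k _.
  by case: ifP => // _; exact: cell_mass_ge0.
have h3 : 2 ^+ N0 * (1 - (\sum_(k < K.+1 | mid k) cell_mass kappa k) / 2) ^+ n
   <= 2 ^+ N0 * (1 - (1 - eps) * (D * (x2 - x1)) / 2) ^+ n.
  apply: ler_wpM2l; first exact: exprn_ge0.
  by apply: lerXn2r; rewrite ?nnegrE; lra.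
move: h1 h2; set u := untied_expct _ _ _ _ => h1 h2.
have := ler_norm (prob_L [set k | (k < l)%N] - u).
by rewrite /mid in h3 *; lra.
Qed.

(** If no observation is below - x, all those with absolute value beyond [x] are pluses, and they
    come first in the list. No cells are needed, since ties do not disturb this prefix. *)
Lemma longest_run_outliers (x : R) (l : nat) : 0 <= x ->
  prob_L [set k | (k < l)%N] <= 2 ^+ l * (1 - (1 - H x) / 2) ^+ n + n%:R * H (- x).
Proof.
move=> x0.
pose c (y : R) : bool * bool := (x < y, y < - x).
have mlt : measurable [set y : R | x < y].
  by rewrite (_ : [set _ | _] = `]x, +oo[%classic)//; apply/seteqP; split => y /=; rewrite in_itv/= andbT.
have mgt : measurable [set y : R | y < - x].
  by rewrite (_ : [set _ | _] = `]-oo, - x[%classic)//; apply/seteqP; split => y /=; rewrite in_itv.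
have mc a : measurable (c @^-1` [set a]).
  case: a => a1 a2.
  rewrite (_ : _ @^-1` _ = (if a1 then [set y | x < y] else ~` [set y | x < y]) `&`
     (if a2 then [set y | y < - x] else ~` [set y | y < - x])).
    by apply: measurableI; case: ifP => // _; exact: measurableC.
  apply/seteqP; split => y /=; first by case=> <- <-; split; case: ifP => // /negbT/negP.
  by case: a1; case: a2; move=> [h1 h2]; congr (_, _) => //; apply/negbTE/negP.
pose B (b : {ffun 'I_n -> bool * bool}) :=
  [exists i, (b i).2] || (#|[pred i | (b i).1]| < l)%N.
pose w a := density_mass h (c @^-1` [set a]).
have w0 a : 0 <= w a by exact: (density_mass_ge0 dH).
have wS (Q : pred (bool * bool)) : \sum_(a | Q a) w a = density_mass h [set y | Q (c y)].
  by rewrite (density_mass_fibres X_iid dH Q n_gt0 mc).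
have w1 : \sum_a w a = 1.
  by rewrite wS -(density_mass_setT X_iid dH n_gt0); congr density_mass; apply/seteqP.
have := iid_law X_iid dH B mc.
have mX i D : measurable D -> measurable (X i @^-1` D).
  by move=> mD; rewrite -[X in measurable X]setTI; apply: (measurable_funP (X i)).
have mB : measurable [set t | B [ffun i => c (X i t)]].
  apply: (measurable_finite_valued (b := fun t => [ffun i => c (X i t)])) => b.
  have -> : (fun t => [ffun i => c (X i t)]) @^-1` [set b]
      = \bigcap_(i in [set: 'I_n]) X i @^-1` (c @^-1` [set b i]).
    apply/seteqP; split => t /=; first by move=> <- i _ /=; rewrite ffunE.
    by move=> hw; apply/ffunP => i; rewrite ffunE; exact: hw.
  by apply: fin_bigcap_measurable => // i _; apply: mX.
move=> PB; apply: (@le_trans _ _ (fine (P [set t | B [ffun i => c (X i t)]]))).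
  apply: fine_le; rewrite ?fin_num_measure//; try exact: measurable_longest_run.
  apply: le_measure; rewrite ?inE//; first exact: measurable_longest_run.
  move=> t /=; rewrite /B; case: existsP => //= noneg short.
  rewrite ltnNge; apply/negP => many; move: short; rewrite ltnNge => /negP; apply.
  rewrite /longest_run_statistic longest_runE leq_run_length sort_map -map_comp.
  set r := sort _ _.
  have tr : transitive (relpre (X^~ t) (fun u v : R => `|v| <= `|u|)).
    by move=> v u z /= uv vz; exact: le_trans vz uv.
  have srt : sorted (relpre (X^~ t) (fun u v : R => `|v| <= `|u|)) r.
    by apply: sort_sorted => i j; exact: le_total.
  have := sorted_filter_upset (U := fun i => x < `|X i t|) tr _ srt.
  move=> /(_ _) -> => [|i j /= ij xj]; last exact: lt_le_trans xj ij.
  rewrite map_cat; set r1 := [seq i <- r | _].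
  have -> : [seq 0 < X i t | i <- r1] = nseq (size r1) true.
    rewrite -(size_map (fun i => 0 < X i t) r1); apply/all_pred1P; rewrite all_map; apply/allP => i; rewrite mem_filter => /andP[xi _] /=.
    rewrite eqb_id ltNge; apply/negP => Xi; apply: noneg; exists i; rewrite ffunE /=.
    by move: xi; rewrite ler0_norm//; lra.
  apply: (@has_run_sub _ (size r1)); last exact: has_run_nseq.
  apply: leq_trans many _; rewrite size_filter (permP (permEl (perm_sort _ _))) cardE size_filter enumT.
  apply: sub_count => i; rewrite !inE ffunE /= => xi; exact: lt_le_trans (ler_norm _).
rewrite PB.
have sw0 (b : {ffun 'I_n -> bool * bool}) : 0 <= sample_wt w b by exact: sample_wt_ge0.
apply: (@le_trans _ _ (\sum_(b : {ffun 'I_n -> bool * bool}) sample_wt w b * (#|[pred i | (b i).1]| < l)%:R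
    + \sum_(b : {ffun 'I_n -> bool * bool}) sample_wt w b * [exists i, (b i).2]%:R)).
  rewrite -big_split big_mkcond; apply: ler_sum => b _ /=; rewrite -mulrDr /B.
  by case: ifP => [/orP[->|->]|_]; [apply: ler_peMr => //; rewrite ?lerDr ?lerDl ?ler0n| |];
    rewrite ?mulr_ge0 ?addr_ge0//; apply: ler_peMr => //; rewrite ?lerDr ?lerDl ?ler0n.
apply: lerD.
  apply: le_trans (count_lower_tail n w0 w1 (fun a => a.1) l) _.
  rewrite (_ : \sum_(a | a.1) w a = 1 - H x)//.
  rewrite (wS (fun a => a.1)) /c /= -(density_mass_itvNy dH x) -(density_mass_setT X_iid dH n_gt0).
  rewrite (_ : [set: R] = `]-oo, x] `|` [set y | x < y]); last first.
    by apply/seteqP; split => y //= _; rewrite in_itv/=; case: (leP y x); [left|right].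
  rewrite (density_mass_setU X_iid dH n_gt0)//; first by rewrite addrC addKr.
  by apply/seteqP; split => y //= -[]; rewrite in_itv/= leNgt => /negP.
apply: le_trans (union_bound n w0 w1 (fun a => a.2)) _.
apply: ler_wpM2l => //; rewrite (wS (fun a => a.2)) -(density_mass_itvNy dH).
apply: (le_density_mass X_iid dH n_gt0) => //.
by move=> y /=; rewrite in_itv/= => /ltW.
Qed.

End contaminated.

(** * Asymptotics *)

Section real_bounds.
Variable R : realType.
Implicit Types x y u : R.

Lemma expRN_le x : 0 <= x -> expR (- x) <= (1 + x)^-1.
Proof.
move=> x0; rewrite expRN lef_pV2 ?posrE ?expR_gt0 ?expR_ge1Dx//; lra.
Qed.

Lemma exprB1_le y N : 0 <= y <= 1 -> (1 - y) ^+ N <= expR (- (N%:R * y)).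
Proof.
move=> y01; rewrite -mulrN expRM_natl; apply: lerXn2r; rewrite ?nnegrE ?expR_ge0//; first lra.
exact: expR_ge1Dx.
Qed.

Lemma exprD1_le2 u k : 0 <= u -> k%:R * u <= 1 / 2 -> (1 + u) ^+ k <= 2.
Proof.
move=> u0 ku; apply: (@le_trans _ _ (expR (k%:R * u))).
  rewrite expRM_natl; apply: lerXn2r; rewrite ?nnegrE ?expR_ge0//; first lra.
  exact: expR_ge1Dx.
rewrite -[X in expR X]opprK expRN -[leRHS]invrK lef_pV2 ?posrE ?expR_gt0 ?invr_gt0//.
by apply: le_trans (expR_ge1Dx _); lra.
Qed.

Lemma ln2_bounds : 1 / 2 <= ln (2 : R) <= 1.
Proof.
have := @le_ln1Dx R 1; have := @le_ln1Dx R (- (1 / 2)).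
have -> : 1 - 1 / 2 = (2 : R)^-1 by lra.
rewrite lnV ?posrE//; have -> : 1 + 1 = 2 :> R by lra.
by move=> h1 h2; have := h1 ltac:(lra); have := h2 ltac:(lra); lra.
Qed.

Lemma trunc_log_le_ln n : (0 < n)%N -> (trunc_log 2 n)%:R <= 2 * ln (n%:R : R).
Proof.
move=> n0; set t := trunc_log 2 n.
have tn : (2 : R) ^+ t <= n%:R by rewrite -natrX ler_nat trunc_logP.
have := tn; rewrite -ler_ln ?posrE ?exprn_gt0 ?ltr0n// lnXn// -[X in X <= ln _]mulr_natl.
have t0 : 0 <= t%:R :> R by []; have /andP[l2 _] := ln2_bounds.
by have := ler_wpM2l t0 l2; lra.
Qed.

Lemma double_trunc_log n : (4 <= n)%N -> (2 * trunc_log 2 n <= n)%N.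
Proof.
move=> n4; have h := trunc_logP (ltnSn 1) (leq_trans (ltn0Sn 3) n4).
apply: leq_trans h; have : (2 <= trunc_log 2 n)%N by apply: trunc_log_max.
elim: (trunc_log 2 n) => // -[|[|[|k]]] ih // _; have := ih isT; rewrite [(2 ^ _.+4)%N]expnS; lia.
Qed.

(** With this [l], the quantity [A] = n 2^-l lies between 2^m and 2^(m+1). The lower bound makes the
    no-run term small; the upper bound limits the number of windows. The condition on
    [t%:R * (2 * dlt)] keeps (1/2 + dlt)^(l-1) within a factor 2 of its fair value. *)
Lemma powerless_terms n m (dlt bad : R) (t := trunc_log 2 n) (l := (t - m)%N) :
  (0 < n)%N -> (m < t)%N -> (2 * t <= n)%N -> 0 <= dlt -> 0 <= bad -> t%:R * (2 * dlt) <= 1 / 2 ->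
  n%:R * bad + (1 - (1 / 2) ^+ l.+1) ^+ (n - l)
    + l%:R * (1 / 2) ^+ l.-1 * (n%:R * (dlt + bad))
    + n%:R * l%:R * (dlt * (1 / 2 + dlt) ^+ l.-1)
  <= n%:R * bad + 4 / 2 ^+ m + 2 ^+ m * (12 * (t%:R * dlt) + 4 * (n%:R * bad)).
Proof.
move=> n0 mt tn d0 b0 td.
have l0 : (0 < l)%N by rewrite subn_gt0.
have w0 : 0 < 2 ^+ m :> R by exact: exprn_gt0.
have h0 k : 0 <= (1 / 2 : R) ^+ k by apply: exprn_ge0; lra.
have wE : (2 : R) ^+ t * (1 / 2) ^+ l = 2 ^+ m.
  rewrite -(subnK (ltnW mt)) -/l exprD mulrAC -exprMn (_ : 2 * (1 / 2) = 1 :> R); last lra.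
  by rewrite expr1n mul1r.
set A := n%:R * (1 / 2 : R) ^+ l.
have A_ge : 2 ^+ m <= A.
  by rewrite -wE; apply: ler_wpM2r => //; rewrite -natrX ler_nat trunc_logP.
have A_le : A <= 2 * 2 ^+ m.
  rewrite -wE mulrA -exprS; apply: ler_wpM2r => //.
  by rewrite -natrX ler_nat ltnW// trunc_log_ltn.
have lt : l%:R <= t%:R :> R by rewrite ler_nat leq_subr.
have tn' : t%:R <= n%:R :> R by rewrite ler_nat; lia.
have lh : (1 / 2 : R) ^+ l.-1 = 2 * (1 / 2) ^+ l by rewrite -{2}(prednK l0) exprS; lra.
have T2 : (1 - (1 / 2 : R) ^+ l.+1) ^+ (n - l) <= 4 / 2 ^+ m.
  have y01 : 0 <= (1 / 2 : R) ^+ l.+1 <= 1 by rewrite h0 exprn_ile1//; lra.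
  apply: le_trans (exprB1_le _ y01) _.
  have nl : n%:R / 2 <= (n - l)%:R :> R.
    by rewrite natrB; [|lia]; have : 2 * t%:R <= n%:R :> R by [rewrite -natrM ler_nat]; lra.
  have z4 : 2 ^+ m / 4 <= (n - l)%:R * (1 / 2 : R) ^+ l.+1.
    have := ler_wpM2r (h0 l) nl; rewrite exprS -/A; move: A_ge; rewrite /A.
    by move: (2 ^+ m) ((1 / 2) ^+ l) => w z; lra.
  move: z4; set Z := (n - l)%:R * _ => z4.
  have w4 : 0 < 2 ^+ m / 4 :> R by rewrite divr_gt0.
  have Z0 : 0 <= Z by exact: le_trans (ltW w4) z4.
  apply: le_trans (expRN_le Z0) _.
  rewrite (_ : 4 / 2 ^+ m = (2 ^+ m / 4)^-1); last by rewrite invf_div.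
  have Z1 : 0 < 1 + Z by move: Z0; clearbody Z; lra.
  by rewrite lef_pV2// (le_trans z4)// lerDr.
have T3 : l%:R * (1 / 2) ^+ l.-1 * (n%:R * (dlt + bad)) <= 4 * 2 ^+ m * (t%:R * dlt + n%:R * bad).
  have -> : l%:R * (1 / 2) ^+ l.-1 * (n%:R * (dlt + bad)) = 2 * A * (l%:R * dlt + l%:R * bad).
    by rewrite lh /A; ring.
  apply: ler_pM => //; try lra.
    by rewrite addr_ge0// mulr_ge0.
  by apply: lerD; apply: ler_wpM2r => //; exact: le_trans tn'.
have T4 : n%:R * l%:R * (dlt * (1 / 2 + dlt) ^+ l.-1) <= 8 * 2 ^+ m * (t%:R * dlt).
  have pw : (1 / 2 + dlt) ^+ l.-1 <= 2 * (2 * (1 / 2) ^+ l).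
    have -> : 1 / 2 + dlt = (1 / 2) * (1 + 2 * dlt) by lra.
    rewrite exprMn lh mulrC; apply: ler_wpM2r; first by have := h0 l; lra.
    apply: exprD1_le2; first lra.
    apply: le_trans td; apply: ler_wpM2r; first lra.
    by rewrite ler_nat; rewrite /l; lia.
  have -> : n%:R * l%:R * (dlt * (1 / 2 + dlt) ^+ l.-1) = (l%:R * dlt) * (n%:R * (1 / 2 + dlt) ^+ l.-1) by ring.
  rewrite [leRHS]mulrC; apply: ler_pM.
  - by rewrite mulr_ge0.
  - by rewrite mulr_ge0//; apply: exprn_ge0; lra.
  - exact: ler_wpM2r.
  - apply: (@le_trans _ _ (n%:R * (2 * (2 * (1 / 2) ^+ l)))); first exact: ler_wpM2l.
    by move: A_le; rewrite /A; lra.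
move: T2 T3 T4; move: (2 ^+ m) w0 => w w0 T2 T3 T4; lra.
Qed.

Lemma near_ln (U : R) : \forall n \near \oo, U <= ln (n%:R : R).
Proof.
near=> n; rewrite -[U]expRK; have : expR U <= n%:R by near: n; exact: nbhs_infty_ger.
by move=> h; rewrite ler_ln// posrE ?(lt_le_trans _ h) ?expR_gt0.
Unshelve. all: by end_near. Qed.

Lemma trunc_log_cvg (m : nat) : \forall n \near \oo, (m < trunc_log 2 n)%N.
Proof.
near=> n; apply: trunc_log_max => //; near: n; exact: nbhs_infty_ge.
Unshelve. all: by end_near. Qed.

Lemma powR_natE n b : (0 < n)%N -> n%:R `^ b = expR (b * ln (n%:R : R)).
Proof. by move=> n0; rewrite /powR pnatr_eq0 eqn0Ngt n0. Qed.

End real_bounds.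

(** * Total variation of an integer statistic and elementary rates *)

Section total_variation_bounds.
Context (R : realType) (dT : measure_display) (T : measurableType dT)
  (P Q : probability T R) (S : T -> nat).
Hypothesis mS : forall A : set nat, measurable (S @^-1` A).
Local Open Scope ereal_scope.

Lemma total_variation_le (e : R) :
  (forall A : set nat, (`|fine (P (S @^-1` A)) - fine (Q (S @^-1` A))| <= e)%R) ->
  total_variation (pushforward P S) (pushforward Q S) <= (2 * e)%:E.
Proof.
move=> h; rewrite /total_variation EFinM; apply: lee_wpmul2l; first by rewrite lee_fin.
apply: ge_ereal_sup => _ [A _ <-]; rewrite /pushforward.
rewrite -[P _]fineK ?fin_num_measure// -[Q _]fineK ?fin_num_measure//.
by rewrite -EFinB abse_EFin lee_fin.
Qed.

Lemma total_variation_ge (A : set nat) :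
  (2 * (fine (Q (S @^-1` A)) - fine (P (S @^-1` A))))%:E
    <= total_variation (pushforward P S) (pushforward Q S).
Proof.
rewrite /total_variation EFinM; apply: lee_wpmul2l; first by rewrite lee_fin.
apply: le_trans (_ : `|P (S @^-1` A) - Q (S @^-1` A)| <= _); last first.
  by apply: ereal_sup_ubound; exists A.
rewrite -[P _]fineK ?fin_num_measure// -[Q _]fineK ?fin_num_measure//.
by rewrite -EFinB abse_EFin lee_fin distrC ler_norm.
Qed.

Lemma total_variation_bounds :
  0 <= total_variation (pushforward P S) (pushforward Q S) <= 2%:E.
Proof.
apply/andP; split.
  apply: le_trans (total_variation_ge set0).
  by rewrite preimage_set0 !measure0 subrr mulr0.
rewrite -[leRHS]mule1 -[X in _ * X]/(1%:E) -EFinM; apply: total_variation_le => A.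
have p01 (P' : probability T R) : (0 <= fine (P' (S @^-1` A)) <= 1)%R.
  by rewrite fine_ge0//= -lee_fin fineK ?fin_num_measure// probability_le1.
by have := p01 P; have := p01 Q; rewrite ler_norml; lra.
Qed.

End total_variation_bounds.

Lemma near_expRN (R : realType) (u e : R) : 0 < u -> 0 < e ->
  \forall n \near \oo, expR (- (u * ln n%:R)) <= e.
Proof.
move=> u0 e0; near=> n; rewrite -[leRHS]lnK ?posrE// ler_expR lerNl mulrC -ler_pdivrMr//.
by near: n; exact: near_ln.
Unshelve. all: by end_near. Qed.

Lemma expR_ln_nat (R : realType) n : (0 < n)%N -> expR (ln (n%:R : R)) = n%:R.
Proof. by move=> n0; rewrite lnK// posrE ltr0n. Qed.

Lemma exprV_expR (R : realType) (y : R) n : 0 < y -> y^-1 ^+ n = expR (- (n%:R * ln y)).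
Proof. by move=> y0; rewrite expRN expRM_natl lnK ?posrE// exprVn. Qed.

Lemma half_bounds (R : realType) (eps v : R) : 0 <= eps <= 1 / 2 -> 0 <= v <= 1 ->
  v / 4 <= (1 - eps) * v / 2 /\ 0 <= (1 - eps) * v / 2 <= 1.
Proof.
move=> /andP[e0 e2] /andP[v0 v1].
have h1 : 0 <= eps * v by exact: mulr_ge0.
have h2 : eps * v <= 1 / 2 * v by exact: ler_wpM2r.
by split; lra.
Qed.

Lemma pow2_expB (R : realType) (W y : R) n N0 : 0 <= y <= 1 -> 2 * W <= n%:R * y -> N0%:R <= W ->
  2 ^+ N0 * (1 - y) ^+ n <= expR (- W).
Proof.
move=> y01 Wy NW.
have two : 2 ^+ N0 <= expR W.
  apply: (@le_trans _ _ (expR (N0%:R * 1))); last by rewrite mulr1 ler_expR.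
  rewrite expRM_natl; apply: lerXn2r; rewrite ?nnegrE ?expR_ge0//.
  exact: expR_ge1Dx.
apply: (@le_trans _ _ (expR W * expR (- (n%:R * y)))).
  by apply: ler_pM (exprB1_le n y01) => //; apply: exprn_ge0; lra.
by rewrite -expRD ler_expR; lra.
Qed.

Lemma block_count (R : realType) (M W P : R) N0 l : (0 < l)%N -> 0 < W -> 0 <= P <= 1 ->
  M <= N0%:R -> l%:R <= W -> M / W * P - 1 <= (N0 %/ l)%:R * P.
Proof.
move=> l0 W0 /andP[P0 P1] MN lW.
have h : M / W <= (N0 %/ l)%:R + 1.
  rewrite ler_pdivrMr//; apply: le_trans MN _.
  apply: (@le_trans _ _ (((N0 %/ l)%:R + 1) * l%:R)).
    by rewrite natr1 -natrM ler_nat ltnW// ltn_ceil.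
  by apply: ler_wpM2l => //; rewrite addr_ge0.
have := ler_wpM2r P0 h; lra.
Qed.

(** Used with [u] = ln n, [B] = n^(1 - b) and [P] the probability of a run in one block. The
    expected number of successful blocks, of order n^(2 z) / u, is at least a constant times [u]
    because exp (z u) >= z u. The constant is 96 = 16 * 3 * 2. *)
Lemma rate_growth (R : realType) (kappa z g u B w P : R) : 0 < kappa -> 0 < g -> 0 < u ->
  B * w = expR (2 * (z * u)) -> 0 < B -> 1 / 2 * w <= P -> 0 <= z ->
  kappa * z ^+ 2 / (96 * g) * u <= kappa * B / 16 / (3 * g * u) * P.
Proof.
move=> k0 g0 u0 Bw B0 wP z0.
have c0 : 0 <= kappa * B / 16 / (3 * g * u) by rewrite !divr_ge0 ?mulr_ge0 ?ltW.
apply: le_trans (ler_wpM2l c0 wP).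
have -> : kappa * B / 16 / (3 * g * u) * (1 / 2 * w) = kappa / (96 * g) / u * (B * w).
  by field; rewrite !lt0r_neq0.
have -> : kappa * z ^+ 2 / (96 * g) * u = kappa / (96 * g) / u * (z * u) ^+ 2.
  by field; rewrite !lt0r_neq0.
apply: ler_wpM2l; first by rewrite !divr_ge0 ?mulr_ge0 ?ltW.
rewrite Bw expRM_natl; apply: lerXn2r; rewrite ?nnegrE ?expR_ge0 ?mulr_ge0 ?(ltW u0)//.
by apply: le_trans (expR_ge1Dx _); lra.
Qed.

(** * Rate in the window case *)

Section window_rate.
Variables (R : realType) (a b kappa : R).
Hypotheses (a01 : 0 < a < 1) (b0 : 0 <= b) (ab : ln (2 - a) / ln 2 < 1 - b).
Hypotheses (kappa01 : 0 < kappa <= 1).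

(** Exponent in base 2 of 2 - a: a block of length [gam] log2 n is all pluses with probability about
    n^(- gam rho). *)
Let rho : R := ln (2 - a) / ln 2.
(* Since [rho < 1 - b], [1 < gam] and [gam * rho < 1 - b]. *)
Let gam : R := (1 + (1 - b) / rho) / 2.

Definition window_length (n : nat) : nat := (Num.truncn (gam * ln n%:R / ln 2)).+1.

Let ln2_gt0 : 0 < ln 2 :> R. Proof. by have := ln2_bounds R; lra. Qed.

Let lna_gt0 : 0 < ln (2 - a). Proof. by apply: ln_gt0; have /andP[] := a01; lra. Qed.

Let rho_gt0 : 0 < rho. Proof. exact: divr_gt0. Qed.

Let gam_gt1 : 1 < gam.
Proof. have : 1 < (1 - b) / rho by rewrite ltr_pdivlMr ?mul1r.
by rewrite /gam; lra. Qed.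

Let gam_rho : gam * rho = (rho + (1 - b)) / 2.
Proof. by rewrite /gam; field; exact: lt0r_neq0. Qed.

Let lna_rho : ln (2 - a) = rho * ln 2.
Proof. by rewrite /rho divfK// lt0r_neq0. Qed.

Let lnn_ge0 n : (0 < n)%N -> 0 <= ln (n%:R : R).
Proof. by move=> n0; rewrite ln_ge0// ler1n. Qed.

Let window_length_bounds n : (0 < n)%N ->
  gam * ln n%:R <= (window_length n)%:R * ln 2 <= gam * ln n%:R + ln 2.
Proof.
move=> n0; set v := gam * ln n%:R; have v0 : 0 <= v / ln 2.
  apply: divr_ge0; last exact: ltW.
  by apply: mulr_ge0; [exact: le_trans ler01 (ltW gam_gt1)|exact: lnn_ge0].
apply/andP; split; first by rewrite -ler_pdivrMr// ltW// truncnS_gt.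
have h : (Num.truncn (v / ln 2))%:R <= v / ln 2 by rewrite truncn_le.
rewrite /window_length -/v -natr1 mulrDl mul1r lerD2r.
by move: h; rewrite ler_pdivlMr.
Qed.

(** The left side is at most n^(1 - gam), and [gam] exceeds 1. *)
Lemma window_length_null (e : R) : 0 < e ->
  \forall n \near \oo, n%:R * (1 / 2 : R) ^+ window_length n <= e.
Proof.
move=> e0; near=> n.
have n0 : (0 < n)%N by near: n; exact: nbhs_infty_gt.
apply: (@le_trans _ _ (expR (- ((gam - 1) * ln n%:R)))); last first.
  by near: n; apply: near_expRN => //; rewrite subr_gt0.
rewrite div1r exprV_expR// -[X in X * _]expR_ln_nat// -expRD ler_expR.
by have /andP[h _] := window_length_bounds n0; lra.
Unshelve. all: by end_near. Qed.

(** The threshold on n must not depend on [eps], which itself varies with n; hence the quantifier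
    inside the filter. *)
Lemma window_rate (e : R) : 0 < e ->
  \forall n \near \oo, forall eps, 0 <= eps <= 1 / 2 ->
    exists N0 q, (q * window_length n <= N0)%N /\
      2 ^+ N0 * (1 - (1 - eps) * (kappa * expR (- (b * ln n%:R))) / 2) ^+ n
        + (1 - (2 - a)^-1 ^+ window_length n) ^+ q <= e.
Proof.
move=> e0; have /andP[k0 k1] := kappa01.
have bet0 : 0 < 1 - b by apply: lt_trans ab; exact: rho_gt0.
(* Since [gam * rho] is the midpoint of [rho] and 1 - b, the exponent 1 - b - gam rho of the
   expected number of successes is [2 * z]. *)
pose z := (1 - b - rho) / 4.
have z0 : 0 < z by rewrite divr_gt0// subr_gt0.
pose k2 := kappa * z ^+ 2 / (96 * gam).
have g0 : 0 < gam by exact: lt_trans gam_gt1.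
have k20 : 0 < k2 by apply: divr_gt0; apply: mulr_gt0 => //; exact: exprn_gt0.
have c1 : 0 < kappa * e / 16 by rewrite divr_gt0 ?mulr_gt0.
(* The factor [expR 1] absorbs the incomplete block lost when [N0] is divided by [l]. *)
have c2 : 0 < e / (2 * expR 1) by rewrite divr_gt0 ?mulr_gt0 ?expR_gt0.
have c3 : 0 < kappa / 16 by rewrite divr_gt0.
near=> n; move=> eps /andP[eps0 eps2].
have n0 : (0 < n)%N by near: n; exact: nbhs_infty_gt.
have u1 : 1 <= ln (n%:R : R) by near: n; exact: near_ln.
have B1 : expR (- ((1 - b) * ln n%:R)) <= kappa * e / 16 by near: n; exact: near_expRN.
have B2 : expR (- ((1 - b) * ln n%:R)) <= kappa / 16 by near: n; exact: near_expRN.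
have E2 : expR (- (k2 * ln n%:R)) <= e / (2 * expR 1) by near: n; exact: near_expRN.
set u := ln (n%:R : R) in u1 B1 B2 E2 *.
set B := expR ((1 - b) * u); have B0 : 0 < B by exact: expR_gt0.
rewrite !expRN -/B in B1 B2.
have /andP[wl1 wl2] := window_length_bounds n0.
set l := window_length n in wl1 wl2 *.
have l0 : 0 < l%:R :> R by rewrite ltr0n.
have l3 : l%:R <= 3 * gam * u.
  have /andP[l2 _] := ln2_bounds R.
  have gu : 1 <= gam * u by rewrite -[1]mulr1 ler_pM// ltW.
  have : (l%:R - 1) * ln 2 <= gam * u by rewrite mulrBl mul1r lerBlDr.
  have := ler_wpM2l (_ : 0 <= l%:R - 1) l2; rewrite subr_ge0 ler1n => /(_ isT).
  by rewrite -[3 * gam * u]mulrA; move: gu; move: (gam * u) => v; lra.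
have kB0 : 0 <= kappa * B / 8 by rewrite divr_ge0// mulr_ge0// ltW.
(* The exponent in [pow2_expB] is at least [kappa * B / 4]; half of it pays for 2^N0, and this
   leaves an eighth. *)
pose N0 := Num.truncn (kappa * B / 8).
have N0le : N0%:R <= kappa * B / 8 by rewrite truncn_le.
have N0gt : kappa * B / 8 < N0%:R + 1 by rewrite natr1 truncnS_gt.
exists N0, (N0 %/ l)%N; split; first exact: leq_divM.
have kB16 : kappa * B / 16 <= N0%:R.
  have h : 1 <= kappa * B / 16 by move: B2; rewrite -[_^-1]mul1r ler_pdivrMr// mulrAC.
  by move: N0gt; move: h; move: (kappa * B) => v; lra.
clearbody N0; clear N0gt B2; rewrite (splitr e); apply: lerD.
- have bu : expR (- (b * u)) <= 1 by rewrite -expR0 ler_expR oppr_le0 mulr_ge0// (le_trans ler01).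
  have ke : 0 <= kappa * expR (- (b * u)) <= 1.
    by rewrite mulr_ge0 ?mulr_ile1 ?expR_ge0 ?(ltW k0).
  have eps02 : 0 <= eps <= 1 / 2 by rewrite eps0.
  have [y2 y01] := half_bounds eps02 ke.
  have ny : 2 * (kappa * B / 8) <= n%:R * ((1 - eps) * (kappa * expR (- (b * u))) / 2).
    apply: le_trans (ler_wpM2l _ y2) => //.
    rewrite /B mulrBl mul1r expRD -/u expR_ln_nat//.
    by move: (expR _) (n%:R) => v w; rewrite le_eqVlt; apply/orP; left; apply/eqP; field.
  apply: le_trans (pow2_expB y01 ny N0le) _.
  apply: le_trans (expRN_le kB0) _.
  apply: (@le_trans _ _ ((kappa * B / 8)^-1)).
    by rewrite lef_pV2 ?posrE ?lerDr// ?ltr_pwDl// divr_gt0// mulr_gt0.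
  rewrite invf_div invfM mulrA; have := B1.
  have c8 : 0 < 8 / kappa by exact: divr_gt0.
  rewrite -(ler_pM2l c8) => /le_trans; apply.
  by rewrite le_eqVlt; apply/orP; left; apply/eqP; field; exact: lt0r_neq0.
- have [a0 a1] := andP a01.
  set p := (2 - a)^-1.
  have a2 : 0 < 2 - a by rewrite subr_gt0 (lt_trans a1)// ltr1n.
  have p1 : 1 / 2 <= p by rewrite /p div1r lef_pV2 ?posrE// gerBl ltW.
  have ple1 : p <= 1 by rewrite /p invf_le1// lerBrDr -lerBrDl (le_trans (ltW a1))// lerBrDr.
  have p0 : 0 <= p by rewrite /p invr_ge0 ltW.
  have pl01 : 0 <= p ^+ l <= 1 by rewrite exprn_ge0 ?exprn_ile1.
  apply: le_trans (exprB1_le _ pl01) _.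
  have pl : 1 / 2 * expR (- (gam * rho * u)) <= p ^+ l.
    rewrite exprV_expR//; apply: le_trans (ler_wpM2r (expR_ge0 _) p1) _.
    rewrite /p -[X in X^-1](@lnK R) ?posrE// -expRN -expRD ler_expR lna_rho.
    rewrite -opprD lerN2 mulrCA; apply: le_trans (ler_wpM2l (ltW rho_gt0) wl2) _.
    by rewrite -/u mulrDr addrC mulrA [rho * gam]mulrC.
  have Bw : B * expR (- (gam * rho * u)) = expR (2 * (z * u)).
    by rewrite /B -expRD; congr expR; rewrite gam_rho /z; field.
  have u0 : 0 < u by exact: lt_le_trans u1.
  have gu0 : 0 < 3 * gam * u by apply: mulr_gt0 => //; exact: mulr_gt0.
  have key := block_count (ltn0Sn _) gu0 pl01 kB16 l3.
  have key2 := rate_growth k0 g0 u0 Bw B0 pl (ltW z0).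
  apply: (@le_trans _ _ (expR (1 + - (k2 * u)))).
    by rewrite ler_expR -(opprB (k2 * u) 1) lerN2; apply: le_trans key; rewrite lerD2r.
  rewrite expRD; apply: le_trans (ler_wpM2l (expR_ge0 1) E2) _.
  rewrite le_eqVlt; apply/orP; left; apply/eqP.
  by field; rewrite lt0r_neq0 ?expR_gt0.
Unshelve. all: by end_near. Qed.

End window_rate.

(** An interval of positive length carries mass because [g] is positive. This makes the denominator
    in [dominates] nonzero. *)
Lemma cdf_lt1 (R : realType) (G : cumulativeBounded (0 : R) (1 : R)) (g : R -> R) (z : R) :
  is_density G g -> (forall x, 0 < g x) -> G z < 1.
Proof.
move=> dG gpos; have [_ int1] := integrable_density dG; have [mg g0 gG] := dG.
rewrite ltNge; apply/negP => G1.
have mE (D : set R) : measurable_fun D (fun x => (g x)%:E).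
  by apply: measurable_funTS; exact/measurable_EFinP.
pose D : set R := `]z, (z + 1)]%classic.
have mD : measurable D by exact: measurable_itv.
have le1 : (\int[lebesgue_measure]_(x in `]-oo, z]) (g x)%:E + \int[lebesgue_measure]_(x in D) (g x)%:E <= 1)%E.
  rewrite -ge0_integral_setU//.
  - rewrite -int1; apply: ge0_subset_integral => //; first exact: measurableU.
      exact: mE.
    by move=> x _; rewrite lee_fin.
  - exact: mE.
  - by move=> x _; rewrite lee_fin.
  - by apply/disj_setPS => x /= []; rewrite /D/= !in_itv/= => h1 /andP[h2 _]; move: h2; rewrite ltNge h1.
have iD0 : (\int[lebesgue_measure]_(x in D) `|(g x)%:E| = 0)%E.
  under eq_integral do rewrite gee0_abs ?lee_fin//.
  have : (0 <= \int[lebesgue_measure]_(x in D) (g x)%:E)%E by apply: integral_ge0 => x _; rewrite lee_fin.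
  move: le1; rewrite -gG; case: (integral _ _ _) => [r| |] //.
  by rewrite -EFinD !lee_fin => h1 h2; congr (_%:E); lra.
have [N [mN N0 DN]] := (ae_eq_integral_abs lebesgue_measure mD (mE D)).1 iD0.
have : (lebesgue_measure D <= lebesgue_measure N)%E.
  apply: le_measure; rewrite ?inE// => x Dx; apply: DN => /= /(_ Dx) /eqP.
  by rewrite eqe gt_eqF.
rewrite N0 /D lebesgue_measure_itv/= lte_fin ltrDl ltr01 -EFinB lee_fin.
by lra.
Qed.

Lemma cdf_homo (R : realType) (G : cumulativeBounded (0 : R) (1 : R)) :
  {homo G : x y / x <= y}.
Proof. exact: cumulative_is_nondecreasing. Qed.

Lemma cdf_01 (R : realType) (G : cumulativeBounded (0 : R) (1 : R)) (g : R -> R) (z : R) :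
  is_density G g -> 0 <= G z <= 1.
Proof.
move=> dG; have [_ int1] := integrable_density dG; have [mg g0 gG] := dG.
rewrite -!lee_fin gG integral_ge0/=; last by move=> x _; rewrite lee_fin.
rewrite -int1; apply: ge0_subset_integral => //; first exact/measurable_EFinP.
by move=> x _; rewrite lee_fin.
Qed.

Lemma symmetric_cdf0 (R : realType) (F : R -> R) :
  (forall x, F (- x) = 1 - F x) -> F 0 = 1 / 2.
Proof. by move=> /(_ 0); rewrite oppr0; lra. Qed.

(** The zero median and the sign of [mu] enter here: on average the contamination favours pluses. *)
Lemma contaminated_cdf0_le (R : realType) (F G : cumulativeBounded (0 : R) (1 : R)) (eps mu : R) :
  (forall x : R, F (- x) = 1 - F x) -> G 0 = 1 / 2 -> 0 <= eps -> 0 <= mu ->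
  contaminated_cdf F G eps mu 0 <= 1 / 2.
Proof.
move=> /symmetric_cdf0 F0 G0 eps0 mu0; rewrite /contaminated_cdf sub0r F0.
have Gm : G (- mu) <= 1 / 2 by rewrite -G0; apply: cdf_homo; rewrite oppr_le0.
have := ler_wpM2l eps0 Gm; lra.
Qed.

(** By symmetry the tail of [F] counts twice; with the two tails of [G] this makes four quarters of
    [k]. *)
Lemma contaminated_tails (R : realType) (F G : cumulativeBounded (0 : R) (1 : R))
    (f g : R -> R) (eps mu x k : R) (n : nat) (H := contaminated_cdf F G eps mu) :
  (forall x : R, F (- x) = 1 - F x) -> is_density F f -> is_density G g -> 0 <= eps <= 1 ->
  n%:R * (1 - F x) <= k / 4 -> n%:R * eps * G (- x - mu) <= k / 4 ->
  n%:R * eps * (1 - G (x - mu)) <= k / 4 ->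
  0 <= 1 - H x + H (- x) /\ n%:R * (1 - H x + H (- x)) <= k.
Proof.
move=> F_sym dF dG /andP[e0 e1] h1 h2 h3.
have /andP[_ F1] := cdf_01 x dF.
have /andP[_ Gx1] := cdf_01 (x - mu) dG; have /andP[Gx2 _] := cdf_01 (- x - mu) dG.
rewrite /H /contaminated_cdf F_sym.
have n0 : 0 <= n%:R :> R by [].
have nF0 : 0 <= n%:R * (1 - F x) by rewrite mulr_ge0// subr_ge0.
have z1 : 0 <= (1 - eps) * (1 - F x) by rewrite mulr_ge0// subr_ge0.
have z2 : 0 <= eps * (1 - G (x - mu)) by rewrite mulr_ge0// subr_ge0.
have z3 : 0 <= eps * G (- x - mu) by rewrite mulr_ge0.
have z4 : 0 <= eps * (n%:R * (1 - F x)) by exact: mulr_ge0.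
clear dF dG F_sym.
move: (F x) (G (x - mu)) (G (- x - mu)) h1 h2 h3 F1 Gx1 Gx2 nF0 z1 z2 z3 z4.
by move=> u v w *; split; nra.
Qed.

(** A mean number [W] >= 6 ln n of outliers gives at most n^-3 for the power of the complement,
    which beats 2^(2t) <= 4 n^2. *)
Lemma outliers_rate (R : realType) (F G : cumulativeBounded (0 : R) (1 : R))
    (f g : R -> R) (eps mu x e : R) (n t : nat) (H := contaminated_cdf F G eps mu)
    (W := n%:R * eps * (1 - G (x - mu))) :
  (forall x : R, F (- x) = 1 - F x) -> is_density F f -> is_density G g -> 0 < eps <= 1 ->
  (0 < n)%N -> 2 ^+ t <= 2 * n%:R :> R -> 0 < W ->
  n%:R * (1 - F x) <= e / 8 -> n%:R * eps * G (- x - mu) <= e / 8 ->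
  ln n%:R / W <= 6^-1 -> n%:R^-1 <= e / 8 ->
  2 ^+ (t * 2) * (1 - (1 - H x) / 2) ^+ n + n%:R * H (- x) <= e.
Proof.
move=> F_sym dF dG /andP[e0 e1] n0 tn W0 h1 h2 h3 h4.
have /andP[F0 F1] := cdf_01 x dF; have /andP[G0 G1] := cdf_01 (x - mu) dG.
have N0 : 0 < n%:R :> R by rewrite ltr0n.
have nF0 : 0 <= n%:R * (1 - F x) by rewrite mulr_ge0// subr_ge0.
have enF0 : 0 <= eps * (n%:R * (1 - F x)) by rewrite mulr_ge0// ltW.
have enF1 : 0 <= (1 - eps) * (n%:R * (1 - F x)) by rewrite mulr_ge0// subr_ge0.
have z1 : 0 <= (1 - eps) * (1 - F x) by rewrite mulr_ge0// subr_ge0.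
have z2 : 0 <= (1 - eps) * F x by rewrite mulr_ge0// subr_ge0.
have z3 : 0 <= eps * G (x - mu) by rewrite mulr_ge0// ltW.
have z4 : 0 <= eps * (1 - G (x - mu)) by rewrite mulr_ge0 ?subr_ge0// ltW.
have y01 : 0 <= (1 - H x) / 2 <= 1.
  rewrite /H /contaminated_cdf; clear -z1 z2 z3 z4.
  by move: (F x) (G _) z1 z2 z3 z4 => u v; lra.
have ny : 3 * ln n%:R <= n%:R * ((1 - H x) / 2).
  move: h3; rewrite ler_pdivrMr// => h3.
  have -> : n%:R * ((1 - H x) / 2) = ((1 - eps) * (n%:R * (1 - F x)) + W) / 2.
    by rewrite /W /H /contaminated_cdf; field.
  by move: h3 enF1; clear; move: (ln _) W (_ * (n%:R * _)) => u v w; lra.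
have tail : n%:R * H (- x) <= e / 4.
  have -> : n%:R * H (- x) = n%:R * (1 - F x) - eps * (n%:R * (1 - F x)) + n%:R * eps * G (- x - mu).
    by rewrite /H /contaminated_cdf F_sym; ring.
  by move: h1 h2 enF0; clear; move: (n%:R * (1 - F x)) (n%:R * eps * G _) => v w; lra.
have main : 2 ^+ (t * 2) * (1 - (1 - H x) / 2) ^+ n <= 4 * n%:R^-1.
  have -> : 4 * n%:R^-1 = (2 * n%:R) ^+ 2 * n%:R^-1 ^+ 3 :> R by field; exact: lt0r_neq0.
  apply: ler_pM.
  - exact: exprn_ge0.
  - by apply: exprn_ge0; move: y01; clear; lra.
  - by rewrite exprM; apply: lerXn2r; rewrite ?nnegrE ?exprn_ge0 ?mulr_ge0.
  - by apply: le_trans (exprB1_le n y01) _; rewrite exprV_expR// ler_expR lerN2.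
apply: le_trans (lerD main tail) _.
have n0i : 0 < n%:R^-1 :> R by rewrite invr_gt0.
by clear -h4 n0i; move: (n%:R^-1) h4 n0i => u; lra.
Qed.

(** * The three asymptotic statements *)

Section testing.
Context (R : realType) (F G : cumulativeBounded (0 : R) (1 : R)) (f g : R -> R).
Hypothesis F_continuous : continuous F.
Hypothesis G_continuous : continuous G.
Hypothesis F_symmetric : forall x : R, F (- x) = 1 - F x.
Hypothesis G_median : G 0 = 1 / 2.
Hypothesis F_density : is_density F f.
Hypothesis G_density : is_density G g.
Hypothesis f_pos : forall x : R, 0 < f x.
Hypothesis g_pos : forall x : R, 0 < g x.
Variables (eps mu : nat -> R).
Hypothesis eps_bounds : forall n, (0 < n)%N -> 0 < eps n <= 1.
Hypothesis eps_cvg0 : eps n @[n --> \oo] --> (0 : R).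
Hypothesis mu_pos : forall n, (0 < n)%N -> 0 < mu n.
Context (d : nat -> measure_display) (T : forall n, measurableType (d n)).
Context (P0 P1 : forall n, probability (T n) R) (X : forall n, 'I_n -> {mfun T n >-> R}).
Arguments X : clear implicits.
Hypothesis H0 : forall n, (0 < n)%N -> iid_with_cdf (P0 n) (X n) F.
Hypothesis H1 : forall n, (0 < n)%N ->
  iid_with_cdf (P1 n) (X n) (contaminated_cdf F G (eps n) (mu n)).

Local Notation L := (fun n => longest_run_statistic (X n)).
Local Notation prob0 n A := (fine (P0 n (longest_run_statistic (X n) @^-1` A))).
Local Notation prob1 n A := (fine (P1 n (longest_run_statistic (X n) @^-1` A))).

Let mL n (A : set nat) : measurable (longest_run_statistic (X n) @^-1` A).
Proof. exact: measurable_longest_run. Qed.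

Lemma prob0_fair n (A : set nat) : (0 < n)%N -> prob0 n A = fair n (\1_A \o run_length).
Proof.
move=> n0; apply: (@longest_run_fair R F G f g 0 0) => //; first by rewrite lexx ler01.
rewrite (_ : contaminated_cdf F G 0 0 = F); first exact: H0.
by apply/funext => x; rewrite /contaminated_cdf subr0 mul1r mul0r addr0.
Qed.

Lemma powerless_of_prob_gap :
  (forall e : R, 0 < e -> \forall n \near \oo, forall A, `|prob0 n A - prob1 n A| <= e) ->
  asymptotically_powerless P0 P1 L.
Proof.
move=> h; apply/fine_cvgP; split.
  near=> n; have /andP[t0 t2] := total_variation_bounds (P0 n) (P1 n) (@mL n).
  by rewrite fin_numE -ltNye -lteey; rewrite (lt_le_trans _ t0)// (le_lt_trans t2)// ltry.
apply/cvgr0Pnorm_le => e e0.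
have e20 : 0 < e / 2 by lra.
near=> n; have /andP[t0 t2] := total_variation_bounds (P0 n) (P1 n) (@mL n).
rewrite /= ger0_norm ?fine_ge0//.
have gap : forall A, `|prob0 n A - prob1 n A| <= e / 2 by near: n; exact: h.
have := total_variation_le (@mL n) gap; rewrite -lee_fin => le.
rewrite fineK; first by apply: le_trans le _; rewrite lee_fin; lra.
by rewrite fin_numE -ltNye -lteey; rewrite (lt_le_trans _ t0)// (le_lt_trans t2)// ltry.
Unshelve. all: by end_near. Qed.

(** The single event that [L] reaches [l n] separates the hypotheses: [fair_run_le] makes it rare
    under the null, and it is likely under the alternative. *)
Lemma powerful_of_threshold (l : nat -> nat) :
  (forall e : R, 0 < e -> \forall n \near \oo, n%:R * (1 / 2 : R) ^+ l n <= e) ->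
  (\forall n \near \oo, (0 < l n)%N) ->
  (forall e : R, 0 < e -> \forall n \near \oo, prob1 n [set k | (k < l n)%N] <= e) ->
  asymptotically_powerful P0 P1 L.
Proof.
move=> h0 hl h1.
have fin n : total_variation (pushforward (P0 n) (longest_run_statistic (X n)))
    (pushforward (P1 n) (longest_run_statistic (X n))) \is a fin_num.
  have /andP[t0 t2] := total_variation_bounds (P0 n) (P1 n) (@mL n).
  by rewrite fin_numE -ltNye -lteey; rewrite (lt_le_trans _ t0)// (le_lt_trans t2)// ltry.
apply/fine_cvgP; split; first by near=> n; exact: fin.
apply/cvgrPdist_le => e e0; have e40 : 0 < e / 4 by lra.
near=> n.
have n0 : (0 < n)%N by near: n; exact: nbhs_infty_gt.
have /andP[t0 t2] := total_variation_bounds (P0 n) (P1 n) (@mL n).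
have b0 : n%:R * (1 / 2 : R) ^+ l n <= e / 4 by near: n; exact: h0.
have b1 : prob1 n [set k | (k < l n)%N] <= e / 4 by near: n; exact: h1.
have l0 : (0 < l n)%N by near: n.
have := total_variation_ge (P0 n) (P1 n) (@mL n) [set k | (l n <= k)%N].
have c1 : prob1 n [set k | (l n <= k)%N] = 1 - prob1 n [set k | (k < l n)%N].
  have -> : longest_run_statistic (X n) @^-1` [set k | (l n <= k)%N]
     = ~` (longest_run_statistic (X n) @^-1` [set k | (k < l n)%N]).
    by apply/seteqP; split => w /= h; [apply/negP; rewrite -leqNgt|rewrite leqNgt; apply/negP].
  by rewrite probability_setC// fineB ?fin_num_measure.
have c0 : prob0 n [set k | (l n <= k)%N] <= e / 4.
  rewrite prob0_fair//; apply: le_trans b0; apply: le_trans (fair_run_le _ n l0).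
  rewrite le_eqVlt; apply/orP; left; apply/eqP; congr fair; apply/funext => s /=.
  rewrite indicE -leq_run_length; congr (_%:R); congr nat_of_bool.
  by apply/idP/idP => [/set_mem //|h3]; exact/mem_set.
rewrite c1 -[X in (_ <= X)%E -> _]fineK// lee_fin => ge.
have le2 : fine (total_variation (pushforward (P0 n) (longest_run_statistic (X n)))
    (pushforward (P1 n) (longest_run_statistic (X n)))) <= 2 by rewrite -lee_fin fineK.
by rewrite /= ger0_norm ?subr_ge0//; lra.
Unshelve. all: by end_near. Qed.

Let eps_le (e : R) : 0 < e -> \forall n \near \oo, eps n <= e.
Proof. by move=> e0; apply: (cvgr_le (f := eps)) e0. Qed.

Let nat_gt0 : \forall n \near \oo, (0 < n)%N.
Proof. exact: nbhs_infty_gt. Qed.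

(** A negative [x n] would give 1 - F (x n) >= 1/2, hence a product of at least n/2. *)
Let x_ge0 (x : nat -> R) : n%:R * (1 - F (x n)) @[n --> \oo] --> (0 : R) ->
  \forall n \near \oo, 0 <= x n.
Proof.
move=> hx; near=> n; rewrite leNgt; apply/negP => xn.
have n0 : (0 < n)%N by near: n; exact: nat_gt0.
have n1 : 1 <= n%:R :> R by rewrite ler1n.
have F0 := symmetric_cdf0 F_symmetric.
have := cdf_homo F (ltW xn); rewrite F0 => Fx.
have : n%:R * (1 - F (x n)) <= 1 / 4.
  by near: n; apply: (cvgr_le (f := fun n => n%:R * (1 - F (x n)))) hx _ _; lra.
have : n%:R * (1 / 2) <= n%:R * (1 - F (x n)) by apply: ler_wpM2l => //; lra.
lra.
Unshelve. all: by end_near. Qed.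

(** The supremum is taken in the extended reals. It is nonnegative, and its product with the
    positive number eps ln n is finite, so it is a real number. *)
Lemma ratio_sup_bound (n : nat) (x : R) : (1 < n)%N -> 0 <= x ->
  let S := ereal_sup [set (Num.max (g (y - mu n) - g (- y - mu n)) 0
                         / (f y + eps n * g (y - mu n)))%:E | y in `[0, x]] in
  ((eps n * ln n%:R)%:E * S)%E \is a fin_num ->
  exists s, [/\ 0 <= s, fine ((eps n * ln n%:R)%:E * S)%E = eps n * ln n%:R * s &
    forall y, 0 <= y <= x -> g (y - mu n) - g (- y - mu n) <= s * (f y + eps n * g (y - mu n))].
Proof.
move=> n1 x0 S Sfin; have /andP[e0 e1] := eps_bounds (ltnW n1).
have a0 : 0 < eps n * ln n%:R by rewrite mulr_gt0// ln_gt0// ltr1n.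
have D0 y : 0 < f y + eps n * g (y - mu n) by rewrite addr_gt0// mulr_gt0.
pose q y := Num.max (g (y - mu n) - g (- y - mu n)) 0 / (f y + eps n * g (y - mu n)).
have qS y : 0 <= y <= x -> ((q y)%:E <= S)%E.
  by move=> yx; apply: ereal_sup_ubound; exists y => //=; rewrite in_itv.
have q0 y : 0 <= q y by rewrite /q; apply: divr_ge0; [rewrite le_max lexx orbT|exact: ltW].
have := qS 0; rewrite lexx x0 => /(_ isT).
case: (S) Sfin qS => [s| |]; last by rewrite leeNy_eq.
  rewrite lee_fin => _ qs q0s; exists s; split => //.
  - exact: le_trans q0s.
  - move=> y /qs; rewrite lee_fin /q ler_pdivrMr// => h; apply: le_trans h.
    by rewrite le_max lexx.
by rewrite gt0_muley ?lte_fin.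
Qed.

Lemma powerless_part (x : nat -> R) : tails_vanish F G eps mu x ->
  ((eps n * ln n%:R)%:E *
        ereal_sup [set (Num.max (g (y - mu n) - g (- y - mu n)) 0
                         / (f y + eps n * g (y - mu n)))%:E | y in `[0%R, x n]])%E
        @[n --> \oo] --> 0%:E ->
  asymptotically_powerless P0 P1 L.
Proof.
move=> [t1 t2 t3] /fine_cvgP[cfin ccvg]; apply: powerless_of_prob_gap => e e0.
(* Then 8 / e < m <= 2^m, and the no-run term 4 / 2^m is at most e / 2. *)
pose m := (Num.truncn (8 / e)).+1.
have m0 : 0 < 2 ^+ m :> R by exact: exprn_gt0.
have mE : 4 / 2 ^+ m <= e / 2.
  have : 8 / e < m%:R by exact: truncnS_gt.
  have : m%:R <= 2 ^+ m :> R by rewrite -natrX ler_nat ltnW// ltn_expl.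
  move=> h1 h2; have := lt_le_trans h2 h1; rewrite ltr_pdivrMr// => h3.
  by rewrite ler_pdivrMr//; lra.
have c0 : 0 < 4 * (1 + 28 * 2 ^+ m) :> R by lra.
(* The remaining terms are at most k (1 + 16 * 2^m), which this choice keeps below e / 4;
   [k <= 1 / 4] yields the smallness required by [powerless_terms]. *)
pose k := Num.min (1 / 4) (e / (4 * (1 + 28 * 2 ^+ m))).
have k0 : 0 < k by rewrite lt_min [X in _ && X]divr_gt0// andbT; lra.
have kle : k <= 1 / 4 by rewrite ge_min lexx.
have kE : k * (4 * (1 + 28 * 2 ^+ m)) <= e by rewrite -ler_pdivlMr// ge_min lexx orbT.
clearbody k m; have k20 : 0 < k / 4 by lra.
near=> n; move=> A.
have n0 : (0 < n)%N by near: n; exact: nat_gt0.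
have n1 : (1 < n)%N by near: n; exact: nbhs_infty_gt.
have n4 : (4 <= n)%N by near: n; exact: nbhs_infty_ge.
have mt : (m < trunc_log 2 n)%N by near: n; exact: trunc_log_cvg.
have eps2 : eps n <= 1 / 2 by near: n; apply: eps_le; lra.
have xn0 : 0 <= x n by near: n; exact: x_ge0.
have /andP[e_gt0 e_le1] := eps_bounds n0.
have e01 : 0 <= eps n <= 1 by rewrite ltW.
have cfn : ((eps n * ln n%:R)%:E *
        ereal_sup [set (Num.max (g (y - mu n) - g (- y - mu n)) 0
                         / (f y + eps n * g (y - mu n)))%:E | y in `[0%R, x n]])%E \is a fin_num.
  by near: n.
have [s [s0 sE hs]] := ratio_sup_bound n1 xn0 cfn.
have b1 : n%:R * (1 - F (x n)) <= k / 4.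
  by near: n; apply: (cvgr_le (f := fun n => n%:R * (1 - F (x n)))) t1 _ k20.
have b2 : n%:R * eps n * G (- x n - mu n) <= k / 4.
  by near: n; apply: (cvgr_le (f := fun n => n%:R * eps n * G (- x n - mu n))) t2 _ k20.
have b3 : n%:R * eps n * (1 - G (x n - mu n)) <= k / 4.
  by near: n; apply: (cvgr_le (f := fun n => n%:R * eps n * (1 - G (x n - mu n)))) t3 _ k20.
have bs : eps n * ln n%:R * s <= k / 4.
  by rewrite -sE; near: n; apply: cvgr_le ccvg _ k20.
set H := contaminated_cdf F G (eps n) (mu n).
have [bad0 badk] := contaminated_tails F_symmetric F_density G_density e01 b1 b2 b3.
have Hm := contaminated_cdf0_le F_symmetric G_median (ltW e_gt0) (ltW (mu_pos n0)).
have es0 : 0 <= eps n * s by rewrite mulr_ge0// ltW.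
have td : (trunc_log 2 n)%:R * (eps n * s) <= k.
  apply: le_trans (ler_wpM2r es0 (trunc_log_le_ln R n0)) _.
  have -> : 2 * ln n%:R * (eps n * s) = 2 * (eps n * ln n%:R * s) by ring.
  by move: bs; move: (eps n * ln n%:R * s) => v; lra.
clear cfn b1 b2 b3 bs sE; have tdl : (trunc_log 2 n)%:R * (2 * (eps n * s)) <= 1 / 2 by lra.
have lrange : (0 < trunc_log 2 n - m <= n)%N.
  rewrite subn_gt0 mt (leq_trans (leq_subr _ _))//.
  exact: leq_trans (leq_pmull _ (ltn0Sn 1)) (double_trunc_log n4).
have gap := longest_run_gap F_continuous G_continuous F_symmetric F_density G_density e01 n0 (H1 n0)
  A eps2 s0 xn0 Hm lrange hs.
have := powerless_terms n0 mt (double_trunc_log n4) es0 bad0 tdl.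
rewrite distrC prob0_fair// => bound.
apply: le_trans gap _; apply: le_trans bound _.
have q1 := ler_wpM2l (ltW m0) td; have q2 := ler_wpM2l (ltW m0) badk.
move: q1 q2 badk; rewrite -/H.
move: (1 - H _ + H _) (_ * (eps n * s)) => v w.
by move: (mE) (kE) (mulr_gt0 m0 k0); move: (2 ^+ m) => u *; lra.
Unshelve. all: by end_near. Qed.

Lemma outliers_part (x : nat -> R) :
  n%:R * (1 - F (x n)) @[n --> \oo] --> (0 : R) ->
  n%:R * eps n * G (- x n - mu n) @[n --> \oo] --> (0 : R) ->
  dominates (fun n => n%:R * eps n * (1 - G (x n - mu n))) (fun n => ln n%:R) ->
  asymptotically_powerful P0 P1 L.
Proof.
move=> t1 t2 t3.
(* Twice log2 n, rounded up: a fair word has a run of this length with probability at most 1 / n. *)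
pose l n := ((trunc_log 2 n).+1 * 2)%N.
have pow_l n : (0 < n)%N -> n%:R <= (2 : R) ^+ (trunc_log 2 n).+1 <= 2 * n%:R.
  move=> n0; apply/andP; split; first by rewrite -natrX ler_nat ltnW// trunc_log_ltn.
  by rewrite exprS ler_pM2l// -natrX ler_nat trunc_logP.
have near_inv (e : R) : 0 < e -> \forall n \near \oo, n%:R^-1 <= e.
  move=> e0; near=> n; rewrite -[e]invrK lef_pV2 ?posrE ?invr_gt0//.
    by near: n; exact: nbhs_infty_ger.
  by rewrite ltr0n; near: n; exact: nat_gt0.
apply: (@powerful_of_threshold l); last 2 first.
- by near=> n.
- move=> e e0; have e80 : 0 < e / 8 by rewrite divr_gt0.
  near=> n.
  have n0 : (0 < n)%N by near: n; exact: nat_gt0.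
  have n1 : (1 < n)%N by near: n; exact: nbhs_infty_gt.
  have xn0 : 0 <= x n by near: n; exact: x_ge0.
  have b1 : n%:R * (1 - F (x n)) <= e / 8.
    by near: n; apply: (cvgr_le (f := fun n => n%:R * (1 - F (x n)))) t1 _ e80.
  have b2 : n%:R * eps n * G (- x n - mu n) <= e / 8.
    by near: n; apply: (cvgr_le (f := fun n => n%:R * eps n * G (- x n - mu n))) t2 _ e80.
  have b3 : ln n%:R / (n%:R * eps n * (1 - G (x n - mu n))) <= 6^-1.
    by near: n; apply: cvgr_le t3 _ _; rewrite invr_gt0.
  have b4 : n%:R^-1 <= e / 8 by near: n; exact: near_inv.
  have /andP[e_gt0 e_le1] := eps_bounds n0.
  apply: le_trans (longest_run_outliers F_density G_density _ n0 (H1 n0) (l n) xn0) _.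
    by rewrite ltW.
  have W0 : 0 < n%:R * eps n * (1 - G (x n - mu n)).
    by rewrite !mulr_gt0 ?ltr0n// subr_gt0; exact: cdf_lt1 G_density g_pos.
  have /andP[_ w2] := pow_l n n0.
  exact: outliers_rate F_symmetric F_density G_density (eps_bounds n0) n0 w2 W0 b1 b2 b3 b4.
- move=> e e0; near=> n.
  have n0 : (0 < n)%N by near: n; exact: nat_gt0.
  have /andP[nw _] := pow_l n n0.
  have n0' : 0 < n%:R :> R by rewrite ltr0n.
  rewrite /l exprM div1r exprVn.
  apply: (@le_trans _ _ (n%:R * n%:R^-1 ^+ 2)).
    apply: ler_wpM2l => //; apply: lerXn2r; rewrite ?nnegrE ?invr_ge0 ?exprn_ge0//.
    by rewrite lef_pV2 ?posrE// (lt_le_trans n0').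
  by rewrite expr2 mulrA divff ?lt0r_neq0// mul1r; near: n; exact: near_inv.
Unshelve. all: by end_near. Qed.

Lemma window_part (x x' : nat -> R) (a b c delta : R) :
  (forall n, (0 < n)%N -> 0 <= x' n <= x n) ->
  [/\ 0 < a < 1, b < 1 - ln (2 - a) / ln 2, 0 < c & 0 < delta] ->
  (forall n, (0 < n)%N ->
     (a%:E <= (eps n)%:E *
       ereal_inf [set ((g (y - mu n) - g (- y - mu n))
                        / (f y + eps n * g (y - mu n)))%:E
                 | y in `[x' n, (x' n + c)%R]])%E) ->
  (forall n, (0 < n)%N ->
     ((delta * (n%:R `^ (- b)))%:E <=
       ereal_inf [set (f y + eps n * g (y - mu n))%:E
                 | y in `[x' n, (x' n + c)%R]])%E) ->
  asymptotically_powerful P0 P1 L.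
Proof.
move=> hx [a01 hb c0 d0] h1 h2.
have /andP[a0 a1] := a01.
(* Normalization for [window_rate]: a negative [b] is raised to 0 and [delta] is lowered so that
   [dl * c <= 1]. Both only weaken the lower bound on the density, and the condition on [b] survives
   at 0 because 2 - a < 2. *)
pose b' := Num.max b 0; pose dl := Num.min delta c^-1.
have b'0 : 0 <= b' by rewrite le_max lexx orbT.
have b'b : b <= b' by rewrite le_max lexx.
have ln2 := ln2_bounds R.
have hb' : ln (2 - a) / ln 2 < 1 - b'.
  rewrite /b' maxEle; case: ifP => _; last lra.
  rewrite subr0 ltr_pdivrMr; last by have /andP[] := ln2; lra.
  by rewrite mul1r ltr_ln ?posrE//; lra.
have dl0 : 0 < dl by rewrite lt_min d0 invr_gt0.
have dld : dl <= delta by rewrite ge_min lexx.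
pose kap := dl * c.
have kap01 : 0 < kap <= 1.
  by rewrite /kap mulr_gt0//= -ler_pdivlMr// div1r ge_min lexx orbT.
apply: (@powerful_of_threshold (window_length a b')) => [e e0||e e0].
- exact: window_length_null.
- by near=> n.
near=> n.
have n0 : (0 < n)%N by near: n; exact: nat_gt0.
have eps2 : eps n <= 1 / 2 by near: n; apply: eps_le; lra.
have rate : forall t, 0 <= t <= 1 / 2 ->
    exists N0 q, (q * window_length a b' n <= N0)%N /\
      2 ^+ N0 * (1 - (1 - t) * (kap * expR (- (b' * ln n%:R))) / 2) ^+ n
        + (1 - (2 - a)^-1 ^+ window_length a b' n) ^+ q <= e.
  by near: n; exact: window_rate.
have /andP[e_gt0 e_le1] := eps_bounds n0.
have [N0 [q [qN le]]] : exists N0 q, (q * window_length a b' n <= N0)%N /\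
      2 ^+ N0 * (1 - (1 - eps n) * (kap * expR (- (b' * ln n%:R))) / 2) ^+ n
        + (1 - (2 - a)^-1 ^+ window_length a b' n) ^+ q <= e.
  by apply: rate; rewrite ltW.
apply: le_trans le.
have D0 y : 0 < f y + eps n * g (y - mu n) by rewrite addr_gt0// mulr_gt0.
have /andP[x'0 _] := hx n n0.
have in_window y : x' n < y <= x' n + c -> `[x' n, x' n + c]%classic y.
  by move=> /andP[y1 y2]; rewrite /= in_itv/= y2 ltW.
have dens y : x' n < y <= x' n + c -> dl * expR (- (b' * ln n%:R)) <= f y + eps n * g (y - mu n).
  move=> /in_window yw; have := le_trans (h2 n n0) (ereal_inf_lbound (imageP _ yw)).
  rewrite lee_fin powR_natE//; apply: le_trans.
  by apply: (ler_pM (ltW dl0) (expR_ge0 _) dld); rewrite ler_expR mulNr lerN2 ler_wpM2r// ln_ge0// ler1n.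
have prob y : x' n < y <= x' n + c ->
    a * (f y + eps n * g (y - mu n)) <= eps n * (g (y - mu n) - g (- y - mu n)).
  move=> /in_window yw.
  have e0' : (0 <= (eps n)%:E)%E by rewrite lee_fin ltW.
  have := le_trans (h1 n n0) (lee_wpmul2l e0' (ereal_inf_lbound (imageP _ yw))).
  by rewrite -EFinM lee_fin mulrA ler_pdivlMr.
have := longest_run_window F_continuous G_continuous F_symmetric F_density G_density
  _ n0 (H1 n0) x'0 _ a01 _ prob dens qN.
rewrite ltW//= => /(_ e_le1); rewrite lerDl (ltW c0) => /(_ isT).
rewrite mulr_ge0 ?expR_ge0 ?(ltW dl0)// => /(_ isT) /le_trans; apply.
rewrite (_ : dl * _ * (x' n + c - x' n) = kap * expR (- (b' * ln n%:R)))//.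
by rewrite /kap; ring.
Unshelve. all: by end_near. Qed.

End testing.

Theorem proposition9 (R : realType)
  (F G : cumulativeBounded (0 : R) (1 : R)) (f g : R -> R)
  (F_continuous : continuous F) (G_continuous : continuous G)
  (F_symmetric : forall x : R, F (- x) = 1 - F x)
  (G_median : G 0 = 1 / 2)
  (F_density : is_density F f) (G_density : is_density G g)
  (f_pos : forall x : R, 0 < f x) (g_pos : forall x : R, 0 < g x)
  (eps mu : nat -> R)
  (eps_bounds : forall n, (0 < n)%N -> 0 < eps n <= 1)
  (eps_cvg0 : eps n @[n --> \oo] --> (0 : R))
  (mu_pos : forall n, (0 < n)%N -> 0 < mu n)
  (d : nat -> measure_display) (T : forall n, measurableType (d n))
  (P0 P1 : forall n, probability (T n) R)
  (X : forall n, 'I_n -> {mfun T n >-> R})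
  (H0 : forall n, (0 < n)%N -> iid_with_cdf (P0 n) (X n) F)
  (H1 : forall n, (0 < n)%N ->
    iid_with_cdf (P1 n) (X n) (contaminated_cdf F G (eps n) (mu n))) :
  let L := fun n => longest_run_statistic (X n) in
  ((exists x : nat -> R,
      tails_vanish F G eps mu x /\
      ((eps n * ln n%:R)%:E *
        ereal_sup [set (Num.max (g (y - mu n) - g (- y - mu n)) 0
                         / (f y + eps n * g (y - mu n)))%:E | y in `[0%R, x n]])%E
        @[n --> \oo] --> 0%:E) ->
    asymptotically_powerless P0 P1 L) /\
  (((exists x : nat -> R,
       [/\ n%:R * (1 - F (x n)) @[n --> \oo] --> (0 : R),
           n%:R * eps n * G (- x n - mu n) @[n --> \oo] --> (0 : R) &
           dominates (fun n => n%:R * eps n * (1 - G (x n - mu n)))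
                     (fun n => ln n%:R)])
    \/
    (exists x x' : nat -> R, exists a b c delta : R,
       [/\ tails_vanish F G eps mu x,
           forall n, (0 < n)%N -> 0 <= x' n <= x n,
           [/\ 0 < a < 1, b < 1 - ln (2 - a) / ln 2, 0 < c & 0 < delta],
           forall n, (0 < n)%N ->
             (a%:E <= (eps n)%:E *
               ereal_inf [set ((g (y - mu n) - g (- y - mu n))
                                / (f y + eps n * g (y - mu n)))%:E
                         | y in `[x' n, (x' n + c)%R]])%E &
           forall n, (0 < n)%N ->
             ((delta * (n%:R `^ (- b)))%:E <=
               ereal_inf [set (f y + eps n * g (y - mu n))%:E
                         | y in `[x' n, (x' n + c)%R]])%E])) ->
    asymptotically_powerful P0 P1 L).
Proof.
split=> [[x [tails sup0]]|[[x [t1 t2 t3]]|[x [x' [a [b [c [delta [_ hx hc h1 h2]]]]]]]]].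
- exact: (powerless_part F_continuous G_continuous F_symmetric G_median F_density G_density
    f_pos g_pos eps_bounds eps_cvg0 mu_pos H0 H1 tails sup0).
- exact: (outliers_part F_continuous G_continuous F_symmetric F_density G_density
    g_pos eps_bounds H0 H1 t1 t2 t3).
- exact: (window_part F_continuous G_continuous F_symmetric F_density G_density
    f_pos g_pos eps_bounds eps_cvg0 H0 H1 hx hc h1 h2).
Qed.
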